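(* Consider the 1SPSA recursion $\theta_{n+1}=\theta_n-\alpha_{n+1}\frac{1}{\epsilon(\theta_n)}\xi_{n+1}\Gamma(\theta_n+\epsilon(\theta_n)\xi_{n+1})$, $\theta_0\in\mathbb{R}^d$, with step-size $\alpha_n=\min\{\alpha,n^{-\rho}\}$, where $\rho\in(1/2,1)$ and $\alpha>0$, and with state-dependent exploration gain $\epsilon(\cdot)$ of either of the two forms in the context, with parameter $\epsilon_\bullet>0$. Let $\beta_N=\frac1N\sum_{n=0}^{N-1}\bar f(\theta_n)$. Suppose (A2) and (A4) hold. (i) If (A3i) holds (i.i.d. exploration), there are $\alpha_0>0$, $\epsilon_\bullet^0>0$ and $b_0\in(0,\infty)$ such that for all $\alpha\in(0,\alpha_0]$ and $\epsilon_\bullet\in(0,\epsilon_\bullet^0)$, $$\lim_{N\to\infty}N\,\mathrm{trace}(\mathrm{Cov}(\beta_N))\ \ge\ b_0\,\frac{1}{\epsilon_\bullet^2}\,[\Gamma(\theta^* )]^2 .$$ (ii) If (A3ii) holds (zig-zag exploration), there are $\alpha_0>0$, $\epsilon_\bullet^0>0$ and $b_1<\infty$ such that for all $\alpha\in(0,\alpha_0]$ and $\epsilon_\bullet\in(0,\epsilon_\bullet^0)$, $$\lim_{N\to\infty}N\,\mathrm{trace}(\mathrm{Cov}(\beta_N))\ \le\ b_1\,\epsilon_\bullet^2 .$$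
   Context: Setting. $\Gamma:\mathbb{R}^d\to\mathbb{R}$ is an objective function. Exploration gain: $\epsilon:\mathbb{R}^d\to(0,\infty)$ is one of the following two functions, with $\epsilon_\bullet>0$ fixed: (a) $\epsilon(\theta)=\epsilon_\bullet\sqrt{1+\|\theta-\theta^{\rm ctr}\|^2/\sigma_p^2}$ with $\theta^{\rm ctr}\in\mathbb{R}^d$ and $\sigma_p>0$ fixed; or (b) $\epsilon(\theta)=\epsilon_\bullet\sqrt{1+\Gamma(\theta)-\Gamma^-}$, where $\Gamma^-\in\mathbb{R}$ is such that $\Gamma(\theta)\ge\Gamma^-$ for all $\theta$. Assumptions: (A2) $\Gamma$ is twice continuously differentiable, its first and second derivatives are globally Lipschitz continuous, and there is $\delta>0$ such that $\|\nabla\Gamma(\theta)\|\ge\delta\|\theta\|$ whenever $\|\theta\|\ge\delta^{-1}$. (A3) $\{W_n:n\ge0\}$ is a zero-mean i.i.d. sequence taking values in a compact subset of $\mathbb{R}^d$, with $\mathsf{E}[W_n^iW_n^jW_n^k]=0$ for all $1\le i\le j\le k\le d$ (superscripts denote components) and $\Sigma_W=\mathsf{E}[W_nW_n^\intercal]>0$ (positive definite). The exploration sequence is, for $n\ge1$, either (A3i) i.i.d.: $\xi_n=W_n$; or (A3ii) zig-zag: $\xi_n=\varsigma[W_n-W_{n-1}]$ with a constant $\varsigma>0$. (A4) The gradient flow $\frac{d}{dt}x_t=-\nabla\Gamma(x_t)$ is globally exponentially asymptotically stable, with $\theta^{\rm opt}$ its unique stationary point, and $\nabla^2\Gamma(\theta^{\rm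 opt})$ is positive definite. (Exponential asymptotic stability to $\theta^{\rm opt}$: there are $b<\infty$, $\varrho>0$ with $\|x_t-\theta^{\rm opt}\|\le b\|x_0-\theta^{\rm opt}\|e^{-\varrho t}$ for all $t\ge0$ and all $x_0$.) Mean vector field: $f(\theta,\xi)=-\xi\,\Gamma(\theta+\epsilon(\theta)\xi)/\epsilon(\theta)$ and $\bar f(\theta)=\mathsf{E}[f(\theta,\xi)]$, with $\xi$ distributed as $\xi_n$. For all sufficiently small $\epsilon_\bullet>0$ there is a unique $\theta^*\in\mathbb{R}^d$ (depending on $\epsilon_\bullet$) with $\bar f(\theta^* )=0$; this is the $\theta^*$ in the claim. The random vector $\beta_N$ is called the empirical target bias. *)

(* Defs.v *)
From HB Require Import structures.
From mathcomp Require Import all_boot all_order all_algebra.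
From mathcomp Require Import all_classical all_reals all_analysis.
Import Order.TTheory GRing.Theory Num.Theory.
Import numFieldNormedType.Exports.

Set Implicit Arguments.
Unset Strict Implicit.
Unset Printing Implicit Defensive.

Local Open Scope classical_set_scope.
Local Open Scope ring_scope.

(* Points of R^d are row vectors.  The library norm on ['rV[R]_d] is the sup
   norm; it is used only in norm-independent notions (differentiability,
   continuity, compactness, existence of a Lipschitz constant).  The norms that
   appear in formulas are [enorm]. *)

Section Deterministic.
Variables (R : realType) (d : nat).
Implicit Types (Gam : 'rV[R]_d -> R) (theta : 'rV[R]_d).

Definition enorm (v : 'rV[R]_d) : R := Num.sqrt (\sum_(i < d) v 0 i ^+ 2).

Definition grad Gam theta : 'rV[R]_d := \row_i 'D_(delta_mx 0 i) Gam theta.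

Definition hess Gam theta : 'M[R]_d := 'J (grad Gam) theta.

Definition posdef (M : 'M[R]_d) : Prop :=
  forall v : 'rV[R]_d, v != 0 -> 0 < (v *m M *m v^T) 0 0.

Definition smooth_objective Gam : Prop :=
  [/\ forall theta, differentiable Gam theta,
      forall theta, differentiable (grad Gam) theta,
      continuous (hess Gam),
      lipschitz (grad Gam) /\ lipschitz (hess Gam) &
      exists2 delta : R, 0 < delta & forall theta,
        delta^-1 <= enorm theta -> delta * enorm theta <= enorm (grad Gam theta)].

Definition gradient_flow Gam (x : R -> 'rV[R]_d) : Prop :=
  {within `[0, +oo[, continuous x} /\
  forall t : R, 0 < t -> is_derive t 1 x (- grad Gam (x t)).

Definition stable_gradient_flow Gam (theta_opt : 'rV[R]_d) : Prop :=
  [/\ exists b rate : R, 0 < rate /\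
        forall x, gradient_flow Gam x -> forall t : R, 0 <= t ->
          enorm (x t - theta_opt) <=
            b * enorm (x 0 - theta_opt) * expR (- (rate * t)),
      forall theta, grad Gam theta = 0 <-> theta = theta_opt &
      posdef (hess Gam theta_opt)].

Inductive gain_form :=
  | DistanceGain of 'rV[R]_d & R  (* center and sigma_p *)
  | ObjectiveGain of R.           (* lower bound Gamma^- of the objective *)

Definition gain_ok Gam (g : gain_form) : Prop :=
  match g with
  | DistanceGain _ sigma_p => 0 < sigma_p
  | ObjectiveGain Gam_min => forall theta, Gam_min <= Gam theta
  end.

Definition gain Gam (g : gain_form) (eps0 : R) theta : R :=
  match g with
  | DistanceGain ctr sigma_p =>
      eps0 * Num.sqrt (1 + enorm (theta - ctr) ^+ 2 / sigma_p ^+ 2)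
  | ObjectiveGain Gam_min => eps0 * Num.sqrt (1 + Gam theta - Gam_min)
  end.

Definition spsa_field Gam (eps : 'rV[R]_d -> R) theta (xi : 'rV[R]_d)
    : 'rV[R]_d :=
  - ((Gam (theta + eps theta *: xi) / eps theta) *: xi).

Definition step_size (alpha rho : R) (n : nat) : R :=
  Num.min alpha (n%:R `^ (- rho)).

End Deterministic.

Section Stochastic.
Context {disp : measure_display} {T : measurableType disp} {R : realType}.
Variables (d : nat) (P : probability T R).
Implicit Types (X : T -> 'rV[R]_d) (W xi : nat -> T -> 'rV[R]_d).

Definition borel_rV (B : set 'rV[R]_d) : Prop := <<s [set U | open U] >> B.

Definition random_vector X : Prop :=
  forall B, borel_rV B -> measurable (X @^-1` B).

Definition iid W : Prop :=
  [/\ forall n, random_vector (W n),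
      forall n B, borel_rV B -> P (W n @^-1` B) = P (W 0%N @^-1` B) &
      forall (s : seq nat) (B : nat -> set 'rV[R]_d), uniq s ->
        (forall n, borel_rV (B n)) ->
        P (\bigcap_(n in [set` s]) (W n @^-1` B n)) =
          (\prod_(n <- s) P (W n @^-1` B n))%E].

Definition second_moment_mx X : 'M[R]_d :=
  \matrix_(i, j) fine 'E_P[(fun w => X w 0 i * X w 0 j)%R]%E.

Definition cov_mx X : 'M[R]_d :=
  \matrix_(i, j) fine (covariance P (fun w => X w 0 i) (fun w => X w 0 j)).

Definition exploration_noise W : Prop :=
  [/\ iid W,
      exists2 K : set 'rV[R]_d, compact K & forall n w, K (W n w),
      forall n i, 'E_P[(fun w => W n w 0 i)%R]%E = 0%E,
      forall n (i j k : 'I_d), (i <= j <= k)%N ->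
        'E_P[(fun w => W n w 0 i * W n w 0 j * W n w 0 k)%R]%E = 0%E &
      forall n, posdef (second_moment_mx (W n))].

(* Only the values at n >= 1 of an exploration sequence are ever used. *)
Definition zigzag (zeta : R) W : nat -> T -> 'rV[R]_d :=
  fun n w => zeta *: (W n w - W n.-1 w).

Variables (Gam : 'rV[R]_d -> R) (eps : 'rV[R]_d -> R).

(* The law of [xi n] does not depend on n >= 1; index 1 is a representative. *)
Definition mean_field xi (theta : 'rV[R]_d) : 'rV[R]_d :=
  \row_i fine 'E_P[(fun w => spsa_field Gam eps theta (xi 1%N w) 0 i)%R]%E.

Fixpoint spsa xi (a : nat -> R) (theta0 : 'rV[R]_d) (n : nat) (w : T)
    : 'rV[R]_d :=
  if n is m.+1 then
    let theta := spsa xi a theta0 m w in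
    theta - (a m.+1 * (1 / eps theta)
             * Gam (theta + eps theta *: xi m.+1 w)) *: xi m.+1 w
  else theta0.

Definition target_bias xi (a : nat -> R) (theta0 : 'rV[R]_d) (N : nat) (w : T)
    : 'rV[R]_d :=
  N%:R^-1 *: \sum_(n < N) mean_field xi (spsa xi a theta0 n w).

End Stochastic.

(* Main.v *)
(* Theta_star is a zero of the mean field at distance O(e) from theta_opt, and the Bregman
   divergence of Gamma at theta_star is a Lyapunov function for the recursion, so that
   E |theta_n - theta_star|^2 = O(alpha_n).  Solving a Poisson equation (explicitly, as the noise
   has memory one) turns the sum of fbar(theta_n) into minus a martingale plus remainders; summation
   by parts with weights 1/alpha_n and the moment bound show that the remainders are o(N) in
   mean square.  Hence N trace(Cov(beta_N)) converges to E |Delta|^2, where Delta is the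
   martingale increment at theta_star.  For i.i.d. probing Delta is the field itself, of size
   Gamma/e; for zig-zag probing its term of order 1/e telescopes, and Delta = O(e).

   Independence is used through one identity, EW_tower, proved for functionals that are
   Lipschitz in finitely many samples by discretising the last sample. *)
Require Import Defs.
From mathcomp Require Import all_boot all_order all_algebra.
From mathcomp Require Import ring lra.
From mathcomp Require Import all_classical all_reals all_analysis.
From mathcomp Require Import measurable_realfun lebesgue_integral.
Import Order.TTheory GRing.Theory Num.Theory.
Import numFieldNormedType.Exports.
Set Implicit Arguments.
Unset Strict Implicit.
Unset Printing Implicit Defensive.
Local Open Scope classical_set_scope.
Local Open Scope ring_scope.

(** * The Euclidean norm *)

(** Both designs are one recursion whose probe is a linear combination of two consecutive samples.
    As the gain grows at least linearly in the distance to [opt], dividing by it turns an objective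
    of quadratic growth into a field that is globally Lipschitz in the state, so the recursion can
    be analysed without localisation. The divergence is centred at the zero of the mean field rather
    than at the minimiser: its gradient vanishes exactly where the drift does, whereas the gap
    [G x - G opt] would only confine the iterates to a ball of radius O(e). Memory one correlates
    the state with the older sample that the field sees; passing to the previous state removes the
    correlation at a cost O(alpha_n) in the drift. The summation by parts is harmless because 1/(N
    alpha_N) and the square of the sum of the alpha_n, divided by N, both vanish when 1/2 < rho < 1.
    The dependence on e is not tracked along the recursion: e is fixed while N grows, and only the
    limiting variance is estimated for small e. *)

Lemma cvg_sumr (R : numFieldType) (V : normedModType R) (T I : Type)
    (F : set_system T) (r : seq I) (f : I -> T -> V) (l : I -> V) : Filter F ->
  (forall i, f i x @[x --> F] --> l i) ->
  \sum_(i <- r) f i x @[x --> F] --> \sum_(i <- r) l i.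
Proof.
move=> FF fl; elim: r => [|i r IH].
  by under eq_fun do rewrite big_nil; rewrite big_nil; exact: cvg_cst.
under eq_fun do rewrite big_cons.
by rewrite big_cons; apply: cvgD.
Qed.

Lemma continuous_sumr (R : numFieldType) (V : normedModType R)
    (T : topologicalType) (I : Type) (r : seq I) (f : I -> T -> V) :
  (forall i, continuous (f i)) -> continuous (fun x => \sum_(i <- r) f i x).
Proof. by move=> fc x; apply: cvg_sumr => i; exact: fc. Qed.

Lemma eq_ler (R : numDomainType) (x y : R) : x = y -> x <= y.
Proof. by move=> ->. Qed.

Section Euclidean.
Variables (R : realType) (d : nat).
Implicit Types (u v w : 'rV[R]_d) (M : 'M[R]_d).

Definition dotv u v : R := \sum_(i < d) u 0 i * v 0 i.

Lemma dotvC u v : dotv u v = dotv v u.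
Proof. by apply: eq_bigr => i _; rewrite mulrC. Qed.

Lemma dotvDl u v w : dotv (u + v) w = dotv u w + dotv v w.
Proof. by rewrite -big_split; apply: eq_bigr => i _; rewrite mxE mulrDl. Qed.

Lemma dotvZl (a : R) u v : dotv (a *: u) v = a * dotv u v.
Proof. by rewrite mulr_sumr; apply: eq_bigr => i _; rewrite mxE mulrA. Qed.

Lemma dotvDr u v w : dotv u (v + w) = dotv u v + dotv u w.
Proof. by rewrite dotvC dotvDl !(dotvC u). Qed.

Lemma dotvZr (a : R) u v : dotv u (a *: v) = a * dotv u v.
Proof. by rewrite dotvC dotvZl dotvC. Qed.

Lemma dotvNl u v : dotv (- u) v = - dotv u v.
Proof. by rewrite -scaleN1r dotvZl mulN1r. Qed.

Lemma dotvNr u v : dotv u (- v) = - dotv u v.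
Proof. by rewrite dotvC dotvNl dotvC. Qed.

Lemma dotvBl u v w : dotv (u - v) w = dotv u w - dotv v w.
Proof. by rewrite dotvDl dotvNl. Qed.

Lemma dotvBr u v w : dotv u (v - w) = dotv u v - dotv u w.
Proof. by rewrite dotvDr dotvNr. Qed.

Lemma dot0v v : dotv 0 v = 0.
Proof. by rewrite -(scale0r 0) dotvZl mul0r. Qed.

Lemma dotv0 v : dotv v 0 = 0.
Proof. by rewrite dotvC dot0v. Qed.

Lemma dotv_delta v (i : 'I_d) : dotv v (delta_mx 0 i) = v 0 i.
Proof.
rewrite /dotv (bigD1 i) //= mxE !eqxx mulr1 big1 ?addr0// => j /negbTE ji.
by rewrite mxE ji andbF mulr0.
Qed.

Lemma dotv_mulmx v M w : (v *m M *m w^T) 0 0 = dotv (v *m M) w.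
Proof. by rewrite mxE; apply: eq_bigr => i _; rewrite [w^T _ _]mxE. Qed.

Lemma dotvv_ge0 v : 0 <= dotv v v.
Proof. by apply: sumr_ge0 => i _; rewrite -expr2 sqr_ge0. Qed.

Lemma enorm_ge0 v : 0 <= enorm v.
Proof. exact: sqrtr_ge0. Qed.

Lemma enorm_sqr v : enorm v ^+ 2 = dotv v v.
Proof.
rewrite sqr_sqrtr; first by apply: eq_bigr => i _; rewrite expr2.
by apply: sumr_ge0 => i _; rewrite sqr_ge0.
Qed.

Lemma enorm_coord v i : `|v 0 i| <= enorm v.
Proof.
rewrite -sqrtr_sqr ler_wsqrtr// (bigD1 i) //= lerDl.
by apply: sumr_ge0 => j _; rewrite sqr_ge0.
Qed.

Lemma enorm_eq0 v : (enorm v == 0) = (v == 0).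
Proof.
apply/eqP/eqP => [v0|->]; last first.
  by rewrite /enorm big1 ?sqrtr0// => i _; rewrite mxE expr0n.
apply/rowP => i; rewrite mxE; apply/eqP; rewrite -normr_eq0 eq_le normr_ge0.
by rewrite -v0 enorm_coord.
Qed.

Lemma enorm0 : enorm (0 : 'rV[R]_d) = 0.
Proof. by apply/eqP; rewrite enorm_eq0. Qed.

Lemma enorm_gt0 v : (0 < enorm v) = (v != 0).
Proof. by rewrite lt_def enorm_ge0 andbT enorm_eq0. Qed.

Lemma enormZ (a : R) v : enorm (a *: v) = `|a| * enorm v.
Proof.
apply/eqP; rewrite -(eqrXn2 (n := 2))// ?mulr_ge0 ?enorm_ge0//.
by rewrite exprMn !enorm_sqr dotvZl dotvZr mulrA real_normK ?num_real.
Qed.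

Lemma enormN v : enorm (- v) = enorm v.
Proof. by rewrite -scaleN1r enormZ normrN1 mul1r. Qed.

Lemma enormB u v : enorm (u - v) = enorm (v - u).
Proof. by rewrite -enormN opprB. Qed.

Lemma ler_dotv u v : dotv u v <= enorm u * enorm v.
Proof.
have [->|v0] := eqVneq v 0; first by rewrite dotv0 mulr_ge0 ?enorm_ge0.
have [->|u0] := eqVneq u 0; first by rewrite dot0v mulr_ge0 ?enorm_ge0.
have := dotvv_ge0 (enorm v *: u - enorm u *: v).
rewrite dotvBl !dotvBr !dotvZl !dotvZr (dotvC v u) -!enorm_sqr.
have : 0 < enorm u * enorm v by rewrite mulr_gt0 ?enorm_gt0.
move: (enorm u) (enorm v) (dotv u v) => a b c ab0.
rewrite (_ : _ - _ = 2 * (a * b) * (a * b - c)); last by ring.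
by rewrite pmulr_rge0 ?subr_ge0// mulr_gt0.
Qed.

Lemma normr_dotv u v : `|dotv u v| <= enorm u * enorm v.
Proof.
rewrite ler_norml ler_dotv andbT lerNl -dotvNl.
by rewrite -{1}(enormN u) ler_dotv.
Qed.

Lemma enormD u v : enorm (u + v) <= enorm u + enorm v.
Proof.
rewrite -(ler_pXn2r (n := 2)) ?nnegrE ?addr_ge0 ?enorm_ge0//.
rewrite enorm_sqr dotvDl !dotvDr (dotvC v u) sqrrD -!enorm_sqr.
by have := ler_dotv u v; lra.
Qed.

Lemma enorm_triangle u v w : enorm (u - w) <= enorm (u - v) + enorm (v - w).
Proof. by rewrite -{1}(subrK v u) -addrA enormD. Qed.

Lemma enormD_sqr u v : enorm (u + v) ^+ 2 =
  enorm u ^+ 2 + 2 * dotv u v + enorm v ^+ 2.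
Proof. by rewrite !enorm_sqr dotvDl !dotvDr (dotvC v u); ring. Qed.

Lemma enorm_sum (I : Type) (r : seq I) (Q : pred I) (F : I -> 'rV[R]_d) :
  enorm (\sum_(i <- r | Q i) F i) <= \sum_(i <- r | Q i) enorm (F i).
Proof.
elim/big_ind2: _ => //; first by rewrite enorm0.
by move=> u a v b ua vb; rewrite (le_trans (enormD _ _))// lerD.
Qed.

Lemma mx_norm_enorm v : `|v| <= enorm v.
Proof.
rewrite [leLHS]mx_normrE; apply: bigmax_le; first exact: enorm_ge0.
by move=> [i j] _ /=; rewrite ord1 enorm_coord.
Qed.

Lemma coord_mx_norm (m n : nat) (A : 'M[R]_(m, n)) i j : `|A i j| <= `|A|.
Proof.
rewrite [leRHS]mx_normrE.
exact: (le_bigmax _ (fun ij : 'I_m * 'I_n => `|A ij.1 ij.2|) (i, j)).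
Qed.

Lemma enorm_le_coord (v : 'rV[R]_d) (a : R) : 0 <= a ->
  (forall i, `|v 0 i| <= a) -> enorm v <= d%:R * a.
Proof.
move=> a0 va; rewrite -(ler_pXn2r (n := 2)) ?nnegrE ?mulr_ge0 ?enorm_ge0//.
rewrite enorm_sqr (@le_trans _ _ (\sum_(i < d) a ^+ 2))//.
  by apply: ler_sum => i _; rewrite -expr2 -real_normK ?num_real// lerXn2r ?nnegrE.
rewrite sumr_const card_ord exprMn -[leLHS]mulr_natl; apply: ler_wpM2r.
  exact: sqr_ge0.
by rewrite -natrX ler_nat -mulnn; case: (d) => // n; exact: leq_pmulr.
Qed.

Lemma enorm_mx_norm v : enorm v <= d%:R * `|v|.
Proof. by apply: enorm_le_coord => // i; exact: coord_mx_norm. Qed.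

Lemma enorm_mulmx v M : enorm (v *m M) <= d%:R ^+ 2 * `|M| * enorm v.
Proof.
rewrite expr2 -!mulrA; apply: enorm_le_coord => [|i].
  by rewrite !mulr_ge0 ?enorm_ge0.
rewrite mxE (le_trans (ler_norm_sum _ _ _))//.
rewrite (@le_trans _ _ (\sum_(j < d) `|M| * enorm v))//; last first.
  by rewrite sumr_const card_ord -[leLHS]mulr_natl.
by apply: ler_sum => j _; rewrite normrM mulrC ler_pM ?enorm_coord ?coord_mx_norm.
Qed.

Lemma enorm_lip u v : `|enorm u - enorm v| <= enorm (u - v).
Proof.
have := enormD (u - v) v; have := enormD (v - u) u.
by rewrite !subrK (enormB v) ler_norml; lra.
Qed.

Lemma continuous_enorm : continuous (@enorm R d).
Proof.
move=> v; apply: (@continuous_comp _ _ _ (fun v : 'rV[R]_d => \sum_(i < d) v 0 i ^+ 2)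
  (@Num.sqrt R)); last exact: sqrt_continuous.
apply: continuous_sumr => i u; apply: (@continuousM _ _ (fun u : 'rV[R]_d => u 0 i));
  exact: coord_continuous.
Qed.

Lemma continuous_enormB (x : 'rV[R]_d) : continuous (fun y : 'rV[R]_d => enorm (y - x)).
Proof.
move=> y; apply: (@continuous_comp _ _ _ (fun y : 'rV[R]_d => y - x) (@enorm R d)).
  by apply: (@continuousB _ _ _ id (cst x)) => //; exact: cst_continuous.
exact: continuous_enorm.
Qed.

Lemma ball_enorm (x : 'rV[R]_d) (r : R) : 0 < r ->
  \forall y \near x, enorm (y - x) < r.
Proof.
move=> r0; have /cvgrPdist_lt/(_ _ r0) := @continuous_enormB x x.
rewrite subrr enorm0; apply: filterS => y; rewrite sub0r normrN.
by rewrite ger0_norm// enorm_ge0.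
Qed.

Lemma compact_enorm_ball (x : 'rV[R]_d) (r : R) :
  compact [set y | enorm (y - x) <= r].
Proof.
apply: bounded_closed_compact.
  exists (r + enorm x); split; first exact: num_real.
  move=> M rM y /= yr; rewrite (le_trans (mx_norm_enorm _))// (le_trans _ (ltW rM))//.
  by rewrite -{1}(subrK x y) (le_trans (enormD _ _))// lerD2r.
apply: (@closed_comp _ _ (fun y : 'rV[R]_d => enorm (y - x)) [set t | t <= r]).
  by move=> y _; exact: continuous_enormB.
exact: closed_le.
Qed.

Lemma posdef_lower M : posdef M ->
  exists2 c : R, 0 < c & forall v, c * enorm v ^+ 2 <= dotv (v *m M) v.
Proof.
move=> M0.
have quadC : continuous (fun v => dotv (v *m M) v).
  apply: continuous_sumr => i v.
  apply: (@continuousM _ _ (fun v : 'rV[R]_d => (v *m M) 0 i) (fun v => v 0 i));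
    last exact: coord_continuous.
  rewrite (_ : (fun u : 'rV[R]_d => (u *m M) 0 i) =
    (fun u => \sum_(j < d) u 0 j * M j i)); last first.
    by apply/funext => u; rewrite mxE.
  apply: continuous_sumr => j u; apply: (@continuousM _ _ (fun v : 'rV[R]_d => v 0 j)).
    exact: coord_continuous.
  exact: cst_continuous.
pose S := [set v : 'rV[R]_d | enorm v = 1].
have cS : compact S.
  apply: (subclosed_compact _ (@compact_enorm_ball 0 1)).
    apply: (@closed_comp _ _ (@enorm R d) [set t | t = 1]).
      by move=> v _; exact: continuous_enorm.
    exact: closed_eq.
  by move=> v /= v1; rewrite subr0 v1.
have unitS v : v != 0 -> S ((enorm v)^-1 *: v).
  by move=> v0; rewrite /S/= enormZ gtr0_norm ?invr_gt0 ?enorm_gt0// mulVf ?enorm_eq0.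
have [[w Sw]|S0] := pselect (S !=set0); last first.
  exists 1 => // v; have [->|/unitS Sv] := eqVneq v 0.
    by rewrite enorm0 dotv0 expr0n mulr0.
  by exfalso; apply: S0; eexists; exact: Sv.
have [|c] := @EVT_min_rV R d (fun v => dotv (v *m M) v) S (ex_intro _ w Sw) cS.
  exact: continuous_subspaceT.
rewrite inE => Sc cmin.
have c0 : c != 0.
  by apply/eqP => c0; move: Sc; rewrite /S/= c0 enorm0 => /eqP; rewrite eq_sym oner_eq0.
exists (dotv (c *m M) c); first by rewrite -dotv_mulmx M0.
move=> v; have [->|v0] := eqVneq v 0.
  by rewrite enorm0 dotv0 expr0n mulr0.
have := cmin _ (mem_set (unitS _ v0)).
rewrite -scalemxAl dotvZl dotvZr mulrA -expr2.
by rewrite exprVn mulrC ler_pdivlMr// exprn_gt0// enorm_gt0.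
Qed.

End Euclidean.

#[local] Hint Extern 0 (is_true (_ <= enorm _)) => exact: enorm_ge0 : core.
#[local] Hint Extern 0 (is_true (_ <= _ ^+ 2)) => exact: sqr_ge0 : core.

(** * Taylor expansions *)

Section Lines.
Variables (R : realType) (d : nat).
Implicit Types (u v x y : 'rV[R]_d).

Lemma is_derive_line (V : normedModType R) (f : 'rV[R]_d -> V) x u t :
  differentiable f (x + t *: u) ->
  is_derive t 1 (fun s : R => f (x + s *: u)) ('D_u f (x + t *: u)).
Proof.
move=> /diff_derivable => /(_ u) df.
have E : (fun h : R => h^-1 *: (((fun s : R => f (x + s *: u)) \o shift t) (h *: 1) -
     f (x + t *: u))) =
   (fun h : R => h^-1 *: ((f \o shift (x + t *: u)) (h *: u) - f (x + t *: u))).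
  apply/funext => h /=; congr (_ *: (f _ - _)).
  by rewrite scalerDl [h *: 1]mulr1 addrCA.
by apply: DeriveDef; [rewrite /derivable E|rewrite /derive E].
Qed.

Lemma is_derive_dotv (f : R -> 'rV[R]_d) (t : R) l v :
  is_derive t 1 f l -> is_derive t 1 (fun s => dotv (f s) v) (dotv l v).
Proof.
move=> [df Df].
have cd : continuous (fun w : 'rV[R]_d => dotv w v).
  apply: continuous_sumr => i w.
  apply: (@continuousM _ _ (fun w : 'rV[R]_d => w 0 i)); last exact: cst_continuous.
  exact: coord_continuous.
have E : (fun h : R => h^-1 *: (((fun s => dotv (f s) v) \o shift t) (h *: 1) - dotv (f t) v))
    = (fun h : R => dotv (h^-1 *: ((f \o shift t) (h *: 1) - f t)) v).
  by apply/funext => h /=; rewrite dotvZl dotvBl.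
have C : (fun h : R => dotv (h^-1 *: ((f \o shift t) (h *: 1) - f t)) v) @ 0^' --> dotv l v.
  apply: (@cvg_comp _ _ _ (fun h : R => h^-1 *: ((f \o shift t) (h *: 1) - f t))
    (fun w => dotv w v) _ (nbhs l)); last exact: cd.
  by rewrite -Df; exact: df.
by apply: DeriveDef; [rewrite /derivable E; apply/cvg_ex; exists (dotv l v)|
  rewrite /derive E; exact/cvg_lim].
Qed.

Lemma mvt01 (f df : R -> R) : (forall t, is_derive t (1 : R) f (df t)) ->
  exists2 t, 0 <= t <= 1 & f 1 - f 0 = df t.
Proof.
move=> fdf; have [|t] := @MVT_segment R f df 0 1 ler01 (fun t _ => fdf t).
  by apply: derivable_within_continuous => t _; case: (fdf t).
by rewrite in_itv/= subr0 mulr1 => t01 ->; exists t.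
Qed.

Lemma derive_grad (f : 'rV[R]_d -> R) x v :
  differentiable f x -> 'D_v f x = dotv (grad f x) v.
Proof.
move=> df; rewrite deriveE// {1}(row_sum_delta v) linear_sum; apply: eq_bigr => i _.
by rewrite linearZ/= mxE deriveE// mulrC.
Qed.

End Lines.

Section Taylor.
Variables (R : realType) (d : nat) (G : 'rV[R]_d -> R) (L H : R).
Hypothesis dG : forall x, differentiable G x.
Hypothesis dgG : forall x, differentiable (grad G) x.
Hypothesis gradL : forall x y, enorm (grad G x - grad G y) <= L * enorm (x - y).
Hypothesis hessL : forall x y u,
  enorm (u *m hess G x - u *m hess G y) <= H * enorm u * enorm (x - y).
Implicit Types (u v x y xi : 'rV[R]_d).

Lemma taylor1 x u : exists2 t : R, 0 <= t <= 1 &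
  G (x + u) - G x = dotv (grad G (x + t *: u)) u.
Proof.
have [|t t01] := @mvt01 R (fun s => G (x + s *: u)) (fun t => dotv (grad G (x + t *: u)) u).
  by move=> t; rewrite -derive_grad//; exact: is_derive_line.
by rewrite scale1r scale0r addr0 => E; exists t.
Qed.

Lemma taylor2 x u : 0 <= L ->
  `|G (x + u) - G x - dotv (grad G x) u| <= L * enorm u ^+ 2.
Proof.
move=> L0; have [t /andP[t0 t1] ->] := taylor1 x u.
rewrite -dotvBl (le_trans (normr_dotv _ _))// expr2 mulrA ler_wpM2r//.
rewrite (le_trans (gradL _ _))// ler_wpM2l// addrAC subrr add0r enormZ ger0_norm//.
by rewrite ler_piMl.
Qed.

Lemma is_derive_grad_line x u (t : R) :
  is_derive t (1 : R) (fun s => grad G (x + s *: u)) (u *m hess G (x + t *: u)).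
Proof.
have := is_derive_line (dgG (x + t *: u)).
by rewrite (deriveEjacobian u (dgG (x + t *: u))).
Qed.

Lemma grad_mvt x u v : exists2 t : R, 0 <= t <= 1 &
  dotv (grad G (x + u) - grad G x) v = dotv (u *m hess G (x + t *: u)) v.
Proof.
have [|t t01] := @mvt01 R (fun s => dotv (grad G (x + s *: u)) v)
    (fun t => dotv (u *m hess G (x + t *: u)) v).
  by move=> t; apply: is_derive_dotv; exact: is_derive_grad_line.
by rewrite scale1r scale0r addr0 -dotvBl => E; exists t.
Qed.

(** Error of the one-sided difference quotient of step [s] along [xi]; averaged against the probe it
    becomes the bias of the mean field. *)
Definition taylor_rem x (s : R) xi := (G (x + s *: xi) - G x) / s - dotv (grad G x) xi.

Lemma taylor_rem_bound x s xi : 0 <= L -> 0 < s ->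
  `|taylor_rem x s xi| <= L * s * enorm xi ^+ 2.
Proof.
move=> L0 s0; have := taylor2 x (s *: xi) L0.
have -> : taylor_rem x s xi = (G (x + s *: xi) - G x - dotv (grad G x) (s *: xi)) / s.
  by rewrite /taylor_rem dotvZr; field; rewrite gt_eqF.
rewrite normrM normfV [X in _ / X]gtr0_norm// ler_pdivrMr// => /le_trans; apply.
by rewrite enormZ exprMn real_normK ?num_real// expr2; lra.
Qed.

(** Up to its linear part, [s] times the difference is a second difference of [G] in the directions
    [s *: xi] and [x - y]. Two mean value arguments, one per direction, turn it into a difference of
    Hessians at points [t *: (s *: xi)] apart, which supplies the factor [s]. *)
Lemma taylor_rem_lip x y s xi : 0 <= H -> 0 < s ->
  `|taylor_rem x s xi - taylor_rem y s xi| <= H * s * enorm xi ^+ 2 * enorm (x - y).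
Proof.
move=> H0 s0; set u := s *: xi.
(* The increment of this function over [0, 1] is [s] times the difference of the two remainders. *)
have [|t /andP[t0 t1]] := @mvt01 R
   (fun r => G (x + r *: u) - G (y + r *: u) - r * dotv (grad G x - grad G y) u)
   (fun r => dotv (grad G (x + r *: u)) u - dotv (grad G (y + r *: u)) u
             - dotv (grad G x - grad G y) u).
  move=> r; apply: is_deriveB; first apply: is_deriveB.
  - by rewrite -derive_grad//; exact: is_derive_line.
  - by rewrite -derive_grad//; exact: is_derive_line.
  - have -> : (fun r => r * dotv (grad G x - grad G y) u) =
       (dotv (grad G x - grad G y) u) \*: id by apply/funext => a /=; rewrite mulrC.
    have := @is_deriveZ R R R id (dotv (grad G x - grad G y) u) r 1 1 (is_derive_id _ _).
    by rewrite [_ *: 1]mulr1.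
rewrite !scale1r !scale0r !addr0 mul1r mul0r subr0.
have [|r /andP[r0 r1]] := @mvt01 R
   (fun r => dotv (grad G (y + t *: u + r *: (x - y))) u - dotv (grad G (y + r *: (x - y))) u)
   (fun r => dotv ((x - y) *m hess G (y + t *: u + r *: (x - y))) u
            - dotv ((x - y) *m hess G (y + r *: (x - y))) u).
  by move=> r; apply: is_deriveB; apply: is_derive_dotv; exact: is_derive_grad_line.
have xyu : y + t *: u + (x - y) = x + t *: u by rewrite addrAC subrKC.
rewrite !scale1r !scale0r !addr0 xyu subrKC => E1 E2.
have E : taylor_rem x s xi - taylor_rem y s xi = s^-1 *
   dotv ((x - y) *m hess G (y + t *: u + r *: (x - y)) -
         (x - y) *m hess G (y + r *: (x - y))) u.
  rewrite [dotv (_ - _) u]dotvBl /taylor_rem -/u -{}E1.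
  have ux z : dotv (grad G z) u = s * dotv (grad G z) xi by rewrite dotvZr.
  move: E2; rewrite !dotvBl !ux.
  move: (G (x + u)) (G (y + u)) (G x) (G y) (dotv (grad G x) xi) (dotv (grad G y) xi).
  move=> a b c e f g E2.
  apply: (@mulfI _ s); first by rewrite gt_eqF.
  rewrite [RHS]mulrA divff ?gt_eqF// mul1r.
  transitivity (a - c - (b - e) - s * (f - g)); first by field; rewrite gt_eqF.
  by move: E2; lra.
rewrite E normrM gtr0_norm ?invr_gt0// mulrC ler_pdivrMr//.
rewrite (le_trans (normr_dotv _ _))//.
rewrite (le_trans (ler_wpM2r (enorm_ge0 _) (hessL _ _ _)))//.
rewrite (_ : y + _ + _ - _ = t *: u); last first.
  by apply/eqP; rewrite subr_eq addrAC addrC addrA.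
rewrite !enormZ !ger0_norm ?(ltW s0)//.
have := mulr_ge0 (mulr_ge0 H0 (enorm_ge0 (x - y))) (sqr_ge0 (s * enorm xi)) => h.
move: h; move: (enorm (x - y)) (enorm xi) => a b h.
rewrite [leLHS](_ : _ = t * (H * a * (s * b) ^+ 2)); last by ring.
rewrite [leRHS](_ : _ = H * a * (s * b) ^+ 2); last by ring.
exact: ler_piMl.
Qed.

(** Needed because the probe length varies with the state. For [r <= s] the difference is
    [(s - r) / s] times a gradient increment less the remainder at [r]; both are O(s), so [s]
    cancels. *)
Lemma taylor_rem_step x s r xi : 0 <= L -> 0 < s -> 0 < r ->
  `|taylor_rem x s xi - taylor_rem x r xi| <= 2 * L * enorm xi ^+ 2 * `|s - r|.
Proof.
move=> L0.
wlog rs : s r / r <= s => [W s0 r0|s0 r0].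
  by case/orP: (le_total r s) => [|] h; [|rewrite distrC (distrC s)]; exact: W.
rewrite [X in _ * X]ger0_norm ?subr_ge0//.
have [t /andP[t0 t1] E] := taylor1 (x + r *: xi) ((s - r) *: xi).
have bnd : `|dotv (grad G (x + r *: xi + t *: ((s - r) *: xi)) - grad G x) xi|
     <= L * s * enorm xi ^+ 2.
  rewrite (le_trans (normr_dotv _ _))// expr2 mulrA ler_wpM2r//.
  rewrite (le_trans (gradL _ _))// -mulrA ler_wpM2l//.
  rewrite (_ : _ - x = (r + t * (s - r)) *: xi); last first.
    by rewrite scalerA addrAC [x + _]addrC addrK -scalerDl.
  rewrite enormZ.
  have sr : 0 <= s - r by rewrite subr_ge0.
  have := ler_piMl sr t1; have := mulr_ge0 t0 sr => tsr0 tsr.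
  rewrite ler_wpM2r// ger0_norm; lra.
have bndr := taylor_rem_bound x xi L0 r0.
set D := dotv _ xi in bnd.
have -> : taylor_rem x s xi - taylor_rem x r xi = (s - r) / s * (D - taylor_rem x r xi).
  move: E; rewrite -addrA -scalerDl subrKC dotvZr /D dotvBl /taylor_rem.
  move: (G (x + s *: xi)) (G (x + r *: xi)) (G x) (dotv (grad G x) xi) => a b c f.
  move: (dotv _ xi) => e E.
  have -> : a = b + (s - r) * e by move: E; lra.
  by field; rewrite !gt_eqF.
rewrite normrM ger0_norm ?divr_ge0 ?subr_ge0 ?(ltW s0)//.
have dr : `|D - taylor_rem x r xi| <= 2 * L * enorm xi ^+ 2 * s.
  rewrite (le_trans (ler_normB _ _))// (le_trans (lerD bnd bndr))//.
  have := mulr_ge0 L0 (sqr_ge0 (enorm xi)) => h.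
  by have := ler_wpM2l h rs; lra.
rewrite (le_trans (ler_wpM2l _ dr)) ?divr_ge0 ?subr_ge0 ?(ltW s0)//.
by apply: eq_ler; field; rewrite gt_eqF.
Qed.

End Taylor.

(** * The landscape of the objective *)

Section Landscape.
Local Opaque hess grad enorm dotv.
Variables (R : realType) (d : nat) (G : 'rV[R]_d -> R) (L H : R).
Hypothesis dG : forall x, differentiable G x.
Hypothesis dgG : forall x, differentiable (grad G) x.
Hypothesis L0 : 0 < L.
Hypothesis H0 : 0 <= H.
Hypothesis gradL : forall x y, enorm (grad G x - grad G y) <= L * enorm (x - y).
Hypothesis hessL : forall x y u,
  enorm (u *m hess G x - u *m hess G y) <= H * enorm u * enorm (x - y).
Variables (opt : 'rV[R]_d) (c0 delta : R).
Hypothesis gradE : forall x, grad G x = 0 <-> x = opt.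
Hypothesis c00 : 0 < c0.
Hypothesis hess_opt : forall v, c0 * enorm v ^+ 2 <= dotv (v *m hess G opt) v.
Hypothesis delta0 : 0 < delta.
Hypothesis far : forall x, delta^-1 <= enorm x -> delta * enorm x <= enorm (grad G x).
Implicit Types (x y u v : 'rV[R]_d).

Let grad_opt : grad G opt = 0. Proof. exact/gradE. Qed.

Let enorm_grad x : enorm (grad G x) <= L * enorm (x - opt).
Proof. by have := gradL x opt; rewrite grad_opt subr0. Qed.

(** Within this distance of [opt] the Hessian moves by at most half of its lower bound [c0]; the
    [+ 1] covers [H = 0]. *)
Definition mono_radius := c0 / (2 * (H + 1)).

Lemma mono_radius_gt0 : 0 < mono_radius.
Proof. by rewrite divr_gt0// mulr_gt0// ltr_wpDl. Qed.

Lemma hess_perturb u z : H * enorm (z - opt) <= c0 / 2 ->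
  c0 / 2 * enorm u ^+ 2 <= dotv (u *m hess G z) u.
Proof.
move=> hz; have h1 := ler_dotv (u *m hess G opt - u *m hess G z) u.
rewrite dotvBl in h1.
have h3 : enorm (u *m hess G opt - u *m hess G z) * enorm u <= c0 / 2 * enorm u ^+ 2.
  rewrite expr2 mulrA ler_wpM2r// (le_trans (hessL _ _ _))//.
  by rewrite mulrAC ler_wpM2r// enormB.
have := lerB (hess_opt u) (le_trans h1 h3).
by rewrite subKr -mulrBl (_ : c0 - c0 / 2 = c0 / 2)//; field.
Qed.

Lemma grad_mono x y :
  enorm (x - opt) <= mono_radius -> enorm (y - opt) <= mono_radius ->
  c0 / 2 * enorm (y - x) ^+ 2 <= dotv (grad G y - grad G x) (y - x).
Proof.
move=> xr yr; have [t /andP[t0 t1]] := grad_mvt dgG x (y - x) (y - x).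
rewrite subrKC => ->.
set z := x + _; set u := y - x.
have zr : enorm (z - opt) <= mono_radius.
  have -> : z - opt = (1 - t) *: (x - opt) + t *: (y - opt).
    by apply/rowP => i; rewrite /z !mxE; ring.
  rewrite (le_trans (enormD _ _))// !enormZ !ger0_norm ?subr_ge0//.
  have st0 : 0 <= 1 - t by rewrite subr_ge0.
  have := ler_wpM2l t0 yr; have := ler_wpM2l st0 xr; lra.
have hz : H * enorm (z - opt) <= c0 / 2.
  rewrite (le_trans (ler_wpM2l H0 zr))// /mono_radius mulrA ler_pdivrMr; last first.
    by rewrite mulr_gt0// ltr_wpDl.
  rewrite (_ : c0 / 2 * (2 * (H + 1)) = H * c0 + c0); last by field.
  by rewrite lerDl ltW.
exact: hess_perturb.
Qed.

(** Three regions: strong monotonicity near [opt], the growth assumption outside a large ball, and a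
    compact set in between that contains no zero of the gradient, so that its norm has a positive
    minimum there. *)
Lemma grad_lower : exists2 c : R, 0 < c & forall x, c * enorm (x - opt) <= enorm (grad G x).
Proof.
have r0 := mono_radius_gt0.
have near x : enorm (x - opt) <= mono_radius ->
    c0 / 2 * enorm (x - opt) <= enorm (grad G x).
  move=> xr; have [->|xo] := eqVneq x opt.
    by rewrite subrr enorm0 mulr0 enorm_ge0.
  have := @grad_mono opt x; rewrite subrr enorm0 grad_opt subr0 => /(_ (ltW r0) xr).
  move=> /le_trans /(_ (ler_dotv _ _)).
  by rewrite expr2 mulrA ler_pM2r// enorm_gt0 subr_eq0.
have [c1 c10 farc] : exists2 c : R, 0 < c & forall x, delta^-1 <= enorm x ->
    c * enorm (x - opt) <= enorm (grad G x).
  have D0 : 0 < 1 + delta * enorm opt by rewrite ltr_pwDl// mulr_ge0 ?enorm_ge0 ?ltW.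
  exists (delta / (1 + delta * enorm opt)); first exact: divr_gt0.
  move=> x xd; rewrite (le_trans _ (far xd))// -mulrA ler_wpM2l ?(ltW delta0)//.
  rewrite mulrC ler_pdivrMr// (le_trans (enormD _ _))// enormN mulrDr mulr1 lerD2l//.
  rewrite mulrA ler_peMl// mulrC -(mulfV (lt0r_neq0 delta0)).
  by rewrite ler_wpM2l// ltW.
pose K := [set x | enorm (x - 0) <= delta^-1] `&` [set x | mono_radius <= enorm (x - opt)].
have cK : compact K.
  apply: (@compact_closedI _ _ _ (@compact_enorm_ball R d 0 delta^-1)).
  apply: (@closed_comp _ _ (fun y : 'rV[R]_d => enorm (y - opt)) [set t | mono_radius <= t]).
    by move=> y _; exact: continuous_enormB.
  exact: closed_ge.
have [c2 c20 midc] : exists2 c : R, 0 < c & forall x, K x -> c <= enorm (grad G x).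
  have [K0|/set0P/negP] := pselect (K !=set0); last first.
    by rewrite negbK => /eqP ->; exists 1.
  have [|x] := @EVT_min_rV R d (fun x => enorm (grad G x)) K K0 cK.
    apply: continuous_subspaceT => x.
    apply: (@continuous_comp _ _ _ (grad G) (@enorm R d)); last exact: continuous_enorm.
    exact: differentiable_continuous.
  rewrite inE => -[_ /= xr] xmin; exists (enorm (grad G x)).
    rewrite enorm_gt0; apply/eqP => /gradE xo; move: xr.
    by rewrite xo subrr enorm0 leNgt r0.
  by move=> y Ky; apply: xmin; rewrite inE.
have D0 : 0 < delta^-1 + enorm opt by rewrite ltr_pwDl ?invr_gt0.
pose c3 := c2 / (delta^-1 + enorm opt).
exists (Num.min (c0 / 2) (Num.min c1 c3)).
  by rewrite !lt_min divr_gt0// c10 divr_gt0.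
move=> x; have xo0 := enorm_ge0 (x - opt).
have [xr|xr] := leP (enorm (x - opt)) mono_radius.
  by rewrite (le_trans _ (near _ xr))// ler_wpM2r// ge_min lexx.
have [xd|xd] := leP delta^-1 (enorm x).
  by rewrite (le_trans _ (farc _ xd))// ler_wpM2r// !ge_min lexx orbT.
rewrite (@le_trans _ _ (c3 * enorm (x - opt)))//.
  by rewrite ler_wpM2r// !ge_min lexx !orbT.
rewrite (@le_trans _ _ c2)//; last by apply: midc; split; rewrite /= ?subr0 ltW.
rewrite /c3 mulrAC ler_pdivrMr// ler_wpM2l ?(ltW c20)//.
by rewrite (le_trans (enormD _ _))// enormN lerD2r ltW.
Qed.

(** Step length of an auxiliary gradient descent: [h * L <= 1 / 2] makes [G] drop by a fixed part of
    the squared gradient, and [h * L ^+ 2 <= c0] keeps the ball of radius [mono_radius]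
    invariant. *)
Let h := c0 / (L ^+ 2 + 2 * L * c0).

Let hden : 0 < L ^+ 2 + 2 * L * c0.
Proof. by rewrite addr_gt0 ?exprn_gt0// !mulr_gt0. Qed.

Let h0 : 0 < h. Proof. exact: divr_gt0. Qed.

Let hL : h * L <= 1 / 2.
Proof. by rewrite /h mulrAC ler_pdivrMr//; have := exprn_gt0 2 L0; nra. Qed.

Let hL2 : h * L ^+ 2 <= c0.
Proof.
rewrite /h mulrAC ler_pdivrMr// ler_wpM2l ?(ltW c00)// lerDl.
by rewrite !mulr_ge0// ltW.
Qed.

Let descent x := x - h *: grad G x.

Let descent_le x : G (descent x) <= G x - h / 2 * enorm (grad G x) ^+ 2.
Proof.
have := taylor2 dG gradL x (- (h *: grad G x)) (ltW L0).
rewrite ler_norml => /andP[_]; rewrite dotvNr dotvZr -enorm_sqr enormN enormZ.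
rewrite gtr0_norm// exprMn -/(descent x).
have := ler_wpM2r (mulr_ge0 (ltW h0) (sqr_ge0 (enorm (grad G x)))) hL.
move: (enorm (grad G x) ^+ 2) (G _) (G x) => a b c; rewrite expr2; lra.
Qed.

Let descent_ball x : enorm (x - opt) <= mono_radius ->
  enorm (descent x - opt) <= enorm (x - opt).
Proof.
move=> xr; rewrite -(ler_pXn2r (n := 2)) ?nnegrE//.
rewrite /descent addrAC enormD_sqr dotvNr dotvZr enormN enormZ gtr0_norm// exprMn.
have := @grad_mono opt x; rewrite subrr enorm0 => /(_ (ltW mono_radius_gt0) xr).
rewrite grad_opt subr0 dotvC => /(ler_wpM2l (ltW h0)).
have : enorm (grad G x) ^+ 2 <= L ^+ 2 * enorm (x - opt) ^+ 2.
  by rewrite -exprMn lerXn2r ?nnegrE ?mulr_ge0 ?(ltW L0)// enorm_grad.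
move=> /(ler_wpM2l (sqr_ge0 h)).
have := ler_wpM2r (mulr_ge0 (ltW h0) (sqr_ge0 (enorm (x - opt)))) hL2.
move: (enorm (x - opt) ^+ 2) (enorm _ ^+ 2) (dotv _ _) (L ^+ 2) => a b c l; rewrite expr2; lra.
Qed.

Let local_min x : enorm (x - opt) <= mono_radius -> G opt <= G x.
Proof.
move=> xr; have [t /andP[t0 t1]] := taylor1 dG opt (x - opt).
rewrite subrKC -subr_ge0 => ->.
have [->|tn0] := eqVneq t 0; first by rewrite scale0r addr0 grad_opt dot0v.
have tp : 0 < t by rewrite lt_neqAle eq_sym tn0.
have := @grad_mono opt (opt + t *: (x - opt)).
rewrite subrr enorm0 addrAC subrr add0r grad_opt subr0 dotvZr !enormZ ger0_norm// => /(_ (ltW mono_radius_gt0)) m.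
rewrite -(pmulr_rge0 _ tp) (le_trans _ (m _))//.
  by rewrite mulr_ge0// ltW// divr_gt0.
by rewrite (le_trans _ xr)// ler_piMl.
Qed.

Let iter_continuous k : continuous (iter k descent).
Proof.
elim: k => [|k IH] x /=; first exact: cvg_id.
apply: (@continuous_comp _ _ _ (iter k descent) descent); first exact: IH.
apply: (@continuousB _ _ _ id (fun y => h *: grad G y)); first exact: cvg_id.
apply: (@continuous_comp _ _ _ (grad G) (fun y => h *: y)).
  exact: differentiable_continuous.
exact: scaler_continuous.
Qed.

(* Gradient descent started at any point either enters the ball around [opt], where [G] is at
   least [G opt], or falls below [G opt]: two disjoint open conditions, so that along a segment
   issued from [opt] only the first occurs. *)
Lemma opt_min x : G opt <= G x.
Proof.
pose A := [set x | exists k, enorm (iter k descent x - opt) < mono_radius].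
pose B := [set x | exists k, G (iter k descent x) < G opt].
have itle j k y : (j <= k)%N -> G (iter k descent y) <= G (iter j descent y).
  move=> /subnK <-; elim: (k - j)%N => [|m IH]; first by rewrite add0n.
  rewrite addSn iterS.
  by rewrite (le_trans (descent_le _))// (le_trans _ IH)// gerBl mulr_ge0// divr_ge0// ltW.
have AB y : A y -> ~ B y.
  move=> [k ky] [j]; apply/negP; rewrite -leNgt.
  have inball m : enorm (iter (m + k) descent y - opt) < mono_radius.
    elim: m => // m IH; rewrite addSn iterS.
    by rewrite (le_lt_trans _ IH)// descent_ball// ltW.
  apply: (@le_trans _ _ (G (iter (j + k) descent y))).
    by apply: local_min; rewrite ltW.
  by apply: itle; rewrite leq_addr.
(* An orbit that never enters the ball sees gradients bounded away from 0, so each step lowers [G]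
   by at least a fixed [e], and the value [G opt] is passed after finitely many steps. *)
have ABT y : A y \/ B y.
  apply: contrapT => /not_orP[nA nB].
  have [c cp cl] := grad_lower.
  have gl k : c * mono_radius <= enorm (grad G (iter k descent y)).
    rewrite (le_trans _ (cl _))// ler_pM2l// leNgt; apply/negP => ?.
    by apply: nA; exists k.
  pose e := h / 2 * (c * mono_radius) ^+ 2.
  have e0 : 0 < e by rewrite mulr_gt0 ?divr_gt0// exprn_gt0// mulr_gt0// mono_radius_gt0.
  have dec k : G (iter k descent y) <= G y - k%:R * e.
    elim: k => [|k IH]; first by rewrite mul0r subr0.
    rewrite iterS (le_trans (descent_le _))//.
    have : e <= h / 2 * enorm (grad G (iter k descent y)) ^+ 2.
      rewrite /e ler_pM2l ?divr_gt0// lerXn2r ?nnegrE//.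
      by rewrite mulr_ge0// ltW// mono_radius_gt0.
    by move: IH; rewrite -[k.+1%:R]natr1 mulrDl mul1r => IH he; lra.
  apply: nB; exists (Num.bound `|(G y - G opt) / e|).
  rewrite (le_lt_trans (dec _))// ltrBlDr -ltrBlDl.
  rewrite -ltr_pdivrMr//.
  exact: le_lt_trans (ler_norm _) (archi_boundP (normr_ge0 _)).
have Aopen y : A y -> \forall z \near y, A z.
  move=> [k ky]; have r0 : 0 < mono_radius - enorm (iter k descent y - opt) by rewrite subr_gt0.
  have nr := @iter_continuous k y _ (ball_enorm _ r0).
  apply: (@filterS _ (nbhs y) (nbhs_filter y) _ _ _ nr) => z /= zr; exists k.
  rewrite (le_lt_trans (enorm_triangle _ (iter k descent y) _))//.
  by rewrite -ltrBrDr.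
have Bopen y : B y -> \forall z \near y, B z.
  move=> [k ky]; have : continuous (fun z => G (iter k descent z)).
    move=> z; apply: (@continuous_comp _ _ _ (iter k descent) G); first exact: iter_continuous.
    exact: differentiable_continuous.
  move=> /(_ y) /(@cvgr_lt _ _ _ (nbhs_filter y)) /(_ _ ky) nr.
  by apply: (@filterS _ (nbhs y) (nbhs_filter y) _ _ _ nr) => z zr; exists k.
rewrite leNgt; apply/negP => xlt.
pose g (t : R) := opt + t *: (x - opt).
have gc : continuous g.
  move=> t; apply: (@cvgD _ _ _ (nbhs t) (nbhs_filter t) (fun=> opt) (fun s : R => s *: (x - opt))).
    exact: cvg_cst.
  exact: scalel_continuous.
(* [A] and [B] are open, disjoint and cover everything, so this indicator is locally constant along
   the segment; being 0 at [opt] and 1 at [x], it would have to take the value 1/2. *)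
pose chi (t : R) : R := if `[< A (g t) >] then 0 else 1.
have chic : continuous chi.
  move=> t; have [At|Bt] := ABT (g t).
    apply: cvg_near_cst.
    apply: (@filterS _ _ (nbhs_filter t) _ _ _ (gc t _ (Aopen _ At))) => s /= As.
    by rewrite /chi asboolT// asboolT.
  apply: cvg_near_cst.
  apply: (@filterS _ _ (nbhs_filter t) _ _ _ (gc t _ (Bopen _ Bt))) => s /= Bs.
  by rewrite /chi !asboolF//; move=> /AB; exact.
have chi0 : chi 0 = 0.
  rewrite /chi asboolT// /g scale0r addr0; exists 0%N.
  by rewrite /= subrr enorm0 mono_radius_gt0.
have chi1 : chi 1 = 1.
  rewrite /chi asboolF// /g scale1r subrKC => /AB; apply.
  by exists 0%N.
have [|t _] := @IVT R chi 0 1 (1/2) ler01 (continuous_subspaceT chic).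
  rewrite chi0 chi1 minEle maxEle ler01; lra.
by rewrite /chi; case: asboolP => _; lra.
Qed.

(** One descent step from [x] gains [h / 2] times the squared gradient and cannot end below [G opt];
    so the gap dominates the squared gradient, hence by [grad_lower] the squared distance. *)
Lemma gap_lower : exists2 c : R, 0 < c & forall x, c * enorm (x - opt) ^+ 2 <= G x - G opt.
Proof.
have [c cp cl] := grad_lower; exists (h / 2 * c ^+ 2).
  by rewrite mulr_gt0 ?divr_gt0// exprn_gt0.
move=> x; have := le_trans (opt_min (descent x)) (descent_le x).
have : h / 2 * c ^+ 2 * enorm (x - opt) ^+ 2 <= h / 2 * enorm (grad G x) ^+ 2.
  rewrite -mulrA -exprMn ler_pM2l ?divr_gt0// lerXn2r ?nnegrE//.
  by rewrite mulr_ge0// ltW.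
by lra.
Qed.

Lemma gap_upper x : G x - G opt <= L * enorm (x - opt) ^+ 2.
Proof.
have := taylor2 dG gradL opt (x - opt) (ltW L0).
by rewrite subrKC grad_opt dot0v subr0 => /(le_trans (ler_norm _)).
Qed.

End Landscape.

(** * Independence and iterated expectations *)

Section BoundedExpectation.
Context {disp : measure_display} {T : measurableType disp} {R : realType}.
Variable P : probability T R.
Implicit Types X Y : T -> R.

(** Under a probability measure boundedness gives integrability, so the expectation is linear on
    this class without side conditions, and the class is closed under products. *)
Definition bounded_mfun X :=
  measurable_fun [set: T] X /\ exists M, forall t, `|X t| <= M.

Definition Ex X : R := fine 'E_P[X]%E.

Lemma bounded_mfun_integrable X :
  bounded_mfun X -> P.-integrable [set: T] (EFin \o X).
Proof.
move=> [mX [M XM]]; apply: measurable_bounded_integrable => //.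
  by rewrite (le_lt_trans (probability_le1 P _))// ltry.
exists M; split; first exact: num_real.
by move=> x Mx t _ /=; rewrite (le_trans (XM t))// ltW.
Qed.

Lemma ExE X : Ex X = \int[P]_t X t.
Proof. by rewrite /Ex unlock. Qed.

Lemma bounded_mfun_cst (c : R) : bounded_mfun (fun=> c).
Proof. by split; [exact: measurable_cst|exists `|c|]. Qed.

Lemma bounded_mfunD X Y : bounded_mfun X -> bounded_mfun Y ->
  bounded_mfun (fun t => X t + Y t).
Proof.
move=> [mX [a Xa]] [mY [b Yb]]; split; first exact: measurable_funD.
by exists (a + b) => t; rewrite (le_trans (ler_normD _ _))// lerD.
Qed.

Lemma bounded_mfunM X Y : bounded_mfun X -> bounded_mfun Y ->
  bounded_mfun (fun t => X t * Y t).
Proof.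
move=> [mX [a Xa]] [mY [b Yb]]; split; first exact: measurable_funM.
by exists (a * b) => t; rewrite normrM ler_pM.
Qed.

Lemma bounded_mfun_sum (I : Type) (r : seq I) (F : I -> T -> R) :
  (forall i, bounded_mfun (F i)) -> bounded_mfun (fun t => \sum_(i <- r) F i t).
Proof.
move=> bF; elim: r => [|i r IH].
  by under eq_fun do rewrite big_nil; exact: bounded_mfun_cst.
by under eq_fun do rewrite big_cons; exact: bounded_mfunD.
Qed.

Lemma bounded_mfun_prod (I : Type) (r : seq I) (F : I -> T -> R) :
  (forall i, bounded_mfun (F i)) -> bounded_mfun (fun t => \prod_(i <- r) F i t).
Proof.
move=> bF; elim: r => [|i r IH].
  by under eq_fun do rewrite big_nil; exact: bounded_mfun_cst.
by under eq_fun do rewrite big_cons; exact: bounded_mfunM.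
Qed.

Lemma bounded_mfun_indic (A : set T) : measurable A ->
  bounded_mfun (\1_A : T -> R).
Proof.
move=> mA; split; first exact: measurable_indic.
by exists 1 => t; rewrite indicE; case: (_ \in _); rewrite ?normr0 ?normr1.
Qed.

Lemma Ex_cst (c : R) : Ex (fun=> c) = c.
Proof. by rewrite /Ex expectation_cst. Qed.

Lemma ExD X Y : bounded_mfun X -> bounded_mfun Y ->
  Ex (fun t => X t + Y t) = Ex X + Ex Y.
Proof. by move=> bX bY; rewrite !ExE RintegralD//; exact: bounded_mfun_integrable. Qed.

Lemma ExZ (c : R) X : bounded_mfun X -> Ex (fun t => c * X t) = c * Ex X.
Proof. by move=> bX; rewrite !ExE RintegralZl//; exact: bounded_mfun_integrable. Qed.

Lemma Ex_sum (I : Type) (r : seq I) (F : I -> T -> R) :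
  (forall i, bounded_mfun (F i)) ->
  Ex (fun t => \sum_(i <- r) F i t) = \sum_(i <- r) Ex (F i).
Proof.
move=> bF; elim: r => [|i r IH].
  by rewrite big_nil; under eq_fun do rewrite big_nil; exact: Ex_cst.
rewrite big_cons -IH -ExD//; last exact: bounded_mfun_sum.
by congr Ex; apply/funext => t; rewrite big_cons.
Qed.

Lemma Ex_le X Y : bounded_mfun X -> bounded_mfun Y ->
  (forall t, X t <= Y t) -> Ex X <= Ex Y.
Proof.
by move=> bX bY XY; rewrite !ExE le_Rintegral//; exact: bounded_mfun_integrable.
Qed.

Lemma Ex_dist X Y (e : R) : bounded_mfun X -> bounded_mfun Y ->
  (forall t, `|X t - Y t| <= e) -> `|Ex X - Ex Y| <= e.
Proof.
move=> bX bY XY.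
have bc := bounded_mfun_cst e.
have h1 : Ex X <= Ex Y + e.
  rewrite -[e in leRHS]Ex_cst -ExD//; apply: Ex_le => //.
    exact: bounded_mfunD.
  by move=> t; have := XY t; rewrite ler_norml => /andP[_]; lra.
have h2 : Ex Y <= Ex X + e.
  rewrite -[e in leRHS]Ex_cst -ExD//; apply: Ex_le => //.
    exact: bounded_mfunD.
  by move=> t; have := XY t; rewrite ler_norml => /andP[+ _]; lra.
by rewrite ler_norml; apply/andP; split; lra.
Qed.

Lemma Ex_indic (A : set T) : measurable A -> Ex (\1_A) = fine (P A).
Proof. by move=> mA; rewrite /Ex expectation_indic. Qed.

End BoundedExpectation.

(** * Functionals of finitely many samples *)

Section Paths.
Variables (R : realType) (d : nat) (M : R).
Hypothesis M0 : 0 <= M.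
Notation path := (nat -> 'rV[R]_d).
Implicit Types (w v : path) (Psi Phi : path -> R) (X Y : path -> 'rV[R]_d).

Definition inball w := forall i, enorm (w i) <= M.

Definition pdist n w v : R := \sum_(i < n) enorm (w i - v i).

(* Lipschitz functionals of the first n samples: bounded and measurable, and closed under
   every operation the recursion performs. *)
Definition nice n Psi := exists2 C : R, 0 <= C &
  forall w v, inball w -> inball v -> `|Psi w - Psi v| <= C * pdist n w v.

Definition niceV n X := forall i, nice n (fun w => X w 0 i).

Definition upd w n (c : 'rV[R]_d) : path := fun i => if i == n then c else w i.

Lemma updE w n c : upd w n c n = c.
Proof. by rewrite /upd eqxx. Qed.

Lemma upd_neq w n c i : i != n -> upd w n c i = w i.
Proof. by rewrite /upd => /negbTE ->. Qed.

Lemma upd_lt w n c i : (i < n)%N -> upd w n c i = w i.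
Proof. by move=> ni; rewrite upd_neq// ltn_eqF. Qed.

Lemma inball_upd w n c : inball w -> enorm c <= M -> inball (upd w n c).
Proof. by move=> wM cM i; rewrite /upd; case: eqP. Qed.

Lemma pdist_ge0 n w v : 0 <= pdist n w v.
Proof. by apply: sumr_ge0 => i _; exact: enorm_ge0. Qed.

Lemma pdist_le n m w v : (n <= m)%N -> pdist n w v <= pdist m w v.
Proof.
move=> /subnKC <-; rewrite /pdist big_split_ord /= lerDl.
by apply: sumr_ge0 => i _; exact: enorm_ge0.
Qed.

Lemma pdist_upd2 n w v c : pdist n.+1 (upd w n c) (upd v n c) = pdist n w v.
Proof.
rewrite /pdist big_ord_recr /= !updE subrr enorm0 addr0.
by apply: eq_bigr => i _; rewrite !upd_lt.
Qed.

Lemma pdist_upd1 n w c : pdist n.+1 (upd w n c) w = enorm (c - w n).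
Proof.
rewrite /pdist big_ord_recr /= updE big1 ?add0r// => i _.
by rewrite upd_lt// subrr enorm0.
Qed.

Lemma pdist_bound n w : inball w -> pdist n w (fun=> 0) <= n%:R * M.
Proof.
move=> wM; rewrite mulr_natl -{2}(card_ord n) -sumr_const.
by apply: ler_sum => i _; rewrite subr0.
Qed.

Lemma nice_bounded n Psi : nice n Psi -> exists2 B : R, 0 <= B & forall w, inball w -> `|Psi w| <= B.
Proof.
move=> [C C0 PC]; pose o : path := fun=> 0.
have oM : inball o by move=> i; rewrite enorm0.
exists (`|Psi o| + C * (n%:R * M)); first by rewrite addr_ge0 ?mulr_ge0.
move=> w wM; rewrite -lerBlDl (le_trans (lerB_dist _ _))// (le_trans (PC _ _ wM oM))//.
by rewrite ler_wpM2l// pdist_bound.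
Qed.

Lemma nice_mono n m Psi : (n <= m)%N -> nice n Psi -> nice m Psi.
Proof.
move=> nm [C C0 PC]; exists C => // w v wM vM.
by rewrite (le_trans (PC _ _ wM vM))// ler_wpM2l// pdist_le.
Qed.

Lemma nice_cst n (c : R) : nice n (fun=> c).
Proof. by exists 0 => // w v _ _; rewrite subrr normr0 mul0r. Qed.

Lemma niceD n Psi Phi : nice n Psi -> nice n Phi -> nice n (fun w => Psi w + Phi w).
Proof.
move=> [a a0 A] [b b0 B]; exists (a + b); first exact: addr_ge0.
move=> w v wM vM; rewrite mulrDl opprD addrACA (le_trans (ler_normD _ _))//.
by rewrite lerD ?A ?B.
Qed.

Lemma niceM n Psi Phi : nice n Psi -> nice n Phi -> nice n (fun w => Psi w * Phi w).
Proof.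
move=> nA nB; have [p p0 Pp] := nice_bounded nA; have [q q0 Qq] := nice_bounded nB.
case: nA nB => [a a0 A] [b b0 B]; exists (a * q + p * b).
  by rewrite addr_ge0 ?mulr_ge0.
move=> w v wM vM.
have -> : Psi w * Phi w - Psi v * Phi v = (Psi w - Psi v) * Phi w + Psi v * (Phi w - Phi v).
  by ring.
rewrite (le_trans (ler_normD _ _))// !normrM mulrDl lerD//.
  by rewrite mulrAC ler_pM ?A ?Qq.
by rewrite -mulrA ler_pM ?Pp ?B.
Qed.

Lemma niceZ n (c : R) Psi : nice n Psi -> nice n (fun w => c * Psi w).
Proof. by apply: niceM; exact: nice_cst. Qed.

Lemma niceN n Psi : nice n Psi -> nice n (fun w => - Psi w).
Proof. by move=> /(niceZ (-1)); under eq_fun do rewrite mulN1r. Qed.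

Lemma niceB n Psi Phi : nice n Psi -> nice n Phi -> nice n (fun w => Psi w - Phi w).
Proof. by move=> nP /niceN; exact: niceD. Qed.

Lemma nice_sum n (I : Type) (r : seq I) (F : I -> path -> R) :
  (forall i, nice n (F i)) -> nice n (fun w => \sum_(i <- r) F i w).
Proof.
move=> nF; elim: r => [|i r IH].
  by under eq_fun do rewrite big_nil; exact: nice_cst.
by under eq_fun do rewrite big_cons; exact: niceD.
Qed.

Lemma nice_inv n Psi (e : R) : 0 < e -> (forall w, inball w -> e <= Psi w) ->
  nice n Psi -> nice n (fun w => (Psi w)^-1).
Proof.
move=> e0 Pe [a a0 A]; exists (a / (e * e)); first by rewrite divr_ge0 ?mulr_ge0 ?(ltW e0).
move=> w v wM vM; have pw := lt_le_trans e0 (Pe _ wM); have pv := lt_le_trans e0 (Pe _ vM).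
have -> : (Psi w)^-1 - (Psi v)^-1 = (Psi v - Psi w) / (Psi w * Psi v).
  by field; rewrite !gt_eqF.
rewrite normrM normfV distrC mulrAC ler_pM ?A//.
rewrite gtr0_norm ?mulr_gt0// lef_pV2 ?posrE ?mulr_gt0//.
by rewrite ler_pM ?Pe// ltW.
Qed.

Lemma niceV_lip n X : niceV n X -> exists2 C : R, 0 <= C &
  forall w v, inball w -> inball v -> enorm (X w - X v) <= C * pdist n w v.
Proof.
move=> nX; have /choice[C CP] : forall i, exists C : R, 0 <= C /\
    forall w v, inball w -> inball v -> `|X w 0 i - X v 0 i| <= C * pdist n w v.
  by move=> i; have [C C0 ?] := nX i; exists C.
have S0 : 0 <= \sum_i C i by apply: sumr_ge0 => i _; case: (CP i).
exists (d%:R * \sum_i C i); first by rewrite mulr_ge0.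
move=> w v wM vM; rewrite -mulrA; apply: enorm_le_coord => [|i].
  by rewrite mulr_ge0 ?pdist_ge0.
rewrite !mxE (le_trans ((CP i).2 _ _ wM vM))// ler_wpM2r ?pdist_ge0//.
by rewrite (bigD1 i)//= lerDl sumr_ge0// => j _; case: (CP j).
Qed.

Lemma niceV_bounded n X : niceV n X -> exists2 B : R, 0 <= B & forall w, inball w -> enorm (X w) <= B.
Proof.
move=> nX; have [C C0 XC] := niceV_lip nX; pose o : path := fun=> 0.
have oM : inball o by move=> i; rewrite enorm0.
exists (C * (n%:R * M) + enorm (X o)); first by rewrite addr_ge0 ?mulr_ge0.
move=> w wM; rewrite -{1}(subrK (X o) (X w)) (le_trans (enormD _ _))// lerD2r.
by rewrite (le_trans (XC _ _ wM oM))// ler_wpM2l// pdist_bound.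
Qed.

Definition locally_lip (g : 'rV[R]_d -> R) := forall r : R, exists2 C : R, 0 <= C &
  forall x y, enorm x <= r -> enorm y <= r -> `|g x - g y| <= C * enorm (x - y).

Lemma nice_comp n (g : 'rV[R]_d -> R) X : locally_lip g -> niceV n X ->
  nice n (fun w => g (X w)).
Proof.
move=> gl nX; have [B B0 XB] := niceV_bounded nX; have [C C0 XC] := niceV_lip nX.
have [G G0 gG] := gl B; exists (G * C); first exact: mulr_ge0.
move=> w v wM vM; rewrite (le_trans (gG _ _ (XB _ wM) (XB _ vM)))//.
by rewrite -mulrA ler_wpM2l// XC.
Qed.

Lemma nice_dotv n X Y : niceV n X -> niceV n Y -> nice n (fun w => dotv (X w) (Y w)).
Proof. by move=> nX nY; apply: nice_sum => i; exact: niceM. Qed.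

Lemma nice_enorm_sqr n X : niceV n X -> nice n (fun w => enorm (X w) ^+ 2).
Proof. by move=> nX; under eq_fun do rewrite enorm_sqr; exact: nice_dotv. Qed.

Lemma niceV_cst n (c : 'rV[R]_d) : niceV n (fun=> c).
Proof. by move=> i; exact: nice_cst. Qed.

Lemma niceVD n X Y : niceV n X -> niceV n Y -> niceV n (fun w => X w + Y w).
Proof. by move=> nX nY i; under eq_fun do rewrite mxE; exact: niceD. Qed.

Lemma niceVN n X : niceV n X -> niceV n (fun w => - X w).
Proof. by move=> nX i; under eq_fun do rewrite mxE; exact: niceN. Qed.

Lemma niceVB n X Y : niceV n X -> niceV n Y -> niceV n (fun w => X w - Y w).
Proof. by move=> nX nY; apply: niceVD => //; exact: niceVN. Qed.

Lemma niceVZ n Psi X : nice n Psi -> niceV n X -> niceV n (fun w => Psi w *: X w).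
Proof. by move=> nP nX i; under eq_fun do rewrite mxE; exact: niceM. Qed.

Lemma niceV_coord n i : (i < n)%N -> niceV n (fun w => w i).
Proof.
move=> ni k; exists 1 => // w v _ _; rewrite mul1r.
have -> : w i 0 k - v i 0 k = (w i - v i) 0 k by rewrite !mxE.
rewrite (le_trans (enorm_coord _ _))// /pdist (bigD1 (Ordinal ni))//= lerDl.
by apply: sumr_ge0 => j _; exact: enorm_ge0.
Qed.

Lemma niceV_mono n m X : (n <= m)%N -> niceV n X -> niceV m X.
Proof. by move=> nm nX i; exact: nice_mono (nX i). Qed.

Lemma nice_upd n Psi c : enorm c <= M -> nice n.+1 Psi -> nice n (fun w => Psi (upd w n c)).
Proof.
move=> cM [C C0 PC]; exists C => // w v wM vM.
by rewrite (le_trans (PC _ _ (inball_upd n wM cM) (inball_upd n vM cM)))// pdist_upd2.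
Qed.

Lemma finite_net (e : R) : 0 < e -> exists s : seq 'rV[R]_d,
  (forall c, c \in s -> enorm c <= M) /\
  (forall v : 'rV[R]_d, enorm v <= M -> has (fun c => enorm (v - c) < e) s).
Proof.
move=> e0; have := @compact_enorm_ball R d 0 M; rewrite compact_cover.
move=> /(_ _ [set c | enorm (c - 0) <= M] (fun c => [set v | enorm (v - c) < e])).
case.
- move=> c _; apply: (@open_comp _ _ (fun y : 'rV[R]_d => enorm (y - c)) [set t | t < e]).
    by move=> y _; exact: continuous_enormB.
  exact: open_lt.
- by move=> v vM; exists v => //=; rewrite subrr enorm0.
move=> D DM Dcov; exists (finmap.enum_fset D); split.
  by move=> c cD; have := DM c cD; rewrite inE /= subr0.
move=> v vM; have := Dcov v; rewrite /= subr0 => /(_ vM)[c cD vc].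
by apply/hasP; exists c.
Qed.

End Paths.

Lemma small_eq0 (R : realFieldType) (x K : R) : 0 <= K ->
  (forall e, 0 < e -> `|x| <= K * e) -> x = 0.
Proof.
move=> K0 xK; apply/eqP; rewrite -normr_eq0 eq_le normr_ge0 andbT.
apply/ler_addgt0Pr => e e0; rewrite add0r.
have K1 : 0 < K + 1 by rewrite ltr_wpDl.
rewrite (le_trans (xK (e / (K + 1)) _)) ?divr_gt0//.
by rewrite mulrA ler_pdivrMr// mulrC ler_pM2l// lerDl.
Qed.

(** * Averaging out the last sample *)

Section Tower.
Context {disp : measure_display} {T : measurableType disp} {R : realType}.
Variables (d : nat) (P : probability T R) (W : nat -> T -> 'rV[R]_d) (M : R).
Hypothesis M0 : 0 <= M.
Hypothesis WM : forall n t, enorm (W n t) <= M.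
Hypothesis iidW : iid P W.
Notation path := (nat -> 'rV[R]_d).
Implicit Types (w v : path) (Psi Phi : path -> R).

Definition sample t : path := fun i => W i t.

Let sample_ball t : inball M (sample t). Proof. by move=> i; exact: WM. Qed.

Lemma borelC (A : set 'rV[R]_d) : borel_rV A -> borel_rV (~` A).
Proof. by rewrite -setTD; exact: sigma_algebraCD. Qed.

Lemma borelI (A B : set 'rV[R]_d) : borel_rV A -> borel_rV B -> borel_rV (A `&` B).
Proof.
move=> bA bB; rewrite -(setCK (A `&` B)) setCI; apply: borelC.
rewrite -bigcup2E; apply: sigma_algebra_bigcup => -[|[|i]]/=; [exact: borelC|exact: borelC|].
exact: sigma_algebra0.
Qed.

Lemma borelT : borel_rV (setT : set 'rV[R]_d).
Proof. by rewrite -setC0; apply: borelC; exact: sigma_algebra0. Qed.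

Lemma borel_ball (c : 'rV[R]_d) e : borel_rV [set v | enorm (v - c) < e].
Proof.
apply: sub_sigma_algebra => /=.
apply: (@open_comp _ _ (fun y : 'rV[R]_d => enorm (y - c)) [set t | t < e]).
  by move=> y _; exact: continuous_enormB.
exact: open_lt.
Qed.

(** Taking the first net point within [e] makes the cells disjoint; a vector that no net point
    reaches gets the index [size s]. *)
Definition cell (s : seq 'rV[R]_d) (e : R) (v : 'rV[R]_d) : nat :=
  find (fun c => enorm (v - c) < e) s.

Lemma borel_cell s e j : borel_rV [set v | cell s e v = j].
Proof.
elim: s j => [|c s IH] j.
  have [->|j0] := eqVneq j 0%N.
    by rewrite (_ : [set _ | _] = setT); [exact: borelT|apply/seteqP; split].
  rewrite (_ : [set _ | _] = set0); first exact: sigma_algebra0.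
  by apply/seteqP; split => // v /= v0; move: j0; rewrite -v0 eqxx.
case: j => [|j].
  rewrite (_ : [set _ | _] = [set v | enorm (v - c) < e]); first exact: borel_ball.
  by apply/seteqP; split => v /=; rewrite /cell /=; case: ifP.
rewrite (_ : [set _ | _] = ~` [set v | enorm (v - c) < e] `&` [set v | cell s e v = j]).
  by apply: borelI; [apply: borelC; exact: borel_ball|exact: IH].
apply/seteqP; split => v /=; rewrite /cell /=; case: ifP => vc.
- by [].
- by move=> [<-].
- by case=> /(_ isT).
- by case=> _ ->.
Qed.

Lemma borel_measurable n B : borel_rV B -> measurable (W n @^-1` B).
Proof. by case: iidW => rv _ _; exact: rv. Qed.

Definition hit (B : set 'rV[R]_d) n t : R := \1_B (W n t).

Lemma bounded_mfun_hit B n : borel_rV B -> bounded_mfun (hit B n).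
Proof. by move=> /(borel_measurable n); exact: bounded_mfun_indic. Qed.

Definition mass (B : set 'rV[R]_d) : R := fine (P (W 0%N @^-1` B)).

(** The place where independence and the common law are unpacked; later factorisations are reduced
    to this product of indicators. *)
Lemma Ex_prod_hit (s : seq nat) (B : nat -> set 'rV[R]_d) : uniq s ->
  (forall i, borel_rV (B i)) ->
  Ex P (fun t => \prod_(i <- s) hit (B i) i t) = \prod_(i <- s) mass (B i).
Proof.
move=> us bB; have [_ law ind] := iidW.
have -> : (fun t => \prod_(i <- s) hit (B i) i t) =
    \1_(\bigcap_(n in [set` s]) (W n @^-1` B n)).
  apply/funext => t; rewrite indicE; elim: s {us} => [|i s IH].
    by rewrite big_nil mem_set.
  rewrite big_cons IH /hit indicE.
  case: (boolP (W i t \in B i)) => Bi; rewrite ?mul1r ?mul0r.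
    congr (_ %:R); congr nat_of_bool; apply/idP/idP; rewrite !inE => h j /=.
      by rewrite in_cons => /orP[/eqP ->|/h//]; move: Bi; rewrite inE.
    by move=> js; apply: h; rewrite /= in_cons js orbT.
  rewrite memNset// => /(_ i); rewrite /= in_cons eqxx => /(_ isT).
  by move: Bi; rewrite notin_setE.
rewrite Ex_indic; last first.
  by apply: fin_bigcap_measurable => // i _; exact: borel_measurable.
rewrite ind//; elim: (s) => [|i r IH]; first by rewrite !big_nil.
rewrite !big_cons fineM ?IH ?law//; first by rewrite fin_num_measure//; exact: borel_measurable.
elim: (r) => [|k q IHq]; first by rewrite big_nil.
by rewrite big_cons fin_numM// fin_num_measure//; exact: borel_measurable.
Qed.

(* Replaces the n-th sample by the centre of its cell in a finite net. *)
Definition disc Psi s e n w : R :=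
  \sum_(j < size s) Psi (upd w n (nth 0 s j)) * \1_[set v | cell s e v = j] (w n).

Lemma disc_dist Psi n C s e : 0 <= C -> 0 < e ->
  (forall w v, inball M w -> inball M v -> `|Psi w - Psi v| <= C * pdist n.+1 w v) ->
  (forall c, c \in s -> enorm c <= M) ->
  (forall v : 'rV[R]_d, enorm v <= M -> has (fun c => enorm (v - c) < e) s) ->
  forall w, inball M w -> `|disc Psi s e n w - Psi w| <= C * e.
Proof.
move=> C0 e0 PC sM cov w wM; have hw := cov _ (wM n).
have cs : (cell s e (w n) < size s)%N by rewrite /cell -has_find.
rewrite /disc (bigD1 (Ordinal cs))//= [X in _ + X - _]big1 ?addr0; last first.
  move=> j /negP jc; rewrite indicE memNset ?mulr0// => /= cj.
  by apply: jc; apply/eqP/val_inj.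
rewrite indicE mem_set//= mulr1.
have cM : enorm (nth 0 s (cell s e (w n))) <= M by apply: sM; exact: mem_nth.
rewrite (le_trans (PC _ _ (inball_upd n wM cM) wM))// ler_wpM2l// pdist_upd1 enormB ltW//.
exact: (nth_find 0 hw).
Qed.

(** Induction on the number of samples: discretising the last one exhibits the functional as a
    uniform limit of finite sums, each term being a functional of fewer samples times the indicator
    of a Borel event. *)
Lemma nice_measurable n Psi : nice M n Psi -> bounded_mfun (fun t => Psi (sample t)).
Proof.
elim: n Psi => [|n IH] Psi nP.
  have [C C0 PC] := nP.
  suff -> : (fun t => Psi (sample t)) = (fun=> Psi (fun=> 0)) by exact: bounded_mfun_cst.
  apply/funext => t; apply/eqP; rewrite -subr_eq0 -normr_eq0 eq_le normr_ge0 andbT.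
  have o : inball M (fun=> 0 : 'rV[R]_d) by move=> i; rewrite enorm0.
  by rewrite (le_trans (PC _ _ (sample_ball t) o))// /pdist big_ord0 mulr0.
split; last first.
  by have [B B0 PB] := nice_bounded M0 nP; exists B => t; exact: PB.
have [C C0 PC] := nP.
have e0 k : 0 < (k.+1%:R : R)^-1 by rewrite invr_gt0.
have /choice[s sP] := fun k => @finite_net R d M _ (e0 k).
apply: (@measurable_fun_cvg _ _ _ _ (fun k t => disc Psi (s k) k.+1%:R^-1 n (sample t))).
  move=> k; suff [] : bounded_mfun
    (fun t => disc Psi (s k) k.+1%:R^-1 n (sample t)) by [].
  apply: bounded_mfun_sum => j; apply: bounded_mfunM.
    apply: (IH (fun w => Psi (upd w n (nth 0 (s k) j)))).
    by apply: nice_upd nP; apply: (sP k).1; exact: mem_nth.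
  exact: bounded_mfun_hit (borel_cell _ _ _).
move=> t _; apply/cvgrPdist_le => e ep.
near=> k; rewrite distrC.
rewrite (le_trans (@disc_dist _ _ C _ _ C0 (e0 k) PC (sP k).1 (sP k).2 _ (sample_ball t)))//.
rewrite ler_pdivrMr//.
have : (Num.bound (C / e) <= k)%N by near: k; exact: nbhs_infty_ge.
move=> bk; rewrite mulrC -ler_pdivrMr// (le_trans (ltW (archi_boundP _)))//.
  by rewrite divr_ge0// ltW.
by rewrite ler_nat (leq_trans bk).
Unshelve. all: by end_near. Qed.

(** The factorisation for [n] samples is a hypothesis, because this step serves both inside the
    induction of [Ex_hit] and after it, in [EW_tower]. The indicator that the discretisation
    produces for sample [n] joins the list [r]. *)
Lemma Ex_disc Psi n s e (r : seq nat) (B : nat -> set 'rV[R]_d) :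
  nice M n.+1 Psi ->
  (forall c, c \in s -> enorm c <= M) ->
  uniq r -> all (leq n.+1) r -> (forall i, borel_rV (B i)) ->
  (forall Phi (q : seq nat) (A : nat -> set 'rV[R]_d), nice M n Phi -> uniq q ->
     all (leq n) q -> (forall i, borel_rV (A i)) ->
     Ex P (fun t => Phi (sample t) * \prod_(i <- q) hit (A i) i t) =
     Ex P (fun t => Phi (sample t)) * \prod_(i <- q) mass (A i)) ->
  Ex P (fun t => disc Psi s e n (sample t) * \prod_(i <- r) hit (B i) i t) =
  (\sum_(j < size s) Ex P (fun t => Psi (upd (sample t) n (nth 0 s j))) *
     mass [set v | cell s e v = j]) * \prod_(i <- r) mass (B i).
Proof.
move=> nP sM ur nr bB claim.
have nj (j : 'I_(size s)) : nice M n (fun w => Psi (upd w n (nth 0 s j))).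
  by apply: nice_upd nP; apply: sM; exact: mem_nth.
have bh i : bounded_mfun (hit (B i) i) by exact: bounded_mfun_hit.
transitivity (\sum_(j < size s) Ex P (fun t => Psi (upd (sample t) n (nth 0 s j)) *
    (hit [set v | cell s e v = j] n t * \prod_(i <- r) hit (B i) i t))).
  rewrite -Ex_sum => [|j]; last first.
    apply: bounded_mfunM; first exact: nice_measurable (nj j).
    apply: bounded_mfunM; first exact: bounded_mfun_hit (borel_cell _ _ _).
    exact: bounded_mfun_prod.
  congr Ex; apply/funext => t; rewrite mulr_suml; apply: eq_bigr => j _.
  by rewrite mulrA.
rewrite mulr_suml; apply: eq_bigr => j _.
have nNr : n \notin r by apply/negP => /(allP nr); rewrite ltnn.
pose A i := if i == n then [set v | cell s e v = j] else B i.
have := claim _ (n :: r) A (nj j); rewrite /= nNr ur leqnn /=.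
have -> : all (leq n) r by apply: sub_all nr => i; exact: ltnW.
move=> /(_ isT isT); rewrite !big_cons /A eqxx.
have rE (F : set 'rV[R]_d -> nat -> R) : \prod_(i <- r) F (if i == n then
    [set v | cell s e v = j] else B i) i = \prod_(i <- r) F (B i) i.
  rewrite big_seq [RHS]big_seq; apply: eq_bigr => i ir.
  by case: eqP => // ie; move: nNr; rewrite -ie ir.
rewrite (rE (fun B _ => mass B)).
have -> : (fun t => Psi (upd (sample t) n (nth 0 s j)) *
   \prod_(i <- n :: r) hit (if i == n then [set v | cell s e v = j] else B i) i t) =
   (fun t => Psi (upd (sample t) n (nth 0 s j)) *
     (hit [set v | cell s e v = j] n t * \prod_(i <- r) hit (B i) i t)).
  by apply/funext => t; rewrite big_cons eqxx (rE (fun B i => hit B i t)).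
by move=> ->; rewrite ?mulrA// => i; case: ifP => _; [exact: borel_cell|exact: bB].
Qed.

(** After its last sample is discretised, the functional depends on one sample fewer and the
    induction hypothesis applies; each side moves by at most [C * e], and [e] is arbitrary. *)
Lemma Ex_hit n Psi (r : seq nat) (B : nat -> set 'rV[R]_d) : nice M n Psi -> uniq r ->
  all (leq n) r -> (forall i, borel_rV (B i)) ->
  Ex P (fun t => Psi (sample t) * \prod_(i <- r) hit (B i) i t) =
  Ex P (fun t => Psi (sample t)) * \prod_(i <- r) mass (B i).
Proof.
elim: n Psi r B => [|n IH] Psi r B nP ur nr bB.
  have [C C0 PC] := nP.
  have PE t : Psi (sample t) = Psi (fun=> 0).
    apply/eqP; rewrite -subr_eq0 -normr_eq0 eq_le normr_ge0 andbT.
    have o : inball M (fun=> 0 : 'rV[R]_d) by move=> i; rewrite enorm0.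
    by rewrite (le_trans (PC _ _ (sample_ball t) o))// /pdist big_ord0 mulr0.
  under eq_fun do rewrite PE; under [in RHS]eq_fun do rewrite PE.
  rewrite Ex_cst ExZ ?Ex_prod_hit//; apply: bounded_mfun_prod => i.
  exact: bounded_mfun_hit.
have bh i : bounded_mfun (hit (B i) i) by exact: bounded_mfun_hit.
have bp : bounded_mfun (fun t => \prod_(i <- r) hit (B i) i t).
  exact: bounded_mfun_prod.
have [C C0 PC] := nP.
set p := \prod_(i <- r) mass (B i).
have p01 : `|p| <= 1.
  rewrite /p; elim: (r) => [|i q IHq]; first by rewrite big_nil normr1.
  rewrite big_cons normrM mulr_ile1// /mass ger0_norm ?fine_ge0//.
  rewrite -lee_fin fineK; first exact: probability_le1 (borel_measurable _ (bB _)).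
  by rewrite fin_num_measure//; exact: borel_measurable.
have h01 t : `|\prod_(i <- r) hit (B i) i t| <= 1.
  elim: (r) => [|i q IHq]; first by rewrite big_nil normr1.
  rewrite big_cons normrM mulr_ile1// /hit indicE.
  by case: (_ \in _); rewrite ?normr0 ?normr1.
have small e : 0 < e -> `|Ex P (fun t => Psi (sample t) * \prod_(i <- r) hit (B i) i t) -
    Ex P (fun t => Psi (sample t)) * p| <= (C + C) * e.
  move=> e0; have [s [sM cov]] := @finite_net R d M e e0.
  have dd t := disc_dist C0 e0 PC sM cov (sample_ball t).
  have bd : bounded_mfun (fun t => disc Psi s e n (sample t)).
    apply: bounded_mfun_sum => j; apply: bounded_mfunM.
      apply: (@nice_measurable n (fun w => Psi (upd w n (nth 0 s j)))).
      by apply: nice_upd nP; apply: sM; exact: mem_nth.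
    exact: bounded_mfun_hit (borel_cell _ _ _).
  have E1 := Ex_disc e nP sM ur nr bB IH.
  have := @Ex_disc Psi n s e [::] B nP sM isT isT bB IH.
  rewrite big_nil mulr1 => E2; rewrite -E2 -/p in E1.
  have E3 : (fun t => disc Psi s e n (sample t) * \prod_(i <- [::]) hit (B i) i t) =
      (fun t => disc Psi s e n (sample t)).
    by apply/funext => t; rewrite big_nil mulr1.
  rewrite E3 in E1.
  have b1 := nice_measurable nP.
  have D1 : `|Ex P (fun t => Psi (sample t) * \prod_(i <- r) hit (B i) i t) -
     Ex P (fun t => disc Psi s e n (sample t) * \prod_(i <- r) hit (B i) i t)| <= C * e.
    apply: Ex_dist; [exact: bounded_mfunM|exact: bounded_mfunM|] => t.
    rewrite -mulrBl normrM distrC -[leRHS]mulr1 ler_pM//.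
  have D2 : `|Ex P (fun t => disc Psi s e n (sample t)) - Ex P (fun t => Psi (sample t))| <= C * e.
    exact: Ex_dist.
  set x := Ex P _; set y := Ex P _; rewrite -/x E1 in D1; rewrite -/y in D2.
  set z := Ex P _ in D1 D2.
  have -> : x - y * p = (x - z * p) + (z - y) * p by ring.
  rewrite (le_trans (ler_normD _ _))// [leRHS]mulrDl lerD//.
  by rewrite normrM -[leRHS]mulr1 ler_pM.
by apply/eqP; rewrite -subr_eq0; apply/eqP; apply: small_eq0 small; exact: addr_ge0.
Qed.

Definition EW Psi : R := Ex P (fun t => Psi (sample t)).

(** The law of one sample is represented by [W 0] for every [n], while the other coordinates of [w]
    stay frozen. *)
Definition integrate n Psi w : R := EW (fun v => Psi (upd w n (v 0%N))).

Lemma nice_integrand n Psi w : nice M n.+1 Psi -> inball M w ->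
  nice M 1 (fun v => Psi (upd w n (v 0%N))).
Proof.
move=> [C C0 PC] wM; exists C => // u v uM vM.
rewrite (le_trans (PC _ _ (inball_upd n wM (uM 0%N)) (inball_upd n wM (vM 0%N))))//.
rewrite ler_wpM2l// /pdist big_ord_recr big_ord1 /= !updE big1 ?add0r// => i _.
by rewrite !upd_lt// subrr enorm0.
Qed.

Lemma EW_le n Psi Phi : nice M n Psi -> nice M n Phi ->
  (forall w, inball M w -> Psi w <= Phi w) -> EW Psi <= EW Phi.
Proof.
move=> nA nB AB; apply: Ex_le; [exact: nice_measurable nA|exact: nice_measurable nB|].
by move=> t; exact: AB.
Qed.

Lemma EW_dist n Psi Phi (e : R) : nice M n Psi -> nice M n Phi ->
  (forall w, inball M w -> `|Psi w - Phi w| <= e) -> `|EW Psi - EW Phi| <= e.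
Proof.
move=> nA nB AB; apply: Ex_dist; [exact: nice_measurable nA|exact: nice_measurable nB|].
by move=> t; exact: AB.
Qed.

Lemma EW_cst (c : R) : EW (fun=> c) = c. Proof. exact: Ex_cst. Qed.

Lemma EWD n Psi Phi : nice M n Psi -> nice M n Phi ->
  EW (fun w => Psi w + Phi w) = EW Psi + EW Phi.
Proof. by move=> /nice_measurable nA /nice_measurable nB; exact: ExD. Qed.

Lemma EWZ n (c : R) Psi : nice M n Psi -> EW (fun w => c * Psi w) = c * EW Psi.
Proof. by move=> /nice_measurable nA; exact: ExZ. Qed.

Lemma EW_eq Psi Phi : (forall w, inball M w -> Psi w = Phi w) -> EW Psi = EW Phi.
Proof. by move=> AB; congr Ex; apply/funext => t; exact: AB. Qed.

Lemma nice_integrate n Psi : nice M n.+1 Psi -> nice M n (integrate n Psi).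
Proof.
move=> nP; have [C C0 PC] := nP; exists C => // w v wM vM.
apply: EW_dist; [exact: nice_integrand|exact: nice_integrand|] => u uM.
by rewrite (le_trans (PC _ _ (inball_upd n wM (uM 0%N)) (inball_upd n vM (uM 0%N))))// pdist_upd2.
Qed.

(* Independence of [W n] from [W 0, ..., W n.-1], as conditional averaging. *)
Lemma EW_tower n Psi : nice M n.+1 Psi -> EW Psi = EW (integrate n Psi).
Proof.
move=> nP; have [C C0 PC] := nP.
apply/eqP; rewrite -subr_eq0; apply/eqP; apply: (@small_eq0 _ _ (C + C)); first exact: addr_ge0.
move=> e e0; have [s [sM cov]] := @finite_net R d M e e0.
have nj (j : 'I_(size s)) : nice M n (fun w => Psi (upd w n (nth 0 s j))).
  by apply: nice_upd nP; apply: sM; exact: mem_nth.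
have bcell j k : bounded_mfun (hit [set v | cell s e v = j] k).
  exact: bounded_mfun_hit (borel_cell _ _ _).
have bd : bounded_mfun (fun t => disc Psi s e n (sample t)).
  apply: bounded_mfun_sum => j; apply: bounded_mfunM; last exact: bcell.
  exact: nice_measurable (nj j).
have D1 : `|EW (disc Psi s e n) - EW Psi| <= C * e.
  by apply: Ex_dist => //; [exact: nice_measurable nP|move=> t; exact: disc_dist].
(* The conditional average of the discretised functional: it has the same mean as [disc], and is
   within [C * e] of [integrate n Psi] uniformly in [w]. *)
pose avg w := \sum_(j < size s) Psi (upd w n (nth 0 s j)) * mass [set v | cell s e v = j].
have navg : nice M n avg.
  by apply: nice_sum => j; apply: niceM => //; exact: nice_cst.
have E : EW (disc Psi s e n) = EW avg.
  have := @Ex_disc Psi n s e [::] (fun=> setT) nP sM isT isT (fun=> borelT) (@Ex_hit n).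
  rewrite big_nil mulr1 => h.
  have -> : EW (disc Psi s e n) = Ex P (fun t => disc Psi s e n (sample t) *
      \prod_(i <- [::]) hit setT i t).
    by congr Ex; apply/funext => t; rewrite big_nil mulr1.
  rewrite h /EW Ex_sum => [|j].
    apply: eq_bigr => j _; rewrite mulrC -ExZ; last exact: nice_measurable (nj j).
    by congr Ex; apply/funext => t; rewrite mulrC.
  apply: bounded_mfunM; last exact: bounded_mfun_cst.
  exact: nice_measurable (nj j).
have D2 : `|EW avg - EW (integrate n Psi)| <= C * e.
  apply: (@EW_dist n) => //; first exact: nice_integrate.
  move=> w wM; have -> : avg w = Ex P (fun t => disc Psi s e n (upd w n (W 0%N t))).
    transitivity (\sum_(j < size s) Ex P (fun t => Psi (upd w n (nth 0 s j)) *
        hit [set v | cell s e v = j] 0%N t)).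
      apply: eq_bigr => j _; rewrite ExZ// [X in _ = _ * X]Ex_indic//.
      exact: borel_measurable (borel_cell _ _ _).
    rewrite -Ex_sum => [|j]; last first.
      by apply: bounded_mfunM => //; exact: bounded_mfun_cst.
    congr Ex; apply/funext => t; apply: eq_bigr => j _; rewrite updE.
    by congr (Psi _ * _); apply/funext => i; rewrite /upd; case: eqP.
  apply: Ex_dist.
  - apply: bounded_mfun_sum => j; apply: bounded_mfunM.
      rewrite (_ : (fun t => _) = fun=> Psi (upd w n (nth 0 s j))).
        exact: bounded_mfun_cst.
      by apply/funext => t; congr Psi; apply/funext => i; rewrite /upd; case: eqP.
    by under eq_fun do rewrite updE; exact: bcell.
  - exact: nice_measurable (nice_integrand nP wM).
  move=> t; apply: disc_dist => //; exact: inball_upd.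
rewrite -E in D2; move: D1 D2.
move: (EW (disc _ _ _ _)) (EW Psi) (EW (integrate n Psi)) => a b c.
rewrite !ler_norml => /andP[h1 h2] /andP[h3 h4]; apply/andP; split; clear -h1 h2 h3 h4; lra.
Qed.

End Tower.

(** * Stochastic approximation *)

Section Sequences.
Variable R : realType.

(** A Chung-type bound with a delayed term, which comes from the memory of the noise. As the
    increments of [1 / al] tend to 0, passing from [al n.+1] to [al n.+2] loses only a small
    multiple of the square of [al n.+1], and the contraction [c] pays for it. *)
Lemma recursion_bound (u al : nat -> R) (c K : R) :
  0 < c -> 0 <= K -> (forall n, 0 <= u n) -> (forall n, 0 < al n) ->
  (forall n, al n.+1 <= al n) -> al @ \oo --> (0 : R) ->
  (fun n => (al n.+1)^-1 - (al n)^-1) @ \oo --> (0 : R) ->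
  (forall n, u n.+2 <= u n.+1 - al n.+1 * c * u n.+1 +
     K * al n.+1 * al n * (1 + u n) + K * al n.+1 ^+ 2 * (1 + u n.+1)) ->
  exists2 B : R, 0 <= B & forall n, u n <= B * al n.
Proof.
move=> c0 K0 u0 al0 aldec al_0 dal_0 step.
have e0 : 0 < c / (8 * (K + 1)) by rewrite divr_gt0 ?mulr_gt0 ?ltr_wpDl.
have e1 : 0 < (2 * c)^-1 by rewrite invr_gt0 mulr_gt0.
have e2 : 0 < c / 4 by rewrite divr_gt0.
have [N _ NP] : \forall n \near \oo, [/\ al n < c / (8 * (K + 1)), al n < (2 * c)^-1 &
    (al n.+1)^-1 - (al n)^-1 < c / 4].
  near=> n; split; near: n.
  - exact: (cvgr_lt _ al_0).
  - exact: (cvgr_lt _ al_0).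
  - exact: (cvgr_lt _ dal_0).
(* The first summand makes the constant error terms a fraction of the contraction; the sum covers
   the indices before the threshold. *)
pose B := 8 * K / c + \sum_(i < N.+2) u i / al i.
have S0 : 0 <= \sum_(i < N.+2) u i / al i.
  by apply: sumr_ge0 => i _; rewrite divr_ge0// ltW.
have B0 : 0 <= B by rewrite addr_ge0// divr_ge0 ?mulr_ge0// ltW.
have BK : 8 * K <= B * c by rewrite -ler_pdivrMr// lerDl.
exists B => //.
have small n : (n < N.+2)%N -> u n <= B * al n.
  move=> nN; rewrite -ler_pdivrMr//.
  rewrite (@le_trans _ _ (\sum_(i < N.+2) u i / al i))//; last first.
    by rewrite lerDr divr_ge0 ?mulr_ge0// ltW.
  rewrite (bigD1 (Ordinal nN))//= lerDl; apply: sumr_ge0 => i _.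
  by rewrite divr_ge0// ltW.
suff H n : u n <= B * al n /\ u n.+1 <= B * al n.+1 by move=> n; case: (H n).
elim: n => [|n [IH0 IH1]]; first by split; apply: small.
split=> //; have [nN|nN] := ltnP n.+2 N.+2; first exact: small.
have Nn : (N <= n)%N by [].
have [p1 q1 r1] := NP n Nn; have [p2 q2 r2] := NP n.+1 (leqW Nn).
have := step n; have := al0 n; have := al0 n.+1; have := al0 n.+2.
move: r1 r2 (aldec n) (aldec n.+1) IH0 IH1 p1 p2 q1 q2 (u0 n) (u0 n.+1).
move: (al n) (al n.+1) (al n.+2) (u n) (u n.+1) (u n.+2) => x y z a b d.
move=> r1 r2 yx zy aB bB p1 p2 q1 q2 a0 b0 z0 y0 x0 stp.
have xy : x - y <= c / 4 * (x * y).
  rewrite -ler_pdivrMr ?mulr_gt0// (_ : _ / _ = y^-1 - x^-1) ?(ltW r1)//.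
  by field; rewrite !gt_eqF.
have yz : y - z <= c / 4 * (y * z).
  rewrite -ler_pdivrMr ?mulr_gt0// (_ : _ / _ = z^-1 - y^-1) ?(ltW r2)//.
  by field; rewrite !gt_eqF.
have cy : c * y <= 1 / 2.
  have : y * (2 * c) <= 1 by rewrite -ler_pdivlMr ?mulr_gt0// mul1r ltW.
  by clear; lra.
have Ky : K * y <= c / 8.
  have : y * (8 * (K + 1)) <= c by rewrite -ler_pdivlMr ?ltW// mulr_gt0// ltr_wpDl.
  by have := ltW y0; clear; lra.
have Kx : K * x <= c / 8.
  have : x * (8 * (K + 1)) <= c by rewrite -ler_pdivlMr ?ltW// mulr_gt0// ltr_wpDl.
  by have := ltW x0; clear; lra.
have x2y : x <= 2 * y.
  by have := ler_wpM2l (ltW x0) cy; move: xy (ltW y0); clear; lra.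
have t1 : b * (1 - c * y + K * y ^+ 2) <= B * y * (1 - c * y + K * y ^+ 2).
  apply: ler_wpM2r => //; have := mulr_ge0 K0 (sqr_ge0 y); move: cy; clear; lra.
have By0 : 0 <= B * y by rewrite mulr_ge0// ltW.
have Bx0 : 0 <= B * x by rewrite mulr_ge0// ltW.
have t2 : B * y * (K * y ^+ 2) <= c / 8 * (B * y ^+ 2).
  by have := ler_wpM2r (mulr_ge0 By0 (ltW y0)) Ky; rewrite !expr2; clear; lra.
have t3 : K * y * x * a <= c / 4 * (B * y ^+ 2).
  have h1 := ler_wpM2l (mulr_ge0 (mulr_ge0 K0 (ltW y0)) (ltW x0)) aB.
  have h2 := ler_wpM2l (mulr_ge0 Bx0 (ltW y0)) Kx.
  have h3 := ler_wpM2l (mulr_ge0 (mulr_ge0 B0 (ltW y0)) (ltW c0)) x2y.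
  move: h1 h2 h3; rewrite !expr2; clear; lra.
have t4 : K * y * x <= 2 * (K * y ^+ 2).
  by have := ler_wpM2l (mulr_ge0 K0 (ltW y0)) x2y; rewrite expr2; clear; lra.
have t5 : 3 * (K * y ^+ 2) <= 3 / 8 * (c * (B * y ^+ 2)).
  by have := ler_wpM2r (sqr_ge0 y) BK; clear; lra.
have t6 : B * y - B * z <= c / 4 * (B * y ^+ 2).
  have h1 := ler_wpM2l B0 yz.
  have h2 := ler_wpM2l (mulr_ge0 (mulr_ge0 B0 (ltW y0)) (ltW c0)) zy.
  by move: h1 h2; rewrite !expr2; clear; lra.
(* The contraction gains [c * (B * y ^+ 2)]; the losses in [t2], [t3], [t5], [t6] use up the shares
   1/8, 1/4, 3/8 and 1/4 of it. *)
move: stp t1 t2 t3 t4 t5 t6; rewrite !expr2; clear; lra.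
Unshelve. all: by end_near. Qed.

(** Cauchy-Schwarz for the vectors with entries [sqrt c] and [sqrt c * x]. *)
Lemma sqr_sum_weighted (N : nat) (c x : nat -> R) : (forall n, 0 <= c n) ->
  (\sum_(n < N) c n * x n) ^+ 2 <= (\sum_(n < N) c n) * \sum_(n < N) c n * x n ^+ 2.
Proof.
move=> c0.
pose p : 'rV[R]_N := \row_i Num.sqrt (c i); pose q : 'rV[R]_N := \row_i (Num.sqrt (c i) * x i).
have sc n : Num.sqrt (c n) * Num.sqrt (c n) = c n by rewrite -expr2 sqr_sqrtr.
have -> : \sum_(n < N) c n * x n = dotv p q.
  by apply: eq_bigr => i _; rewrite !mxE mulrA sc.
have -> : \sum_(n < N) c n = enorm p ^+ 2.
  by rewrite enorm_sqr; apply: eq_bigr => i _; rewrite !mxE sc.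
have -> : \sum_(n < N) c n * x n ^+ 2 = enorm q ^+ 2.
  by rewrite enorm_sqr; apply: eq_bigr => i _; rewrite !mxE mulrACA sc expr2.
rewrite -exprMn -[leLHS]real_normK ?num_real// lerXn2r ?nnegrE ?mulr_ge0//.
exact: normr_dotv.
Qed.

Lemma enorm_sum_weighted d (N : nat) (c : nat -> R) (X : nat -> 'rV[R]_d) :
  (forall n, 0 <= c n) ->
  enorm (\sum_(n < N) c n *: X n) ^+ 2 <=
    (\sum_(n < N) c n) * \sum_(n < N) c n * enorm (X n) ^+ 2.
Proof.
move=> c0; apply: le_trans (sqr_sum_weighted N (fun n => enorm (X n)) c0).
rewrite lerXn2r ?nnegrE//.
  by apply: sumr_ge0 => i _; rewrite mulr_ge0.
rewrite (le_trans (enorm_sum _ _ _))//; apply: ler_sum => i _.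
by rewrite enormZ ger0_norm.
Qed.

Lemma summation_by_parts d (N : nat) (b : nat -> R) (x : nat -> 'rV[R]_d) :
  \sum_(n < N) b n *: (x n.+1 - x n) =
  b N *: x N - b 0%N *: x 0%N - \sum_(n < N) (b n.+1 - b n) *: x n.+1.
Proof.
elim: N => [|N IH]; first by rewrite !big_ord0 subrr subr0.
rewrite !big_ord_recr /= IH.
by apply/rowP => i; rewrite !mxE; ring.
Qed.

(** Discrete form of integrating [1 / sqrt b]: with [p] and [q] the new and old square roots,
    [(p ^+ 2 - q ^+ 2) / p <= 2 * (p - q)], and the right side telescopes. *)
Lemma sum_sqrt_increments (b : nat -> R) N : (forall n, 0 < b n) ->
  (forall n, b n <= b n.+1) ->
  \sum_(n < N) (b n.+1 - b n) / Num.sqrt (b n.+1) <= 2 * Num.sqrt (b N).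
Proof.
move=> b0 binc; elim: N => [|N IH]; first by rewrite big_ord0 mulr_ge0 ?sqrtr_ge0.
rewrite big_ord_recr /=.
have p0 : 0 < Num.sqrt (b N.+1) by rewrite sqrtr_gt0.
have q0 : 0 <= Num.sqrt (b N) by exact: sqrtr_ge0.
have qp : Num.sqrt (b N) <= Num.sqrt (b N.+1) by exact: ler_wsqrtr.
suff : (b N.+1 - b N) / Num.sqrt (b N.+1) <= 2 * (Num.sqrt (b N.+1) - Num.sqrt (b N)).
  by move: IH; clear; lra.
rewrite ler_pdivrMr// -{1}(sqr_sqrtr (ltW (b0 N.+1))) -{1}(sqr_sqrtr (ltW (b0 N))).
have := mulr_ge0 (_ : 0 <= Num.sqrt (b N.+1) - Num.sqrt (b N)) q0.
rewrite subr_ge0 => /(_ qp).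
have h : 0 <= (Num.sqrt (b N.+1) - Num.sqrt (b N)) ^+ 2 by exact: sqr_ge0.
move: h; move: (Num.sqrt _) (Num.sqrt _) => p q; rewrite !expr2; clear; lra.
Qed.

End Sequences.

(** Bookkeeping for a sum of six terms split by five uses of [|a + b|^2 <= 2 |a|^2 + 2 |b|^2],
    whence the factor 32. *)
Lemma iterated_sqr_bound (R : realFieldType) (g1 g2 g3 g4 g5 g6 f1 f2 f3 f4 f5 c1 c2 c3 c4 c5 c6 Z : R) :
  0 <= Z -> 0 <= c1 -> 0 <= c2 -> 0 <= c3 -> 0 <= c4 -> 0 <= c5 -> 0 <= c6 ->
  f1 <= 2 * g1 + 2 * g2 -> f2 <= 2 * f1 + 2 * g3 -> f3 <= 2 * f2 + 2 * g4 ->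
  f4 <= 2 * f3 + 2 * g5 -> f5 <= 2 * f4 + 2 * g6 ->
  g1 <= c1 * Z -> g2 <= c2 * Z -> g3 <= c3 * Z -> g4 <= c4 * Z -> g5 <= c5 * Z ->
  g6 <= c6 * Z -> f5 <= 32 * (c1 + c2 + c3 + c4 + c5 + c6) * Z.
Proof.
move=> z0 /mulr_ge0 /(_ z0) h1 /mulr_ge0 /(_ z0) h2 /mulr_ge0 /(_ z0) h3.
move=> /mulr_ge0 /(_ z0) h4 /mulr_ge0 /(_ z0) h5 /mulr_ge0 /(_ z0) h6.
move=> e1 e2 e3 e4 e5 k1 k2 k3 k4 k5 k6; lra.
Qed.

(** * Vector expectations and martingale increments *)

Section StochasticApproximation.
Context {disp : measure_display} {T : measurableType disp} {R : realType}.
Variables (d : nat) (P : probability T R) (W : nat -> T -> 'rV[R]_d) (M : R).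
Hypothesis M0 : 0 <= M.
Hypothesis WM : forall n t, enorm (W n t) <= M.
Hypothesis iidW : iid P W.
Notation path := (nat -> 'rV[R]_d).
Notation E := (EW P W).
Notation nice := (nice M).
Notation niceV := (niceV M).
Notation inball := (inball M).
Implicit Types (w v : path) (Psi Phi : path -> R) (X Y Z : path -> 'rV[R]_d).

Let E_le := @EW_le _ _ _ _ P W M M0 WM iidW.
Let ED := @EWD _ _ _ _ P W M M0 WM iidW.
Let EZ := @EWZ _ _ _ _ P W M M0 WM iidW.
Let E_eq := @EW_eq _ _ _ _ P W M WM.
Let E_cst := @EW_cst _ _ _ _ P W.
Let tower := @EW_tower _ _ _ _ P W M M0 WM iidW.

Lemma EB n Psi Phi : nice n Psi -> nice n Phi ->
  E (fun w => Psi w - Phi w) = E Psi - E Phi.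
Proof.
move=> nA nB; rewrite (ED nA (niceN M0 nB)) -[in RHS]mulN1r -(EZ _ nB).
by congr (_ + E _); apply/funext => w; rewrite mulN1r.
Qed.

Lemma E_ge0 n Psi : nice n Psi -> (forall w, inball w -> 0 <= Psi w) -> 0 <= E Psi.
Proof.
move=> nA P0; have h := E_le (nice_cst d M n 0) nA P0.
by rewrite E_cst in h.
Qed.

Lemma E1D n Psi : nice n Psi -> 1 + E Psi = E (fun w => 1 + Psi w).
Proof. by move=> nP; rewrite (ED (nice_cst d M n 1) nP) E_cst. Qed.

Lemma E_eq0 Psi : (forall w, inball w -> Psi w = 0) -> E Psi = 0.
Proof. by move=> P0; rewrite (E_eq P0) E_cst. Qed.

Lemma E_sum n (I : Type) (r : seq I) (F : I -> path -> R) : (forall i, nice n (F i)) ->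
  E (fun w => \sum_(i <- r) F i w) = \sum_(i <- r) E (F i).
Proof.
move=> nF; elim: r => [|i r IH].
  by rewrite big_nil; under eq_fun do rewrite big_nil; exact: E_cst.
rewrite big_cons -IH -(ED (nF i) (nice_sum r nF)).
by congr (E _); apply/funext => w; rewrite big_cons.
Qed.

(** [pdist n] does not see the coordinates from [n] on, so a [nice n] functional cannot see them
    either. *)
Lemma nice_upd_id n m Psi w c : nice n Psi -> (n <= m)%N -> inball w -> enorm c <= M ->
  Psi (upd w m c) = Psi w.
Proof.
move=> [C C0 PC] nm wM cM; apply/eqP.
rewrite -subr_eq0 -normr_eq0 eq_le normr_ge0 andbT.
rewrite (le_trans (PC _ _ (inball_upd m wM cM) wM))// /pdist big1 ?mulr0// => i _.
by rewrite upd_lt ?subrr ?enorm0// (leq_trans (ltn_ord i)).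
Qed.

Lemma niceV_upd_id n m X w c : niceV n X -> (n <= m)%N -> inball w -> enorm c <= M ->
  X (upd w m c) = X w.
Proof.
by move=> nX nm wM cM; apply/rowP => i; apply: (nice_upd_id (nX i)).
Qed.

Lemma nice_congr n Psi Phi : (forall w, inball w -> Psi w = Phi w) -> nice n Psi -> nice n Phi.
Proof.
by move=> PP [C C0 PC]; exists C => // w v wM vM; rewrite -!PP// PC.
Qed.

Definition EV X : 'rV[R]_d := \row_i E (fun w => X w 0 i).

Lemma dotv_EV n c X : niceV n X -> dotv c (EV X) = E (fun w => dotv c (X w)).
Proof.
move=> nX; rewrite /dotv (@E_sum n) => [|i]; last by apply: niceZ.
by apply: eq_bigr => i _; rewrite mxE (EZ _ (nX i)).
Qed.

(** Pairing the mean with itself reduces the bound to a scalar expectation. *)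
Lemma enorm_EV n X B : 0 <= B -> niceV n X -> (forall w, inball w -> enorm (X w) <= B) ->
  enorm (EV X) <= B.
Proof.
move=> B0 nX XB; have [->|e0] := eqVneq (EV X) 0; first by rewrite enorm0.
rewrite -(ler_pM2l (_ : 0 < enorm (EV X))) ?enorm_gt0// -expr2 enorm_sqr (dotv_EV _ nX).
rewrite -[leRHS]E_cst; apply: (@E_le n).
- by apply: nice_dotv => //; exact: niceV_cst.
- exact: nice_cst.
by move=> w wM; rewrite (le_trans (ler_dotv _ _))// ler_wpM2l// XB.
Qed.

Lemma EVB n X Y : niceV n X -> niceV n Y -> EV (fun w => X w - Y w) = EV X - EV Y.
Proof.
move=> nX nY; apply/rowP => i; rewrite !mxE -(EB (nX i) (nY i)).
by congr (E _); apply/funext => w; rewrite !mxE.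
Qed.

(** Pythagoras for martingale increments: the partial sum ignores sample [N.+1], so averaging over
    that sample annihilates the cross term. *)
Lemma E_orthogonal (X : nat -> path -> 'rV[R]_d) N :
  (forall n, niceV n.+2 (X n)) ->
  (forall n w, inball w -> EV (fun v => X n (upd w n.+1 (v 0%N))) = 0) ->
  E (fun w => enorm (\sum_(n < N) X n w) ^+ 2) = \sum_(n < N) E (fun w => enorm (X n w) ^+ 2).
Proof.
move=> nX X0.
have nS m : niceV m.+1 (fun w => \sum_(n < m) X n w).
  move=> i; under eq_fun do rewrite summxE; apply: nice_sum => k.
  by apply: nice_mono (nX k i); rewrite ltnS ltn_ord.
elim: N => [|N IH].
  rewrite big_ord0 (_ : (fun w => _) = fun=> 0) ?E_cst//.
  by apply/funext => w; rewrite big_ord0 enorm0 expr0n.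
have nS' := niceV_mono (leqnSn _) (nS N).
rewrite big_ord_recr /= -IH.
transitivity (E (fun w => (enorm (\sum_(n < N) X n w) ^+ 2 +
    2 * dotv (\sum_(n < N) X n w) (X N w)) + enorm (X N w) ^+ 2)).
  by congr (E _); apply/funext => w; rewrite big_ord_recr /= enormD_sqr.
have nd := nice_dotv M0 nS' (nX N).
have n1 := nice_enorm_sqr M0 nS'; have n2 := nice_enorm_sqr M0 (nX N).
rewrite (ED (niceD n1 (niceZ M0 2 nd)) n2).
rewrite (ED n1 (niceZ M0 2 nd)).
rewrite (EZ _ nd) (tower nd) (_ : E (integrate _ _ _ _) = 0) ?mulr0 ?addr0//.
apply: E_eq0 => w wM.
transitivity (dotv (\sum_(n < N) X n w) (EV (fun v => X N (upd w N.+1 (v 0%N)))));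
  last by rewrite X0// dotv0.
rewrite (@dotv_EV 1); last by move=> i; apply: (nice_integrand (nX N i)).
by apply: E_eq => v vM; congr dotv; exact: niceV_upd_id (nS N) (leqnn _) wM (vM 0%N).
Qed.

(** * Two-sample fields and their averages *)

Variable F : 'rV[R]_d -> 'rV[R]_d -> 'rV[R]_d -> 'rV[R]_d.
Variables (t : 'rV[R]_d) (CF : R).
Hypothesis niceF : forall n X i j, niceV n X -> (i < n)%N -> (j < n)%N ->
  niceV n (fun w => F (X w) (w i) (w j)).
Hypothesis CF0 : 0 <= CF.
Hypothesis F_lip : forall x y u v : 'rV[R]_d, enorm u <= M -> enorm v <= M ->
  enorm (F x u v - F y u v) <= CF * enorm (x - y).
Hypothesis F_t : forall u v : 'rV[R]_d, enorm u <= M -> enorm v <= M -> enorm (F t u v) <= CF.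

(* [F] sees two consecutive samples; [hF x u] is its mean over the new one, given the old one [u]. *)
Definition hF x u := EV (fun v => F x u (v 0%N)).
Definition fbar x := EV (fun v => hF x (v 0%N)).
(** What the older sample still reveals about the next value of the field: centred in [u], it is the
    corrector in the Poisson equation. *)
Definition ht x u := hF x u - fbar x.

Lemma niceF1 x u : enorm u <= M -> niceV 1 (fun v => F x u (v 0%N)).
Proof.
move=> uM i; have nF := niceF (i := 0%N) (j := 1%N) (niceV_cst M 2 x) isT isT.
have wM : inball (fun=> u) by [].
have := nice_integrand (nF i) wM; apply: nice_congr => v vM.
by rewrite updE.
Qed.

Lemma hF_lip x y u : enorm u <= M -> enorm (hF x u - hF y u) <= CF * enorm (x - y).
Proof.
move=> uM; have nx := niceF1 x uM; have ny := niceF1 y uM.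
rewrite /hF -(EVB nx ny); apply: (@enorm_EV 1).
- by rewrite mulr_ge0.
- exact: niceVB.
by move=> w wM; exact: F_lip.
Qed.

Lemma nice_hF n X i : niceV n X -> (i < n)%N -> niceV n (fun w => hF (X w) (w i)).
Proof.
move=> nX ni k; have nF := niceF (niceV_mono (leqnSn n) nX) (leqW ni) (ltnSn n).
apply: nice_congr (nice_integrate M0 WM iidW (nF k)) => w wM.
rewrite /integrate mxE; apply: E_eq => v vM.
by rewrite (niceV_upd_id nX)// updE upd_lt.
Qed.

Lemma nice_hF1 x : niceV 1 (fun v => hF x (v 0%N)).
Proof. exact: (@nice_hF 1 (fun=> x) 0%N (niceV_cst M 1 x)). Qed.

Lemma fbar_lip x y : enorm (fbar x - fbar y) <= CF * enorm (x - y).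
Proof.
rewrite /fbar -(EVB (nice_hF1 x) (nice_hF1 y)); apply: (@enorm_EV 1).
- by rewrite mulr_ge0.
- by apply: niceVB => //; exact: nice_hF1.
by move=> w wM; exact: hF_lip.
Qed.

Lemma nice_fbar n X : niceV n X -> niceV n (fun w => fbar (X w)).
Proof.
move=> nX i; apply: (@nice_comp _ _ M M0 n (fun x => fbar x 0 i)) => // r.
exists CF => // x y _ _; apply: le_trans (fbar_lip x y).
by apply: le_trans (enorm_coord _ i); rewrite !mxE.
Qed.

Lemma nice_ht n X i : niceV n X -> (i < n)%N -> niceV n (fun w => ht (X w) (w i)).
Proof. by move=> nX ni; apply: niceVB => //; [exact: nice_hF|exact: nice_fbar]. Qed.

Lemma ht_lip x y u : enorm u <= M -> enorm (ht x u - ht y u) <= 2 * CF * enorm (x - y).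
Proof.
move=> uM; have -> : ht x u - ht y u = (hF x u - hF y u) - (fbar x - fbar y).
  rewrite /ht; move: (hF x u) (hF y u) (fbar x) (fbar y) => a b a' b'.
  by apply/rowP => i; rewrite !mxE; ring.
rewrite (le_trans (enormD _ _))// enormN -mulrA mulrDl !mul1r lerD//.
  exact: hF_lip.
exact: fbar_lip.
Qed.

Lemma F_bound (x u v : 'rV[R]_d) : enorm u <= M -> enorm v <= M ->
  enorm (F x u v) <= CF * (1 + enorm (x - t)).
Proof.
move=> uM vM; rewrite -(subrK (F t u v) (F x u v)) (le_trans (enormD _ _))//.
by rewrite mulrDr mulr1 addrC lerD ?F_t ?F_lip.
Qed.

(** The state and the test vector involve only samples before [n], so the new sample can be averaged
    out while they stay frozen. *)
Lemma E_F n X Y i : niceV n X -> niceV n Y -> (i < n)%N ->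
  E (fun w => dotv (Y w) (F (X w) (w i) (w n))) =
  E (fun w => dotv (Y w) (hF (X w) (w i))).
Proof.
move=> nX nY ni.
have nF := niceF (niceV_mono (leqnSn n) nX) (leqW ni) (ltnSn n).
rewrite (tower (nice_dotv M0 (niceV_mono (leqnSn n) nY) nF)).
apply: E_eq => w wM; rewrite /integrate (@dotv_EV 1); last exact: niceF1.
apply: E_eq => v vM.
by rewrite (niceV_upd_id nX)// (niceV_upd_id nY)// updE upd_lt.
Qed.

(** Sample [n] is new to [X] and [Y], and [ht] is centred in it. Along the recursion the current
    state already contains that sample, hence the comparison in [drift_lip]. *)
Lemma E_ht n X Y : niceV n X -> niceV n Y ->
  E (fun w => dotv (Y w) (ht (X w) (w n))) = 0.
Proof.
move=> nX nY.
have nh := nice_ht (niceV_mono (leqnSn n) nX) (ltnSn n).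
rewrite (tower (nice_dotv M0 (niceV_mono (leqnSn n) nY) nh)).
apply: E_eq0 => w wM; rewrite /integrate.
transitivity (E (fun v => dotv (Y w) (hF (X w) (v 0%N)) - dotv (Y w) (fbar (X w)))).
  apply: E_eq => v vM.
  by rewrite (niceV_upd_id nX)// (niceV_upd_id nY)// updE /ht dotvBr.
rewrite (@EB 1).
- by rewrite E_cst -(dotv_EV _ (nice_hF1 _)) subrr.
- by apply: nice_dotv => //; [exact: niceV_cst|exact: nice_hF1].
exact: nice_cst.
Qed.

(** * The Lyapunov function *)

Variables (V : 'rV[R]_d -> R) (gV : 'rV[R]_d -> 'rV[R]_d) (cV CV : R).
Hypothesis cV0 : 0 < cV.
Hypothesis CV0 : 0 <= CV.
Hypothesis V_lower : forall x, cV * enorm (x - t) ^+ 2 <= V x.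
Hypothesis V_upper : forall x, V x <= CV * enorm (x - t) ^+ 2.
Hypothesis V_step : forall x u, V (x + u) <= V x + dotv (gV x) u + CV * enorm u ^+ 2.
Hypothesis gV_lip : forall x y, enorm (gV x - gV y) <= CV * enorm (x - y).
Hypothesis gV_t : gV t = 0.
Hypothesis V_decrease : forall x, dotv (gV x) (fbar x) <= - cV * enorm (x - t) ^+ 2.
Hypothesis fbar_t : fbar t = 0.

Lemma gV_bound x : enorm (gV x) <= CV * enorm (x - t).
Proof. by have := gV_lip x t; rewrite gV_t subr0. Qed.

Lemma V_locally_lip : locally_lip V.
Proof.
move=> r; exists (CV * (3 * `|r| + enorm t)).
  by rewrite mulr_ge0// addr_ge0 ?mulr_ge0.
have half x y : enorm x <= r -> enorm y <= r ->
    V x - V y <= CV * (3 * `|r| + enorm t) * enorm (x - y).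
  move=> xr yr; have := V_step y (x - y); rewrite subrKC => h.
  have r0 : 0 <= r by rewrite (le_trans (enorm_ge0 x)).
  have yt : enorm (y - t) <= r + enorm t.
    by rewrite (le_trans (enormD _ _))// enormN lerD2r.
  have xy : enorm (x - y) <= r + r by rewrite (le_trans (enormD _ _))// enormN lerD.
  have g1 := ler_dotv (gV y) (x - y).
  have g2 := ler_wpM2r (enorm_ge0 (x - y)) (le_trans (gV_bound y) (ler_wpM2l CV0 yt)).
  have g3 := ler_wpM2l (mulr_ge0 CV0 (enorm_ge0 (x - y))) xy.
  rewrite ger0_norm//; move: h g1 g2 g3; rewrite expr2.
  move: (V x) (V y) (dotv _ _) (enorm (gV y)) (enorm (x - y)) (enorm t) CV.
  move=> a b c e f g k; lra.
move=> x y xr yr; rewrite ler_norml; apply/andP; split; last exact: half.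
by rewrite lerNl opprB enormB half.
Qed.

Lemma nice_V n X : niceV n X -> nice n (fun w => V (X w)).
Proof. exact: (nice_comp M0 V_locally_lip). Qed.

Lemma nice_gV n X : niceV n X -> niceV n (fun w => gV (X w)).
Proof.
move=> nX i; apply: (@nice_comp _ _ M M0 n (fun x => gV x 0 i)) => // r.
exists CV => // x y _ _; apply: le_trans (gV_lip x y).
by apply: le_trans (enorm_coord _ i); rewrite !mxE.
Qed.

Lemma ht_bound x u : enorm u <= M -> enorm (ht x u) <= 2 * CF * (1 + enorm (x - t)).
Proof.
move=> uM; have htt : enorm (ht t u) <= CF.
  by rewrite /ht fbar_t subr0; apply: (@enorm_EV 1 _ _ CF0 (niceF1 t uM)) => w wM; exact: F_t.
rewrite -(subrK (ht t u) (ht x u)) (le_trans (enormD _ _))//.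
have := ht_lip x t uM; move: htt CF0; move: (CF) (enorm _) (enorm _) (enorm _).
by move=> c p q r; lra.
Qed.

Lemma sqr1D_le (a : R) : (1 + a) ^+ 2 <= 2 * (1 + a ^+ 2).
Proof. by have := sqr_ge0 (1 - a); rewrite !expr2; lra. Qed.

(** Cost of replacing a state by its predecessor in the pairing with [ht]. Both factors are
    Lipschitz and of linear growth, so a displacement of relative size [a] costs O(a) times one plus
    the squared distance. *)
Lemma drift_lip x y u (a : R) : enorm u <= M -> 0 <= a <= 1 ->
  enorm (x - y) <= a * (CF * (1 + enorm (y - t))) ->
  dotv (gV x) (ht x u) - dotv (gV y) (ht y u) <=
    a * (4 * CV * CF ^+ 2 * (2 + CF)) * (1 + enorm (y - t) ^+ 2).
Proof.
move=> uM /andP[a0 a1] xy.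
have -> : dotv (gV x) (ht x u) - dotv (gV y) (ht y u) =
    dotv (gV x - gV y) (ht x u) + dotv (gV y) (ht x u - ht y u).
  by rewrite dotvBl dotvBr addrA subrK.
have y0 := enorm_ge0 (y - t).
have xt : 1 + enorm (x - t) <= (1 + CF) * (1 + enorm (y - t)).
  have := enorm_triangle x y t; have : 0 <= CF * (1 + enorm (y - t)).
    by rewrite mulr_ge0// addr_ge0.
  move=> Z0; have := ler_piMl Z0 a1; move: xy Z0; rewrite mulrDl mul1r.
  move: (CF * (1 + enorm (y - t))) (enorm (x - t)) (enorm (y - t)) (enorm (x - y)).
  by move=> p q r s; lra.
have h1 : dotv (gV x - gV y) (ht x u) <= CV * enorm (x - y) * (2 * CF * ((1 + CF) * (1 + enorm (y - t)))).
  rewrite (le_trans (ler_dotv _ _))// ler_pM//.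
  rewrite (le_trans (ht_bound x uM))// ler_wpM2l// mulr_ge0//.
have h2 : dotv (gV y) (ht x u - ht y u) <= CV * (1 + enorm (y - t)) * (2 * CF * enorm (x - y)).
  rewrite (le_trans (ler_dotv _ _))// ler_pM//; last exact: ht_lip.
  by rewrite (le_trans (gV_bound y))// ler_wpM2l// lerDr.
have h3 : CV * (2 * CF * (1 + enorm (y - t)) * (2 + CF)) * enorm (x - y) <=
    CV * (2 * CF * (1 + enorm (y - t)) * (2 + CF)) * (a * (CF * (1 + enorm (y - t)))).
  by rewrite ler_wpM2l// !mulr_ge0 ?addr_ge0.
have h4 := ler_wpM2l (_ : 0 <= a * (2 * CV * CF ^+ 2 * (2 + CF))) (sqr1D_le (enorm (y - t))).
have h5 := h4 ltac:(by rewrite !mulr_ge0 ?addr_ge0 ?sqr_ge0).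
move: h1 h2 h3 h5; rewrite !expr2.
move: (dotv _ _) (dotv _ _) (enorm (x - y)) (enorm (y - t)) (CF) (CV).
move=> p q r s c v; lra.
Qed.

(** * Mean-square bound on the iterates *)

Variables (al : nat -> R) (x0 : 'rV[R]_d).
Hypothesis al0 : forall n, 0 < al n.
Hypothesis al1 : forall n, al n <= 1.

(** The step out of [n] uses samples [n] and [n.+1] with step size [al n], so [theta n] is a
    functional of the samples 0 to [n]. *)
Fixpoint theta n (w : path) : 'rV[R]_d :=
  if n is m.+1 then theta m w + al m *: F (theta m w) (w m) (w m.+1) else x0.

Lemma nice_theta n : niceV n.+1 (theta n).
Proof.
elim: n => [|n IH]; first exact: niceV_cst.
have IH' := niceV_mono (leqnSn _) IH.
apply: niceVD => //; apply: niceVZ => //; first exact: nice_cst.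
exact: niceF.
Qed.

Definition msd n := E (fun w => enorm (theta n w - t) ^+ 2).

Lemma nice_msd n : nice n.+1 (fun w => enorm (theta n w - t) ^+ 2).
Proof.
by apply: nice_enorm_sqr => //; apply: niceVB => //; [exact: nice_theta|exact: niceV_cst].
Qed.

Lemma msd_ge0 n : 0 <= msd n.
Proof. by apply: (E_ge0 (nice_msd n)) => w _; exact: sqr_ge0. Qed.

Lemma theta_increment n w : inball w ->
  enorm (theta n.+1 w - theta n w) <= al n * (CF * (1 + enorm (theta n w - t))).
Proof.
move=> wM; rewrite /= addrAC subrr add0r enormZ gtr0_norm//.
by apply: ler_wpM2l; [exact: ltW|exact: F_bound].
Qed.

(** One expansion of the Lyapunov function. Averaging over the newest sample leaves [hF], that is
    [fbar] plus [ht]: the former gives the decrease, the latter is compared with its value at the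
    previous state, where the pairing has mean zero. *)
Lemma moment_step : exists2 K : R, 0 <= K & forall n,
  E (fun w => V (theta n.+2 w)) <= E (fun w => V (theta n.+1 w)) - al n.+1 * (cV * msd n.+1) +
    K * al n.+1 * al n * (1 + msd n) + K * al n.+1 ^+ 2 * (1 + msd n.+1).
Proof.
pose K1 := 4 * CV * CF ^+ 2 * (2 + CF); pose K2 := 2 * CV * CF ^+ 2.
have K10 : 0 <= K1 by rewrite !mulr_ge0 ?addr_ge0.
have K20 : 0 <= K2 by rewrite !mulr_ge0.
exists (K1 + K2); first exact: addr_ge0.
move=> n; have a0 := ltW (al0 n); have b0 := ltW (al0 n.+1).
have nT := niceV_mono (leqnSn _) (nice_theta n.+1).
have nT' := nice_theta n.+1.
have nT2 := nice_theta n.+2.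
have nT0 := nice_theta n.
have n1 := nice_V nT.
have ng := nice_gV nT; have ng' := nice_gV nT'.
have nF : niceV n.+3 (fun w => F (theta n.+1 w) (w n.+1) (w n.+2)) by exact: niceF.
have nd := nice_dotv M0 ng nF.
have n2 := nice_mono (leqnSn _) (nice_msd n.+1).
have nc c := nice_cst d M n.+3 c.
have A1 : E (fun w => V (theta n.+2 w)) <= E (fun w => V (theta n.+1 w)) +
   al n.+1 * E (fun w => dotv (gV (theta n.+1 w)) (F (theta n.+1 w) (w n.+1) (w n.+2))) +
   K2 * al n.+1 ^+ 2 * (1 + msd n.+1).
  rewrite -(EZ _ nd) -(ED n1 (niceZ M0 _ nd)) /msd (E1D n2).
  rewrite -(EZ _ (niceD (nc 1) n2)).
  rewrite -(ED (niceD n1 (niceZ M0 _ nd)) (niceZ M0 _ (niceD (nc 1) n2))).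
  apply: (E_le (nice_V nT2)).
    by apply: niceD; [apply: niceD => //; exact: niceZ|apply: niceZ => //; exact: niceD].
  move=> w wM; rewrite [theta n.+2 w]/=; apply: le_trans (V_step _ _) _.
  rewrite dotvZr lerD2l enormZ (ger0_norm b0) exprMn.
  have fb := F_bound (theta n.+1 w) (wM n.+1) (wM n.+2).
  have : enorm (F (theta n.+1 w) (w n.+1) (w n.+2)) ^+ 2 <=
      CF ^+ 2 * (2 * (1 + enorm (theta n.+1 w - t) ^+ 2)).
    rewrite (@le_trans _ _ ((CF * (1 + enorm (theta n.+1 w - t))) ^+ 2))//.
      by rewrite lerXn2r ?nnegrE ?mulr_ge0 ?addr_ge0.
    by rewrite exprMn ler_wpM2l// sqr1D_le.
  move=> /(ler_wpM2l (mulr_ge0 CV0 (sqr_ge0 (al n.+1)))); rewrite /K2.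
  move: (enorm _ ^+ 2) (enorm _ ^+ 2) (al n.+1 ^+ 2) (CF ^+ 2) (CV).
  move=> p q r s v; lra.
have A2 : E (fun w => dotv (gV (theta n.+1 w)) (F (theta n.+1 w) (w n.+1) (w n.+2))) <=
    - (cV * msd n.+1) + al n * K1 * (1 + msd n).
  rewrite (@E_F n.+2 (theta n.+1) (fun w => gV (theta n.+1 w)) n.+1)//.
  have nh' := nice_ht nT' (ltnSn n.+1).
  have nf' := nice_fbar nT'.
  have m1 := nice_dotv M0 ng' nf'; have m2 := nice_dotv M0 ng' nh'.
  have -> : E (fun w => dotv (gV (theta n.+1 w)) (hF (theta n.+1 w) (w n.+1))) =
      E (fun w => dotv (gV (theta n.+1 w)) (fbar (theta n.+1 w))) +
      E (fun w => dotv (gV (theta n.+1 w)) (ht (theta n.+1 w) (w n.+1))).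
    rewrite -(ED m1 m2); congr (E _); apply/funext => w.
    by rewrite /ht dotvBr subrKC.
  have n3 := nice_msd n.+1.
  apply: lerD.
    rewrite -mulNr /msd -(EZ _ n3); apply: (E_le m1 (niceZ M0 _ n3)) => w wM.
    exact: V_decrease.
  have nT0' := niceV_mono (leqnSn _) nT0.
  have nh0 := nice_ht nT0' (ltnSn n.+1).
  have m3 := nice_dotv M0 (nice_gV nT0') nh0.
  have n4 := nice_mono (leqnSn _) (nice_msd n).
  have nc2 := nice_cst d M n.+2 1.
  (* Subtract the same pairing at [theta n]: its mean is 0 because [theta n] does not involve sample
     [n.+1]. *)
  rewrite -[leLHS]subr0 -(E_ht nT0 (nice_gV nT0)) -(EB m2 m3).
  rewrite /msd (E1D n4) -(EZ _ (niceD nc2 n4)).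
  apply: (E_le (niceB M0 m2 m3) (niceZ M0 _ (niceD nc2 n4))) => w wM.
  apply: drift_lip => //; first by rewrite a0 al1.
  exact: theta_increment.
apply: (le_trans A1).
have := ler_wpM2l b0 A2.
have h1 : 0 <= K2 * al n.+1 * al n * (1 + msd n).
  by rewrite !mulr_ge0// addr_ge0// msd_ge0.
have h2 : 0 <= K1 * al n.+1 ^+ 2 * (1 + msd n.+1).
  by rewrite !mulr_ge0// addr_ge0// msd_ge0.
move: h1 h2.
move: (E _) (E _) (msd _) (msd _) (al n.+1 ^+ 2) (al n.+1) (al n) (K1) (K2) (cV).
move=> p q s s2 b a1 a2 k1 k2 c; lra.
Qed.

Hypothesis al_dec : forall n, al n.+1 <= al n.
Hypothesis al_0 : al @ \oo --> (0 : R).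
Hypothesis dal_0 : (fun n => (al n.+1)^-1 - (al n)^-1) @ \oo --> (0 : R).

(** [V] lies between two multiples of the squared distance, so the inequality of [moment_step]
    closes into a recursion for [V] alone. *)
Lemma msd_le : exists2 B : R, 0 <= B & forall n, msd n <= B * al n.
Proof.
have [K K0 step] := moment_step.
pose u n := E (fun w => V (theta n w)).
have uge n : cV * msd n <= u n.
  rewrite /msd -(EZ _ (nice_msd n)); apply: (E_le (niceZ M0 _ (nice_msd n)) (nice_V (nice_theta n))).
  by move=> w _; exact: V_lower.
have ule n : u n <= (CV + cV) * msd n.
  rewrite /msd -(EZ _ (nice_msd n)); apply: (E_le (nice_V (nice_theta n)) (niceZ M0 _ (nice_msd n))).
  move=> w _; apply: (le_trans (V_upper _)); rewrite [leRHS]mulrDl lerDl.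
  by apply: mulr_ge0; [exact: ltW|exact: sqr_ge0].
have msdu k : msd k <= u k / cV by rewrite ler_pdivlMr// mulrC.
have D0 : 0 < CV + cV by rewrite ltr_wpDl.
have [] := @recursion_bound R u al (cV / (CV + cV)) (K * (1 + cV^-1)).
- exact: divr_gt0.
- by rewrite mulr_ge0// addr_ge0// invr_ge0 ltW.
- by move=> k; rewrite (le_trans _ (uge k))// mulr_ge0 ?msd_ge0// ltW.
- exact: al0.
- exact: al_dec.
- exact: al_0.
- exact: dal_0.
- move=> m; have un0 k : 0 <= u k by rewrite (le_trans _ (uge k))// mulr_ge0 ?msd_ge0// ltW.
  apply: (le_trans (step m)).
  have e1 : cV / (CV + cV) * u m.+1 <= cV * msd m.+1.
    by rewrite -mulrA ler_pM2l// mulrC ler_pdivrMr// mulrC; exact: ule.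
  have e2 k : K * (1 + msd k) <= K * (1 + cV^-1) * (1 + u k).
    rewrite -mulrA ler_wpM2l// mulrDl mul1r mulrDr mulr1.
    have := msdu k; have : 0 <= cV^-1 by rewrite invr_ge0 ltW.
    have := un0 k; rewrite [u k / cV]mulrC; move: (msd k) (u k) (cV^-1).
    by move=> p q r; move: (_ * _) => l; lra.
  have f1 := ler_wpM2l (ltW (al0 m.+1)) e1.
  have f2 := ler_wpM2l (mulr_ge0 (ltW (al0 m.+1)) (ltW (al0 m))) (e2 m).
  have f3 := ler_wpM2l (sqr_ge0 (al m.+1)) (e2 m.+1).
  move: f1 f2 f3; rewrite -/(u m.+1).
  move: (u m) => q. move: (u m.+1) => r. move: (msd m) => s. move: (msd m.+1) => s2.
  move: (al m.+1 ^+ 2) => b. move: (al m.+1) (al m) => a1 a2. move: (cV / _) => cc. move: (cV^-1) => ci.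
  lra.
move=> B B0 Bu; exists (B / cV); first by rewrite divr_ge0// ltW.
by move=> k; rewrite (le_trans (msdu k))// mulrAC ler_pM2r ?invr_gt0.
Qed.

(* [F x u v = fbar x + incr x u v + (ht x u - ht x v)]: the Poisson equation is solved in one
   step, and [incr x] is a martingale increment. *)
Definition incr x (u v : 'rV[R]_d) := F x u v - hF x u + ht x v.

Lemma nice_incr n X i j : niceV n X -> (i < n)%N -> (j < n)%N ->
  niceV n (fun w => incr (X w) (w i) (w j)).
Proof.
move=> nX ni nj; apply: niceVD; last exact: nice_ht.
by apply: niceVB => //; [exact: niceF|exact: nice_hF].
Qed.

Lemma incr_mean x u : enorm u <= M -> EV (fun v => incr x u (v 0%N)) = 0.
Proof.
move=> uM; have n1 := niceF1 x uM; have n2 := nice_hF1 x.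
have nc (c : 'rV[R]_d) : niceV 1 (fun _ : path => c) by exact: niceV_cst.
have nB : niceV 1 (fun v => fbar x - hF x (v 0%N)) by exact: niceVB.
transitivity (EV (fun v => (F x u (v 0%N) - hF x u) - (fbar x - hF x (v 0%N)))).
  by congr EV; apply/funext => v; rewrite /incr /ht opprB.
have EVc c : EV (fun=> c) = c by apply/rowP => i; rewrite mxE E_cst.
rewrite (EVB (niceVB M0 n1 (nc _)) nB) (EVB n1 (nc _)) (EVB (nc _) n2).
by rewrite !EVc -/(hF x u) -/(fbar x) !subrr.
Qed.

Lemma incr_lip x y (u v : 'rV[R]_d) : enorm u <= M -> enorm v <= M ->
  enorm (incr x u v - incr y u v) <= 4 * CF * enorm (x - y).
Proof.
move=> uM vM; have -> : incr x u v - incr y u v =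
    (F x u v - F y u v) - (hF x u - hF y u) + (ht x v - ht y v).
  rewrite /incr; move: (F x u v) (F y u v) (hF x u) (hF y u) (ht x v) (ht y v).
  by move=> a b c e f h; apply/rowP => i; rewrite !mxE; ring.
rewrite (le_trans (enormD _ _))//; have := enormD (F x u v - F y u v) (- (hF x u - hF y u)).
rewrite enormN; have := F_lip x y uM vM; have := hF_lip x y uM; have := ht_lip x y vM.
move: (enorm _) (enorm _) (enorm _) (enorm _) (enorm _) => p q r s l; lra.
Qed.

(** Averaging over the newer sample and then over the older one leaves a number in which [n] no
    longer occurs. *)
Lemma E_stationary (psi : 'rV[R]_d -> 'rV[R]_d -> R) n :
  (forall n, nice n.+2 (fun w => psi (w n) (w n.+1))) ->
  E (fun w => psi (w n) (w n.+1)) = E (fun w => psi (w 0%N) (w 1%N)).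
Proof.
move=> npsi; pose kappa u := E (fun v => psi u (v 0%N)).
suff H k : E (fun w => psi (w k) (w k.+1)) = E (fun v => kappa (v 0%N)) by rewrite !H.
have nk : nice k.+1 (fun w => kappa (w k)).
  apply: nice_congr (nice_integrate M0 WM iidW (npsi k)) => w wM.
  by apply: E_eq => v vM; rewrite updE upd_lt.
rewrite (tower (npsi k)).
transitivity (E (fun w => kappa (w k))).
  by apply: E_eq => w wM; apply: E_eq => v vM; rewrite updE upd_lt.
rewrite (tower nk) -[RHS]E_cst; apply: E_eq => w wM.
by apply: E_eq => v vM; rewrite updE.
Qed.

Lemma E_sqrD n X Y : niceV n X -> niceV n Y ->
  E (fun w => enorm (X w + Y w) ^+ 2) <=
  2 * E (fun w => enorm (X w) ^+ 2) + 2 * E (fun w => enorm (Y w) ^+ 2).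
Proof.
move=> nX nY; have n1 := nice_enorm_sqr M0 nX; have n2 := nice_enorm_sqr M0 nY.
rewrite -(EZ _ n1) -(EZ _ n2) -(ED (niceZ M0 _ n1) (niceZ M0 _ n2)).
apply: (E_le (nice_enorm_sqr M0 (niceVD nX nY)) (niceD (niceZ M0 _ n1) (niceZ M0 _ n2))).
move=> w _; have := sqr_ge0 (enorm (X w - Y w)); rewrite !enormD_sqr enormN dotvNr.
move: (enorm (X w) ^+ 2) (enorm (Y w) ^+ 2) (dotv _ _) => p q r; lra.
Qed.

Lemma E_sqrB n X Y : niceV n X -> niceV n Y ->
  E (fun w => enorm (X w - Y w) ^+ 2) <=
  2 * E (fun w => enorm (X w) ^+ 2) + 2 * E (fun w => enorm (Y w) ^+ 2).
Proof.
move=> nX nY; apply: (le_trans (E_sqrD nX (niceVN M0 nY))).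
by under [X in _ + 2 * E X]eq_fun do rewrite enormN.
Qed.

Lemma E_variance n X : niceV n X ->
  E (fun w => enorm (X w - EV X) ^+ 2) = E (fun w => enorm (X w) ^+ 2) - enorm (EV X) ^+ 2.
Proof.
move=> nX; have n1 := nice_enorm_sqr M0 nX; have nc := niceV_cst M n (- EV X).
have n2 := nice_dotv M0 nc nX.
transitivity (E (fun w => (enorm (X w) ^+ 2 + 2 * dotv (- EV X) (X w)) + enorm (EV X) ^+ 2)).
  by congr (E _); apply/funext => w; rewrite enormD_sqr enormN dotvC.
rewrite (ED (niceD n1 (niceZ M0 2 n2)) (nice_cst d M n _)) (ED n1 (niceZ M0 2 n2)).
rewrite (EZ _ n2) -(dotv_EV _ nX) E_cst dotvNl -enorm_sqr.
by move: (E _) (enorm _ ^+ 2) => p q; ring.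
Qed.

(** * Decomposition of the summed mean field and its remainders *)

Let b n := (al n)^-1.

(** The field is [b n] times the increment of [theta]. In the Poisson equation the differences of
    [ht] would telescope if the state were frozen; the sum of differences of [ht] at a common sample
    is the price of its motion. *)
Lemma target_decomposition N w :
  \sum_(n < N) fbar (theta n w) =
  \sum_(n < N) b n *: ((theta n.+1 w - t) - (theta n w - t))
  + (ht (theta N w) (w N) - ht x0 (w 0%N))
  - \sum_(n < N) (ht (theta n.+1 w) (w n.+1) - ht (theta n w) (w n.+1))
  - \sum_(n < N) incr (theta n w) (w n) (w n.+1).
Proof.
elim: N => [|N IH]; first by rewrite !big_ord0 subrr addr0 !subr0.
rewrite !big_ord_recr /= IH.
have -> : b N *: (theta N w + al N *: F (theta N w) (w N) (w N.+1) - t - (theta N w - t)) =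
   F (theta N w) (w N) (w N.+1).
  rewrite opprB addrA subrK addrAC subrr add0r scalerA /b mulVf ?scale1r//.
  by rewrite gt_eqF.
rewrite /incr /ht.
move: (\sum_(_ < _) _) (\sum_(_ < _) _) (\sum_(_ < _) _) => p q r.
move: (F _ _ _) (hF _ _) (hF _ _) (hF _ _) (hF _ _) (fbar _) (fbar _) (fbar _).
by move=> a1 a2 a3 a4 a5 a6 a7 a8; apply/rowP => i; rewrite !mxE; ring.
Qed.

Lemma le_sqr_bound (x y : R) : 0 <= y -> x <= 1 + y + x ^+ 2.
Proof. by have := sqr_ge0 x; have := sqr_ge0 (1 - x); rewrite !expr2; lra. Qed.

Definition target_sum N w := \sum_(n < N) fbar (theta n w).

Definition noise_sum N w := \sum_(n < N) incr t (w n) (w n.+1).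

Lemma nice_target_sum N : niceV N.+2 (target_sum N).
Proof.
move=> i; under eq_fun do rewrite /target_sum summxE; apply: nice_sum => k.
have := nice_fbar (nice_theta k) => /(_ i); apply: nice_mono.
by rewrite ltnS (leq_trans (ltnW (ltn_ord k)))// leqnSn.
Qed.

Lemma nice_noise_sum N : niceV N.+2 (noise_sum N).
Proof.
move=> i; under eq_fun do rewrite /noise_sum summxE; apply: nice_sum => k.
have := nice_incr (niceV_cst M k.+2 t) (ltnW (ltnSn k.+1)) (ltnSn k.+1) => /(_ i).
by apply: nice_mono; rewrite !ltnS ltnW.
Qed.

Let b0 n : 0 < b n. Proof. by rewrite invr_gt0. Qed.

Let b_inc n : b n <= b n.+1.
Proof. by rewrite /b lef_pV2 ?posrE. Qed.

(** Six pieces, all controlled by second moments O(al n). The boundary term [A1] and the summation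
    by parts [A3] give [b N]; [A2] and [A4] stay bounded; in [A5] each difference of [ht] is O(al
    n), which gives the square of the sum of [al]; [A6] has orthogonal increments and gives the sum
    of [al], absorbed by [le_sqr_bound]. *)
Lemma remainder_bound : exists2 K : R, 0 <= K & forall N,
  E (fun w => enorm (target_sum N w + noise_sum N w) ^+ 2) <=
  K * (1 + b N + (\sum_(n < N) al n) ^+ 2).
Proof.
have [B B0 msdB] := msd_le.
have msdB1 n : msd n <= B by rewrite (le_trans (msdB n))// ler_piMr.
(* Weights for Cauchy-Schwarz in [A3]: the factor [sqrt (b n.+1)] gives the error of the iterate a
   bounded second moment, and the remaining weights sum to at most [2 * sqrt (b N)]. *)
pose c n := (b n.+1 - b n) / Num.sqrt (b n.+1).
have c0 n : 0 <= c n by rewrite divr_ge0 ?sqrtr_ge0// subr_ge0.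
have niceT N : niceV N.+2 (theta N) := niceV_mono (leqnSn _) (nice_theta N).
have nX k N : (k <= N.+1)%N -> niceV N.+2 (fun w => theta k w - t).
  move=> kN; apply: niceVB => //; last exact: niceV_cst.
  by apply: niceV_mono (nice_theta k); rewrite ltnS.
have nX2 k N : (k <= N.+1)%N -> nice N.+2 (fun w => enorm (theta k w - t) ^+ 2).
  by move=> kN; apply: nice_enorm_sqr => //; exact: nX.
pose A1 N w := b N *: (theta N w - t).
pose A2 w : 'rV[R]_d := b 0%N *: (x0 - t) + ht x0 (w 0%N).
pose A3 N w := \sum_(n < N) c n *: (Num.sqrt (b n.+1) *: (theta n.+1 w - t)).
pose A4 N w := ht (theta N w) (w N).
pose A5 N w := \sum_(n < N) al n *: ((al n)^-1 *: (ht (theta n.+1 w) (w n.+1) - ht (theta n w) (w n.+1))).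
pose A6 N w := \sum_(n < N) (incr (theta n w) (w n) (w n.+1) - incr t (w n) (w n.+1)).
have dec N w : target_sum N w + noise_sum N w =
   A1 N w - A2 w - A3 N w + A4 N w - A5 N w - A6 N w.
  rewrite /target_sum target_decomposition (summation_by_parts N b (fun n => theta n w - t)).
  have -> : A6 N w = \sum_(n < N) incr (theta n w) (w n) (w n.+1) - noise_sum N w.
    by rewrite /A6 sumrB.
  have -> : A5 N w = \sum_(n < N) (ht (theta n.+1 w) (w n.+1) - ht (theta n w) (w n.+1)).
    by apply: eq_bigr => n _; rewrite scalerA mulfV ?scale1r// gt_eqF.
  have -> : A3 N w = \sum_(n < N) (b n.+1 - b n) *: (theta n.+1 w - t).
    apply: eq_bigr => n _; rewrite scalerA /c divfK// gt_eqF// sqrtr_gt0//.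
  rewrite /A1 /A2 /A4 [theta 0 w]/=.
  move: (\sum_(_ < _) _) (\sum_(_ < _) _) (\sum_(_ < _) _) => p q r.
  move: (_ *: _) (_ *: _) (ht _ _) (ht _ _) (noise_sum _ _) => a1 a2 a3 a4 a5.
  by apply/rowP => i; rewrite !mxE; ring.
have n1 N : niceV N.+2 (A1 N) by apply: niceVZ => //; [exact: nice_cst|exact: nX].
have n2 N : niceV N.+2 A2.
  by apply: niceVD; [exact: niceV_cst|apply: nice_ht => //; exact: niceV_cst].
have n3 N : niceV N.+2 (A3 N).
  move=> i; under eq_fun do rewrite summxE; apply: nice_sum => k.
  apply: (niceVZ M0 (nice_cst d M _ _) (niceVZ M0 (nice_cst d M _ _) _)).
  by apply: nX; rewrite ltnW// ltnS.
have n4 N : niceV N.+2 (A4 N) by apply: nice_ht => //; exact: ltnW.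
have nr k N : (k < N)%N ->
    niceV N.+2 (fun w => ht (theta k.+1 w) (w k.+1) - ht (theta k w) (w k.+1)).
  move=> kN; have k2 : (k.+2 <= N.+2)%N by rewrite !ltnS ltnW.
  apply: niceVB => //; apply: nice_ht => //.
    exact: niceV_mono k2 (nice_theta k.+1).
  exact: niceV_mono (ltnW k2) (nice_theta k).
have n5 N : niceV N.+2 (A5 N).
  move=> i; under eq_fun do rewrite summxE; apply: nice_sum => k.
  by apply: (niceVZ M0 (nice_cst d M _ _) (niceVZ M0 (nice_cst d M _ _) _)); exact: nr.
have ni k : niceV k.+2 (fun w => incr (theta k w) (w k) (w k.+1) - incr t (w k) (w k.+1)).
  exact: (niceVB M0 (nice_incr (niceT k) (ltnW (ltnSn k.+1)) (ltnSn k.+1))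
    (nice_incr (niceV_cst M k.+2 t) (ltnW (ltnSn k.+1)) (ltnSn k.+1))).
have n6 N : niceV N.+2 (A6 N).
  move=> i; under eq_fun do rewrite summxE; apply: nice_sum => k.
  by apply: nice_mono (ni k i); rewrite !ltnS ltnW.
pose sq X := E (fun w => enorm (X w) ^+ 2).
have e1 N : sq (A1 N) <= B * b N.
  rewrite /sq (_ : (fun w => _) = fun w => b N ^+ 2 * enorm (theta N w - t) ^+ 2); last first.
    by apply/funext => w; rewrite enormZ exprMn real_normK ?num_real.
  rewrite (EZ _ (nice_msd N)) -/(msd N).
  rewrite (le_trans (ler_wpM2l (sqr_ge0 _) (msdB N)))//.
  by rewrite expr2 mulrCA -!mulrA mulVf ?mulr1// gt_eqF.
pose K2 := (b 0%N * enorm (x0 - t) + 2 * CF * (1 + enorm (x0 - t))) ^+ 2.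
have e2 (N : nat) : sq A2 <= K2.
  rewrite -[leRHS]E_cst; apply: (E_le (nice_enorm_sqr M0 (n2 N)) (nice_cst d M _ _)) => w wM.
  have k0 : 0 <= b 0%N * enorm (x0 - t) + 2 * CF * (1 + enorm (x0 - t)).
    by rewrite addr_ge0 ?mulr_ge0 ?addr_ge0// ltW.
  rewrite lerXn2r ?nnegrE// (le_trans (enormD _ _))// lerD//.
    by rewrite enormZ gtr0_norm.
  exact: ht_bound.
have e3 N : sq (A3 N) <= B * (2 * Num.sqrt (b N)) ^+ 2.
  have nn (n : 'I_N) : nice N.+2 (fun w => enorm (theta n.+1 w - t) ^+ 2).
    by apply: nX2; rewrite ltnS ltnW.
  apply: (@le_trans _ _ (E (fun w => (\sum_(n < N) c n) *
       \sum_(n < N) c n * (b n.+1 * enorm (theta n.+1 w - t) ^+ 2)))).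
    apply: (E_le (nice_enorm_sqr M0 (n3 N))) => [|w wM].
      by apply: niceZ => //; apply: nice_sum => n; do 2 apply: niceZ => //.
    apply: le_trans (enorm_sum_weighted N (fun n => Num.sqrt (b n.+1) *: (theta n.+1 w - t)) c0) _.
    rewrite ler_wpM2l ?sumr_ge0// ler_sum// => n _; rewrite ler_wpM2l//.
    by rewrite enormZ exprMn real_normK ?num_real// sqr_sqrtr// ltW.
  rewrite (@EZ N.+2); last by apply: nice_sum => n; do 2 apply: niceZ => //.
  rewrite (@E_sum N.+2) => [|n]; last by do 2 apply: niceZ => //.
  have cs := @sum_sqrt_increments R b N b0 b_inc.
  have S0 : 0 <= \sum_(n < N) c n by apply: sumr_ge0.
  apply: (@le_trans _ _ ((\sum_(n < N) c n) * \sum_(n < N) c n * B)).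
    rewrite ler_wpM2l// ler_sum// => n _.
    rewrite (EZ _ (niceZ M0 _ (nn n))) (EZ _ (nn n)) ler_wpM2l//.
    rewrite (le_trans (ler_wpM2l (ltW (b0 n.+1)) (msdB n.+1)))//.
    by rewrite mulrCA mulVf ?mulr1// gt_eqF.
  by rewrite -mulr_suml mulrA mulrC ler_wpM2l// -expr2 lerXn2r ?nnegrE ?mulr_ge0 ?sqrtr_ge0.
pose K4 := (2 * CF) ^+ 2 * (2 * (1 + B)).
have e4 N : sq (A4 N) <= K4.
  have nm := nX2 N N (leqnSn N).
  apply: (@le_trans _ _ ((2 * CF) ^+ 2 * (2 * (1 + msd N)))); last first.
    by rewrite ler_wpM2l// ler_pM2l// lerD2l.
  rewrite /msd (E1D nm) -!(EZ _ (niceD (nice_cst d M _ 1) nm)) -(@EZ N.+2); last first.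
    by apply: niceZ => //; apply: niceD => //; exact: nice_cst.
  apply: (E_le (nice_enorm_sqr M0 (n4 N))) => [|w wM].
    by do 2 apply: niceZ => //; apply: niceD => //; exact: nice_cst.
  apply: le_trans (ler_wpM2l (sqr_ge0 _) (sqr1D_le _)); rewrite -exprMn.
  rewrite lerXn2r ?nnegrE ?mulr_ge0 ?addr_ge0//.
  exact: ht_bound.
pose K5 := (2 * CF * CF) ^+ 2 * (2 * (1 + B)).
have e5 N : sq (A5 N) <= K5 * (\sum_(n < N) al n) ^+ 2.
  have nn (n : 'I_N) : nice N.+2 (fun w => 1 + enorm (theta n w - t) ^+ 2).
    by apply: niceD; [exact: nice_cst|apply: nX2; rewrite ltnW// ltnS ltnW].
  pose D : R := (2 * CF * CF) ^+ 2 * 2.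
  have D0 : 0 <= D by rewrite mulr_ge0.
  have S0 : 0 <= \sum_(n < N) al n by apply: sumr_ge0 => n _; exact: ltW.
  apply: (@le_trans _ _ (E (fun w => (\sum_(n < N) al n) *
       \sum_(n < N) al n * (D * (1 + enorm (theta n w - t) ^+ 2))))).
    apply: (E_le (nice_enorm_sqr M0 (n5 N))) => [|w wM].
      by apply: niceZ => //; apply: nice_sum => n; do 2 apply: niceZ => //.
    apply: le_trans (enorm_sum_weighted N (fun n => (al n)^-1 *:
      (ht (theta n.+1 w) (w n.+1) - ht (theta n w) (w n.+1))) (fun n => ltW (al0 n))) _.
    rewrite ler_wpM2l// ler_sum// => n _; rewrite ler_wpM2l ?(ltW (al0 n))//.
    rewrite /D -mulrA; apply: le_trans (ler_wpM2l (sqr_ge0 _) (sqr1D_le _)).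
    rewrite -exprMn lerXn2r ?nnegrE ?mulr_ge0 ?addr_ge0//.
    rewrite enormZ gtr0_norm ?invr_gt0// mulrC ler_pdivrMr//.
    apply: le_trans (ht_lip _ _ (wM n.+1)) _.
    apply: le_trans (ler_wpM2l _ (theta_increment n wM)) _; first by rewrite mulr_ge0.
    by apply: eq_ler; ring.
  rewrite (@EZ N.+2); last by apply: nice_sum => n; do 2 apply: niceZ => //.
  rewrite (@E_sum N.+2) => [|n]; last by do 2 apply: niceZ => //.
  rewrite expr2 mulrCA ler_wpM2l// mulr_sumr ler_sum// => n _.
  rewrite (EZ _ (niceZ M0 _ (nn n))) (EZ _ (nn n)) mulrC ler_wpM2r ?(ltW (al0 n))//.
  rewrite /K5 mulrA -/D ler_wpM2l//.
  have nm : nice N.+2 (fun w => enorm (theta n w - t) ^+ 2).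
    by apply: nX2; rewrite ltnW// ltnS ltnW.
  by rewrite -(E1D nm) lerD2l msdB1.
pose K6 := (4 * CF) ^+ 2 * B.
have e6 N : sq (A6 N) <= K6 * \sum_(n < N) al n.
  rewrite /sq (@E_orthogonal (fun n w => incr (theta n w) (w n) (w n.+1) - incr t (w n) (w n.+1)))//.
    rewrite mulr_sumr ler_sum// => n _; rewrite /K6 -mulrA.
    apply: le_trans (ler_wpM2l (sqr_ge0 _) (msdB n)).
    have nm := nice_mono (leqnSn _) (nice_msd n).
    rewrite /msd -(EZ _ nm); apply: (E_le (nice_enorm_sqr M0 (ni n)) (niceZ M0 _ nm)) => w wM.
    rewrite -exprMn lerXn2r ?nnegrE ?mulr_ge0//.
    exact: incr_lip.
  move=> n w wM; rewrite -[RHS](subrr (0 : 'rV[R]_d)) -{1}(incr_mean (theta n w) (wM n)) -(incr_mean t (wM n)).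
  have nin x : niceV 1 (fun v => incr x (w n) (v 0%N)).
    move=> i; have := nice_integrand (nice_incr (niceV_cst M n.+2 x) (ltnW (ltnSn n.+1)) (ltnSn n.+1) i) wM.
    by apply: nice_congr => v vM; rewrite updE upd_lt.
  rewrite -(EVB (nin _) (nin _)); apply/rowP => i; rewrite !mxE; apply: E_eq => v vM.
  rewrite (niceV_upd_id (nice_theta n) (leqnn _) wM (vM 0%N)) updE upd_lt//.
have p2 : 0 <= K2 by exact: sqr_ge0.
have p4 : 0 <= K4 by rewrite mulr_ge0// mulr_ge0// addr_ge0.
have p5 : 0 <= K5 by rewrite mulr_ge0// mulr_ge0// addr_ge0.
have p6 : 0 <= K6 by rewrite mulr_ge0.
exists (32 * (B + K2 + 4 * B + K4 + K5 + K6)).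
  by rewrite mulr_ge0// !addr_ge0// mulr_ge0.
move=> N; have -> : (fun w => enorm (target_sum N w + noise_sum N w) ^+ 2) =
   (fun w => enorm (A1 N w - A2 w - A3 N w + A4 N w - A5 N w - A6 N w) ^+ 2).
  by apply/funext => w; rewrite dec.
have m1 := niceVB M0 (n1 N) (n2 N); have m2 := niceVB M0 m1 (n3 N).
have m3 := niceVD m2 (n4 N); have m4 := niceVB M0 m3 (n5 N).
have S0 : 0 <= \sum_(n < N) al n by apply: sumr_ge0 => n _; exact: ltW.
have [Z ZE] : exists Z : R, Z = 1 + b N + (\sum_(n < N) al n) ^+ 2 by eexists.
rewrite -ZE.
have SZ : \sum_(n < N) al n <= Z.
  by rewrite ZE; apply: le_sqr_bound; exact: ltW.
have S2Z : (\sum_(n < N) al n) ^+ 2 <= Z by rewrite ZE lerDr addr_ge0// ltW.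
have bZ : b N <= Z by rewrite ZE -addrA addrCA lerDl addr_ge0.
have oZ : 1 <= Z by rewrite ZE -addrA lerDl addr_ge0// ltW.
have z0 : 0 <= Z by rewrite (le_trans _ oZ).
apply: (iterated_sqr_bound z0 B0 p2 (mulr_ge0 _ B0) p4 p5 p6 (E_sqrB (n1 N) (n2 N))
  (E_sqrB m1 (n3 N)) (E_sqrD m2 (n4 N)) (E_sqrB m3 (n5 N)) (E_sqrB m4 (n6 N))) => //.
- exact: le_trans (e1 N) (ler_wpM2l B0 bZ).
- exact: le_trans (e2 N) (ler_peMr p2 oZ).
- apply: (le_trans (e3 N)); rewrite exprMn sqr_sqrtr ?(ltW (b0 N))//.
  rewrite (_ : 4 * B * Z = B * (2 ^+ 2 * Z)); last by ring.
  by apply: ler_wpM2l => //; apply: ler_wpM2l => //; exact: sqr_ge0.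
- exact: le_trans (e4 N) (ler_peMr p4 oZ).
- exact: le_trans (e5 N) (ler_wpM2l p5 S2Z).
- exact: le_trans (e6 N) (ler_wpM2l p6 SZ).
Qed.

(** * The limiting variance *)

Definition noise_variance := E (fun w => enorm (incr t (w 0%N) (w 1%N)) ^+ 2).

Let nice_incr_t k : niceV k.+2 (fun w => incr t (w k) (w k.+1)).
Proof. exact: (nice_incr (niceV_cst M k.+2 t) (ltnW (ltnSn k.+1)) (ltnSn k.+1)). Qed.

Let incr_t_mean n w : inball w -> EV (fun v => incr t (upd w n.+1 (v 0%N) n) (upd w n.+1 (v 0%N) n.+1)) = 0.
Proof.
move=> wM; rewrite -[RHS](incr_mean t (wM n)).
by congr EV; apply/funext => v; rewrite updE upd_lt.
Qed.

Lemma noise_energy N : E (fun w => enorm (noise_sum N w) ^+ 2) = N%:R * noise_variance.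
Proof.
rewrite (@E_orthogonal (fun n w => incr t (w n) (w n.+1)))//.
transitivity (\sum_(n < N) noise_variance); last by rewrite sumr_const card_ord mulr_natl.
apply: eq_bigr => n _; rewrite /noise_variance.
have h k : nice k.+2 (fun w => enorm (incr t (w k) (w k.+1)) ^+ 2).
  exact: (nice_enorm_sqr M0 (nice_incr_t k)).
exact: (@E_stationary (fun x y => enorm (incr t x y) ^+ 2) n h).
Qed.

Lemma EV_noise N : EV (noise_sum N) = 0.
Proof.
apply/rowP => i; rewrite !mxE.
rewrite (_ : (fun w => _) = fun w => \sum_(n < N) (incr t (w n) (w n.+1)) 0 i); last first.
  by apply/funext => w; rewrite summxE.
rewrite (@E_sum N.+2) => [|n]; last first.
  by apply: nice_mono (nice_incr_t n i); rewrite !ltnS ltnW.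
rewrite big1// => n _; rewrite (tower (nice_incr_t n i)); apply: E_eq0 => w wM.
by have /rowP /(_ i) := incr_t_mean n wM; rewrite !mxE.
Qed.

Hypothesis step_inv : (fun N : nat => N%:R^-1 * (al N)^-1) @ \oo --> (0 : R).
Hypothesis step_sum : (fun N : nat => N%:R^-1 * (\sum_(n < N) al n) ^+ 2) @ \oo --> (0 : R).

(** The cross term between martingale and remainder is split by Young's inequality: the martingale
    receives the factor [e], the remainder [e^-1]. The noise sum is centred, so the mean of the
    target sum is that of the remainder and is bounded by its second moment. *)
Lemma variance_gap (e : R) N : 0 < e ->
  `|E (fun w => enorm (target_sum N w - EV (target_sum N)) ^+ 2) - N%:R * noise_variance| <=
  e * (N%:R * noise_variance) +
  (2 + e^-1) * E (fun w => enorm (target_sum N w + noise_sum N w) ^+ 2).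
Proof.
move=> e0; pose Q w := target_sum N w + noise_sum N w.
have nS := nice_target_sum N; have nN := nice_noise_sum N.
have nQ : niceV N.+2 Q by exact: niceVD.
have n1 := nice_enorm_sqr M0 nN; have n2 := nice_enorm_sqr M0 nQ.
have n3 := nice_enorm_sqr M0 nS.
have EVS : EV (target_sum N) = EV Q.
  rewrite -[RHS]subr0 -(EV_noise N) -(EVB nQ nN); congr EV; apply/funext => w.
  by rewrite /Q addrK.
rewrite (E_variance nS) EVS -noise_energy.
have EQ0 : enorm (EV Q) ^+ 2 <= E (fun w => enorm (Q w) ^+ 2).
  rewrite -subr_ge0 -(E_variance nQ); apply: (@E_ge0 N.+2) => [|w _]; last exact: sqr_ge0.
  by apply: nice_enorm_sqr => //; apply: niceVB => //; exact: niceV_cst.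
have cross w : `|enorm (target_sum N w) ^+ 2 - enorm (noise_sum N w) ^+ 2| <=
    e * enorm (noise_sum N w) ^+ 2 + (1 + e^-1) * enorm (Q w) ^+ 2.
  have -> : target_sum N w = Q w - noise_sum N w by rewrite /Q addrK.
  rewrite enormD_sqr enormN dotvNr addrK.
  have := normr_dotv (Q w) (noise_sum N w).
  have := mulr_ge0 (ltW (_ : 0 < e^-1)) (sqr_ge0 (e * enorm (noise_sum N w) - enorm (Q w))).
  rewrite invr_gt0 => /(_ e0); rewrite sqrrB.
  rewrite (_ : e^-1 * _ = e * enorm (noise_sum N w) ^+ 2 - 2 * (enorm (Q w) * enorm (noise_sum N w))
     + e^-1 * enorm (Q w) ^+ 2); last by field; rewrite gt_eqF.
  rewrite !ler_norml; move: (enorm _ * enorm _) (e * _) (e^-1) (enorm (Q w) ^+ 2) (sqr_ge0 (enorm (Q w))) (dotv _ _).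
  by move=> p q r s s0 l h /andP[h1 h2]; apply/andP; split; lra.
have nR := niceD (niceZ M0 e n1) (niceZ M0 (1 + e^-1) n2).
have cr1 : E (fun w => enorm (target_sum N w) ^+ 2) - E (fun w => enorm (noise_sum N w) ^+ 2) <=
   e * E (fun w => enorm (noise_sum N w) ^+ 2) + (1 + e^-1) * E (fun w => enorm (Q w) ^+ 2).
  rewrite -(EZ _ n1) -(EZ _ n2) -(ED (niceZ M0 e n1) (niceZ M0 (1 + e^-1) n2)) -(EB n3 n1).
  apply: (E_le (niceB M0 n3 n1) nR) => w _.
  by have := cross w; rewrite ler_norml => /andP[].
have cr2 : E (fun w => enorm (noise_sum N w) ^+ 2) - E (fun w => enorm (target_sum N w) ^+ 2) <=
   e * E (fun w => enorm (noise_sum N w) ^+ 2) + (1 + e^-1) * E (fun w => enorm (Q w) ^+ 2).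
  rewrite -(EZ _ n1) -(EZ _ n2) -(ED (niceZ M0 e n1) (niceZ M0 (1 + e^-1) n2)) -(EB n1 n3).
  apply: (E_le (niceB M0 n1 n3) nR) => w _.
  by have := cross w; rewrite ler_norml lerNl opprB => /andP[].
move: EQ0 cr1 cr2 (sqr_ge0 (enorm (EV Q))); rewrite ler_norml.
move: (E (fun w => enorm (target_sum N w) ^+ 2)) (E (fun w => enorm (noise_sum N w) ^+ 2)) => a c.
rewrite -/Q; move: (E _) (enorm (EV Q) ^+ 2) (e^-1) => q s r h1 h2 h3 h4.
by apply/andP; split; lra.
Qed.

Theorem target_bias_variance_cvg :
  (fun N : nat => N%:R^-1 * E (fun w => enorm (target_sum N w - EV (target_sum N)) ^+ 2))
    @ \oo --> noise_variance.
Proof.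
have [K K0 rem] := remainder_bound.
have s0 : 0 <= noise_variance.
  apply: (@E_ge0 2) => [|w _]; last exact: sqr_ge0.
  exact: nice_enorm_sqr.
pose eps (N : nat) : R := K * (N%:R^-1 + N%:R^-1 * (al N)^-1 + N%:R^-1 * (\sum_(n < N) al n) ^+ 2).
have eps0 : eps @ \oo --> (0 : R).
  have c1 : (fun N : nat => (N%:R : R)^-1) @ \oo --> (0 : R).
    by rewrite -cvg_shiftS; exact: cvg_harmonic.
  have := cvgM (cvg_cst K) (cvgD (cvgD c1 step_inv) step_sum).
  by rewrite !addr0 mulr0; exact.
apply/cvgrPdist_le => e e0.
(* [dl] is fixed first and bounds the martingale share by half of the tolerance; [N] is then taken
   large for the remainder, whose factor contains [dl^-1]. *)
pose dl := e / (2 * (noise_variance + 1)).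
have dl0 : 0 < dl by rewrite divr_gt0// mulr_gt0// ltr_wpDl.
have r0 : 0 < e / (2 * (2 + dl^-1)) by rewrite divr_gt0// mulr_gt0// addr_gt0// invr_gt0.
near=> N.
have N0 : (0 < N)%N by near: N; exact: nbhs_infty_gt.
have NR : 0 < (N%:R : R) by rewrite ltr0n.
have epsN : eps N <= e / (2 * (2 + dl^-1)) by near: N; exact: (cvgr_le _ eps0).
rewrite distrC.
have -> : N%:R^-1 * E (fun w => enorm (target_sum N w - EV (target_sum N)) ^+ 2) - noise_variance =
   N%:R^-1 * (E (fun w => enorm (target_sum N w - EV (target_sum N)) ^+ 2) - N%:R * noise_variance).
  by rewrite mulrBr mulKf// gt_eqF.
rewrite normrM gtr0_norm ?invr_gt0// mulrC ler_pdivrMr//.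
apply: (le_trans (variance_gap N dl0)).
have h1 : dl * (N%:R * noise_variance) <= e / 2 * N%:R.
  rewrite mulrCA mulrC ler_pM2r// /dl mulrAC ler_pdivrMr ?mulr_gt0 ?ltr_wpDl//.
  rewrite (_ : e / 2 * (2 * (noise_variance + 1)) = e * noise_variance + e); last by field.
  by rewrite lerDl ltW.
have h2 : (2 + dl^-1) * E (fun w => enorm (target_sum N w + noise_sum N w) ^+ 2) <= e / 2 * N%:R.
  have c0 : 0 < 2 + dl^-1 by rewrite addr_gt0// invr_gt0.
  apply: (@le_trans _ _ ((2 + dl^-1) * (eps N * N%:R))).
    rewrite ler_pM2l// (le_trans (rem N))// le_eqVlt; apply/orP; left; apply/eqP.
    by rewrite /eps /b; field; rewrite !gt_eqF.
  rewrite mulrA ler_pM2r//.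
  apply: (le_trans (ler_wpM2l (ltW c0) epsN)).
  move: c0; move: (2 + dl^-1) => c c0.
  by apply: eq_ler; field; rewrite gt_eqF.
rewrite [leRHS](_ : _ = e / 2 * N%:R + e / 2 * N%:R); last by field.
exact: lerD.
Unshelve. all: by end_near. Qed.

End StochasticApproximation.

(** * The mean field *)

Lemma small_mul_lt (R : realFieldType) (A B e : R) : 0 <= A -> 0 < B -> 0 <= e ->
  e <= B / (A + 1) -> e * A < B.
Proof.
move=> A0 B0 e0; have A1 : 0 < A + 1 by rewrite ltr_wpDl.
rewrite ler_pdivlMr// mulrDr mulr1 => h.
have [->|] := eqVneq e 0; first by rewrite mul0r.
move=> en; have : 0 < e by rewrite lt_neqAle eq_sym en e0.
move: h; move: (e * A) => p h; lra.
Qed.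

Lemma locally_lip_continuous (R : realType) d (g : 'rV[R]_d -> R) :
  locally_lip g -> continuous g.
Proof.
move=> gl x; have [C C0 gC] := gl (enorm x + 1).
apply/(@cvgrPdist_le _ _ _ _ (nbhs_filter x)) => e e0.
have r0 : 0 < Num.min 1 (e / (C + 1)) by rewrite lt_min ltr01 divr_gt0// ltr_wpDl.
apply: (@filterS _ _ (nbhs_filter x) _ _ _ (ball_enorm x r0)) => y.
rewrite lt_min => /andP[y1 y2].
have yr : enorm y <= enorm x + 1.
  by rewrite -(subrK x y) (le_trans (enormD _ _))// addrC lerD2l ltW.
rewrite (le_trans (gC _ _ _ yr))// ?lerDl// enormB.
rewrite (le_trans (ler_wpM2l C0 (ltW y2)))// mulrCA ler_piMr ?(ltW e0)//.
by rewrite ler_pdivrMr ?ltr_wpDl// mul1r lerDl.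
Qed.

Section MeanField.
Variables (R : realType) (d : nat) (G : 'rV[R]_d -> R) (L : R) (opt : 'rV[R]_d).
Hypothesis dG : forall x, differentiable G x.
Hypothesis L0 : 0 < L.
Hypothesis gradL : forall x y, enorm (grad G x - grad G y) <= L * enorm (x - y).
Hypothesis grad_opt : grad G opt = 0.
Variables (r c1 cg ca : R).
Hypothesis r0 : 0 < r.
Hypothesis c10 : 0 < c1.
Hypothesis cg0 : 0 < cg.
Hypothesis ca0 : 0 < ca.
Hypothesis mono : forall x y, enorm (x - opt) <= r -> enorm (y - opt) <= r ->
  c1 * enorm (y - x) ^+ 2 <= dotv (grad G y - grad G x) (y - x).
Hypothesis glow : forall x, cg * enorm (x - opt) <= enorm (grad G x).
Hypothesis gap_lo : forall x, ca * enorm (x - opt) ^+ 2 <= G x - G opt.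
Hypothesis gap_up : forall x, G x - G opt <= L * enorm (x - opt) ^+ 2.
Variables (S : 'M[R]_d) (lam C1 : R).
Hypothesis lam0 : 0 < lam.
Hypothesis S_lam : forall v, lam * enorm v ^+ 2 <= dotv (v *m S) v.
Hypothesis C10 : 0 <= C1.
Implicit Types x y u v : 'rV[R]_d.

Let enorm_grad x : enorm (grad G x) <= L * enorm (x - opt).
Proof. by have := gradL x opt; rewrite grad_opt subr0. Qed.

(** A vector in the left kernel has zero quadratic form, hence vanishes. *)
Lemma S_unit : S \in unitmx.
Proof.
rewrite -row_free_unit; apply/row_freeP; exists (invmx S); apply: mulmxV.
rewrite -row_free_unit -kermx_eq0; apply/eqP/row_matrixP => i; rewrite row0.
set v := row i (kermx S).
have vS : v *m S = 0 by rewrite /v -row_mul mulmx_ker row0.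
have := S_lam v; rewrite vS dot0v => h.
apply/eqP; rewrite -enorm_eq0 -sqrf_eq0 eq_le sqr_ge0 andbT.
by rewrite -(pmulr_rle0 _ lam0).
Qed.

(** * Zeros of a perturbed gradient drift *)

Section Perturbation.
Variables (e : R) (pr : 'rV[R]_d -> 'rV[R]_d).
Hypothesis e0 : 0 < e.
Hypothesis pr_bound : forall x, enorm (pr x) <= e * C1 * (1 + enorm (x - opt)).
Hypothesis pr_lip : forall x y,
  enorm (pr x - pr y) <= e * C1 * (1 + enorm (x - opt)) * enorm (x - y).

(** [S] will be the covariance of the probe and [pr] the error of order [e] left by the Taylor
    expansion. *)
Definition mean_drift x := - (grad G x *m S) - pr x.

Let kS := d%:R ^+ 2 * `|invmx S|.
Let kap := kS * (C1 * (1 + r)).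
(** Normalising by [invmx S] gives a small perturbation of the gradient itself, so that the
    monotonicity of the gradient near [opt] can be used. *)
Let F0 x := grad G x + pr x *m invmx S.

Let kS0 : 0 <= kS. Proof. by rewrite mulr_ge0// sqr_ge0. Qed.
Let kap0 : 0 <= kap. Proof. by rewrite !mulr_ge0// addr_ge0// ltW. Qed.

Let F0_drift x : mean_drift x = - (F0 x *m S).
Proof. by rewrite /mean_drift /F0 mulmxDl mulmxKV ?S_unit// opprD. Qed.

Let pS_bound x : enorm (x - opt) <= r -> enorm (pr x *m invmx S) <= e * kap.
Proof.
move=> xr; rewrite (le_trans (enorm_mulmx _ _))// /kap mulrCA ler_wpM2l//.
rewrite (le_trans (pr_bound x))// -mulrA ler_pM2l// ler_wpM2l// lerD2l//.
Qed.

Let pS_lip x y : enorm (x - opt) <= r ->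
  enorm (pr x *m invmx S - pr y *m invmx S) <= e * kap * enorm (x - y).
Proof.
move=> xr; rewrite -mulmxBl (le_trans (enorm_mulmx _ _))// -/kS.
rewrite (_ : e * kap * _ = kS * (e * C1 * (1 + r) * enorm (x - y))); last first.
  by rewrite /kap; ring.
rewrite ler_wpM2l// (le_trans (pr_lip x y))// ler_wpM2r// ler_wpM2l ?lerD2l//.
by rewrite mulr_ge0// ltW.
Qed.

Let F0_locally_lip : locally_lip (fun x => enorm (F0 x)).
Proof.
move=> b; exists (L + kS * (e * C1 * (1 + (`|b| + enorm opt)))).
  by rewrite addr_ge0 ?(ltW L0)// !mulr_ge0 ?addr_ge0// ltW.
move=> x y xb yb; rewrite (le_trans (enorm_lip _ _))//.
have -> : F0 x - F0 y = (grad G x - grad G y) + (pr x - pr y) *m invmx S.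
  by rewrite /F0 mulmxBl opprD addrACA.
rewrite (le_trans (enormD _ _))// [leRHS]mulrDl lerD ?gradL//.
rewrite (le_trans (enorm_mulmx _ _))// -/kS -[leRHS]mulrA ler_wpM2l//.
rewrite (le_trans (pr_lip x y))// ler_wpM2r// ler_wpM2l ?mulr_ge0 ?(ltW e0)//.
rewrite lerD2l (le_trans (enormD _ _))// enormN lerD2r (le_trans xb)//.
exact: ler_norm.
Qed.

(** Step length of the descent on the norm of [F0]: [c1 * s <= 1] and [L ^+ 2 * s <= c1] make the
    gradient part contract by [1 - c1 * s / 2], and [s <= 1] keeps the step inside the ball. *)
Let s := c1 / (L ^+ 2 + c1 + c1 ^+ 2).

Let sden : 0 < L ^+ 2 + c1 + c1 ^+ 2.
Proof. by rewrite !addr_gt0 ?exprn_gt0. Qed.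

Let s0 : 0 < s. Proof. exact: divr_gt0. Qed.

Let s1 : s <= 1.
Proof.
rewrite ler_pdivrMr// mul1r addrAC lerDr addr_ge0//.
Qed.

Let sc : c1 * s <= 1.
Proof.
by rewrite /s mulrA ler_pdivrMr// mul1r -expr2 lerDr addr_ge0// ltW.
Qed.

Let sL : L ^+ 2 * s <= c1.
Proof.
rewrite /s mulrA ler_pdivrMr// mulrC ler_pM2l// -addrA lerDl addr_ge0//.
exact: ltW.
Qed.

(* A minimiser of the norm of the normalised drift near [opt] is a zero, since a gradient-like
   step would decrease that norm. *)
Lemma mean_drift_root : e * (2 * kap / cg + kap) < r -> e * kap < c1 / 2 ->
  exists2 t, mean_drift t = 0 & enorm (t - opt) <= e * (2 * kap / cg).
Proof.
move=> e1 e2; have oK : enorm (opt - opt) <= r by rewrite subrr enorm0 ltW.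
have [|m] := @EVT_min_rV R d (fun x => enorm (F0 x)) [set x | enorm (x - opt) <= r]
    (ex_intro _ opt oK) (@compact_enorm_ball R d opt r).
  by apply: continuous_subspaceT; exact: locally_lip_continuous.
rewrite inE => /= mr mmin.
have F0opt : enorm (F0 m) <= e * kap.
  rewrite (le_trans (mmin opt _)) ?inE//; rewrite /F0 grad_opt add0r.
  exact: pS_bound.
have mo : enorm (m - opt) <= e * (2 * kap / cg).
  rewrite mulrA ler_pdivlMr// mulrC (le_trans (glow m))//.
  have -> : grad G m = F0 m - pr m *m invmx S by rewrite /F0 addrK.
  rewrite (le_trans (enormD _ _))// enormN (le_trans (lerD F0opt (pS_bound mr)))//.
  by apply: eq_ler; ring.
exists m => //; rewrite F0_drift.
suff -> : F0 m = 0 by rewrite mul0mx oppr0.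
apply/eqP/negPn/negP => w0; set w := F0 m in w0 F0opt mmin.
have wp : 0 < enorm w by rewrite enorm_gt0.
pose y := m - s *: w.
have ym : y - m = - (s *: w) by rewrite /y addrAC subrr add0r.
have yr : enorm (y - opt) <= r.
  rewrite /y addrAC (le_trans (enormD _ _))// enormN enormZ gtr0_norm//.
  rewrite (le_trans _ (ltW e1))// mulrDr lerD//.
  by rewrite (le_trans _ F0opt)// ler_piMl.
have := mmin y; rewrite inE => /(_ yr); apply/negP; rewrite -ltNge.
set D := grad G y - grad G m.
have wD : dotv w D <= - (c1 * s * enorm w ^+ 2).
  have := mono mr yr; rewrite -/D ym enormN enormZ gtr0_norm// dotvNr dotvZr dotvC exprMn.
  move=> h; rewrite lerNr -(ler_pM2l s0); move: h.
  by move: (enorm w ^+ 2) (dotv w D) => a b h; rewrite expr2 in h; lra.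
have DD : enorm D <= L * (s * enorm w).
  by rewrite (le_trans (gradL y m))// ym enormN enormZ gtr0_norm.
(* The squared norm contracts by [1 - c1 * s], which is at most the square of this factor. The
   perturbation then gives back at most [e * kap * (s * enorm w)], strictly less than the gain. *)
have wDn : enorm (w + D) <= enorm w * (1 - c1 * s / 2).
  have q0 : 0 <= 1 - c1 * s / 2 by have := sc; lra.
  rewrite -(ler_pXn2r (n := 2)) ?nnegrE ?mulr_ge0// enormD_sqr.
  have h1 : enorm D ^+ 2 <= c1 * s * enorm w ^+ 2.
    apply: (@le_trans _ _ ((L * (s * enorm w)) ^+ 2)).
      have Lsw : 0 <= L * (s * enorm w).
        by rewrite mulr_ge0 ?(ltW L0)// mulr_ge0// (ltW s0).
      by rewrite lerXn2r ?nnegrE.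
    rewrite (_ : _ ^+ 2 = L ^+ 2 * s * (s * enorm w ^+ 2)); last by ring.
    rewrite -[leRHS]mulrA ler_wpM2r// mulr_ge0//.
    exact: ltW.
  have h2 : 0 <= (c1 * s / 2 * enorm w) ^+ 2 by exact: sqr_ge0.
  rewrite [leRHS](_ : _ = enorm w ^+ 2 - c1 * s * enorm w ^+ 2 + (c1 * s / 2 * enorm w) ^+ 2); last by field.
  move: h1 h2 wD; move: (dotv w D) (enorm w ^+ 2) (enorm D ^+ 2) ((_ / 2 * _) ^+ 2) (c1 * s * _).
  by move=> a1 a2 a3 a4 a5; lra.
have -> : F0 y = (w + D) + (pr y *m invmx S - pr m *m invmx S).
  rewrite /w /D /F0; move: (pr y *m _) (pr m *m _) => a b.
  by apply/rowP => i; rewrite !mxE; ring.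
rewrite (le_lt_trans (enormD _ _))// (le_lt_trans (lerD wDn (pS_lip m yr)))//.
rewrite ym enormN enormZ gtr0_norm//.
have sw : 0 < s * enorm w by exact: mulr_gt0.
have : e * kap * (s * enorm w) < c1 / 2 * (s * enorm w) by rewrite ltr_pM2r.
by move: (e * kap) (enorm w) => a b h; lra.
Qed.

(** * The Bregman divergence at the zero of the drift *)

Section Lyapunov.
Variables (t : 'rV[R]_d) (cm : R).
Hypothesis cm0 : 0 < cm.
Hypothesis cm1 : cm <= c1.
Hypothesis cm2 : cm <= cg / 4.
Hypothesis t_root : mean_drift t = 0.
Hypothesis t_r : enorm (t - opt) <= r / 2.
Hypothesis t_g : L * enorm (t - opt) <= cg / 8 * r.
Hypothesis t_a : L * enorm (t - opt) <= ca / 32 * r.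
Hypothesis e_lam : e * (C1 * (1 + r)) <= lam / 2 * cm.

(* The Lyapunov function of the mean flow. *)
Definition bregman x := G x - G t - dotv (grad G t) (x - t).

Let far_dist x : r < enorm (x - opt) ->
  r / 2 <= enorm (x - t) /\ enorm (x - t) <= 2 * enorm (x - opt).
Proof.
move=> xr; have := enorm_triangle x t opt; have := enorm_triangle x opt t.
rewrite (enormB opt t); move: t_r xr; move: (enorm _) (enorm _) (enorm _) => a b c.
by move=> h1 h2 h3 h4; split; lra.
Qed.

Let tr : enorm (t - opt) <= r. Proof. by rewrite (le_trans t_r)// ler_pdivrMr// ler_peMr ?ltW//; lra. Qed.

(** Near [opt] this is monotonicity; far away the gradient at [x] dominates the one at [t], which
    [t_g] keeps small. *)
Lemma bregman_grad_lower x : cm * enorm (x - t) <= enorm (grad G x - grad G t).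
Proof.
have [xr|xr] := leP (enorm (x - opt)) r.
  have [->|xt] := eqVneq x t; first by rewrite !subrr enorm0 mulr0.
  have xp : 0 < enorm (x - t) by rewrite enorm_gt0 subr_eq0.
  apply: (@le_trans _ _ (c1 * enorm (x - t))); first by rewrite ler_pM2r.
  rewrite -(ler_pM2r xp) -mulrA -expr2.
  exact: le_trans (mono tr xr) (ler_dotv _ _).
have [h1 h2] := far_dist xr.
have := glow x; have := enorm_grad t; have := enormD (grad G x - grad G t) (grad G t).
rewrite subrK.
have h3 : cg / 8 * r <= cg / 4 * enorm (x - t).
  by have := ler_wpM2l (ltW cg0) h1; move: (enorm (x - t)) => p; lra.
have h4 := ler_wpM2l (ltW cg0) h2.
have h5 : cm * enorm (x - t) <= cg / 4 * enorm (x - t) by rewrite ler_wpM2r.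
move: h3 h4 h5 t_g; move: (enorm (x - t)) (enorm (x - opt)) (enorm (t - opt)) => a b c.
move: (enorm (grad G x)) (enorm (grad G t)) (enorm _) => p q l.
by move=> h3 h4 h5 h6 h7 h8 h9; lra.
Qed.

(** Along the segment from [t], subtract the linear part and [c1 / 2 * k * q ^+ 2]: monotonicity
    makes the derivative of the difference nonnegative. *)
Lemma bregman_near x : enorm (x - opt) <= r -> c1 / 2 * enorm (x - t) ^+ 2 <= bregman x.
Proof.
move=> xr; set u := x - t; set k := enorm u ^+ 2.
have [|q /andP[q0 q1]] := @mvt01 R
   (fun q => G (t + q *: u) - q * dotv (grad G t) u - c1 / 2 * k * q ^+ 2)
   (fun q => dotv (grad G (t + q *: u)) u - dotv (grad G t) u - c1 * k * q).
  move=> q; apply: is_deriveB; first apply: is_deriveB.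
  - by rewrite -derive_grad//; exact: is_derive_line.
  - have := @is_deriveZ R R R id (dotv (grad G t) u) q 1 1 (is_derive_id _ _).
    rewrite [_ *: 1]mulr1; congr is_derive.
    by apply/funext => a /=; rewrite mulrC.
  - have := @is_deriveZ R R R (id ^+ 2) (c1 / 2 * k) q 1 _ (is_deriveX 2 (is_derive_id q 1)).
    congr is_derive.
    rewrite /= [_ *: 1]mulr1 expr1.
    by rewrite [LHS](_ : _ = c1 / 2 * k * (2 * q))//; field.
rewrite scale1r scale0r addr0 mul1r mul0r expr1n expr0n !mulr0 mulr1 !subr0 /u subrKC -/u.
have : 0 <= dotv (grad G (t + q *: u)) u - dotv (grad G t) u - c1 * k * q.
  have [->|qn] := eqVneq q 0; first by rewrite scale0r addr0 subrr mulr0 subr0.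
  have qp : 0 < q by rewrite lt_neqAle eq_sym qn.
  have zr : enorm (t + q *: u - opt) <= r.
    have -> : t + q *: u - opt = (1 - q) *: (t - opt) + q *: (x - opt).
      by apply/rowP => i; rewrite /u !mxE; ring.
    have q1' : 0 <= 1 - q by rewrite subr_ge0.
    rewrite (le_trans (enormD _ _))// !enormZ !ger0_norm//.
    by have := ler_wpM2l q0 xr; have := ler_wpM2l q1' tr; move: (enorm _) (enorm _) => a b; lra.
  have := mono tr zr; rewrite addrAC subrr add0r enormZ gtr0_norm// dotvZr dotvBl exprMn.
  rewrite -/k expr2 => h; rewrite -(pmulr_rge0 _ qp); move: h.
  by move: (dotv _ _) (dotv _ _) => a b; lra.
by rewrite /bregman -/u; move: (dotv _ _) (dotv _ _) (G x) (G t) => a b c f; lra.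
Qed.

(** Quadratic growth of [G] beats the linear term and the gap of [t]; both are controlled by [t_a],
    since [x] is at distance at least [r / 2] from [t]. *)
Lemma bregman_far x : r < enorm (x - opt) -> ca / 8 * enorm (x - t) ^+ 2 <= bregman x.
Proof.
move=> xr; have [h1 h2] := far_dist xr; rewrite /bregman.
have g1 := gap_lo x; have g2 := gap_up t.
have g3 := le_trans (ler_dotv (grad G t) (x - t)) (ler_wpM2r (enorm_ge0 _) (enorm_grad t)).
have a0 := enorm_ge0 (x - t).
have k1 : L * enorm (t - opt) ^+ 2 <= L * enorm (t - opt) * enorm (x - t).
  rewrite expr2 mulrA ler_wpM2l ?mulr_ge0 ?(ltW L0)//.
  exact: le_trans t_r h1.
have k2 : L * enorm (t - opt) * enorm (x - t) <= ca / 16 * enorm (x - t) ^+ 2.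
  rewrite expr2 mulrA ler_wpM2r//; apply: (le_trans t_a).
  by have := ler_wpM2l (ltW ca0) h1; move: (enorm (x - t)) => p; lra.
have k3 : enorm (x - t) ^+ 2 <= 4 * enorm (x - opt) ^+ 2.
  rewrite (_ : 4 * _ = (2 * enorm (x - opt)) ^+ 2); last by ring.
  by rewrite lerXn2r ?nnegrE ?mulr_ge0.
have k4 := ler_wpM2l (ltW ca0) k3.
move: g1 g2 g3 k1 k2 k4.
move: (enorm (x - t) ^+ 2) (enorm (x - opt) ^+ 2) (enorm (t - opt) ^+ 2).
move: (L * enorm (t - opt) * enorm (x - t)) (dotv _ _) (G x) (G t) (G opt).
by move=> a b c f g k l q; lra.
Qed.

Lemma bregman_lower x :
  Num.min (c1 / 2) (ca / 8) * enorm (x - t) ^+ 2 <= bregman x.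
Proof.
have [xr|xr] := leP (enorm (x - opt)) r.
  rewrite (le_trans _ (bregman_near xr))// ler_wpM2r//.
  by rewrite ge_min lexx.
rewrite (le_trans _ (bregman_far xr))// ler_wpM2r//.
by rewrite ge_min lexx orbT.
Qed.

Lemma bregman_upper x : bregman x <= L * enorm (x - t) ^+ 2.
Proof.
have := taylor2 dG gradL t (x - t) (ltW L0).
by rewrite subrKC => /(le_trans (ler_norm _)).
Qed.

Lemma bregman_step x u :
  bregman (x + u) <= bregman x + dotv (grad G x - grad G t) u + L * enorm u ^+ 2.
Proof.
have := le_trans (ler_norm _) (taylor2 dG gradL x u (ltW L0)).
rewrite /bregman (addrAC x u) (dotvDr _ (x - t) u) dotvBl.
move: (G (x + u)) (G x) (G t) (dotv (grad G x) u) (dotv (grad G t) u).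
by move: (dotv (grad G t) (x - t)) (enorm u ^+ 2) => a b c f g k l; lra.
Qed.

(** As the drift vanishes at [t], it equals [- (v *m S)] less an increment of [pr]. That increment
    is estimated with base point [t], where the growth factor is at most [1 + r], so that [e_lam]
    lets half of the quadratic form absorb it. *)
Lemma bregman_decrease x :
  dotv (grad G x - grad G t) (mean_drift x) <= - (lam / 2 * cm ^+ 2) * enorm (x - t) ^+ 2.
Proof.
set v := grad G x - grad G t.
have -> : mean_drift x = - (v *m S) - (pr x - pr t).
  rewrite -[LHS]subr0 -t_root /mean_drift /v mulmxBl.
  move: (grad G x *m S) (grad G t *m S) => a b.
  by apply/rowP => i; rewrite !mxE; ring.
rewrite dotvBr dotvNr dotvC.
have h1 := S_lam v; have h2 := bregman_grad_lower x; rewrite -/v in h2.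
have h3 : - dotv v (pr x - pr t) <= lam / 2 * enorm v ^+ 2.
  rewrite -dotvNr (le_trans (ler_dotv _ _))// enormN expr2 mulrA mulrC.
  rewrite ler_wpM2r// -(enormB (pr t)) (le_trans (pr_lip t x))//.
  rewrite (enormB t x) (@le_trans _ _ (e * (C1 * (1 + r)) * enorm (x - t)))//.
    by rewrite ler_wpM2r// -mulrA ler_pM2l// ler_wpM2l// lerD2l.
  rewrite (le_trans (ler_wpM2r (enorm_ge0 _) e_lam))// -(mulrA (lam / 2)) ler_wpM2l//.
  by rewrite divr_ge0// ltW.
have h4 : (cm * enorm (x - t)) ^+ 2 <= enorm v ^+ 2.
  by rewrite lerXn2r ?nnegrE ?mulr_ge0// ltW.
have h5 := ler_wpM2l (ltW lam0) h4; rewrite exprMn in h5.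
move: h1 h3 h5; move: (enorm v ^+ 2) (enorm (x - t) ^+ 2) (dotv _ _) (dotv _ _) (cm ^+ 2).
by move=> a b c f g; lra.
Qed.

Lemma drift_root_unique x : mean_drift x = 0 -> x = t.
Proof.
move=> x0; have := bregman_decrease x; rewrite x0 dotv0 mulNr oppr_ge0 => h.
apply/eqP; rewrite -subr_eq0 -enorm_eq0 -sqrf_eq0 eq_le sqr_ge0 andbT.
rewrite -(pmulr_rle0 _ (_ : 0 < lam / 2 * cm ^+ 2))//.
by rewrite mulr_gt0 ?divr_gt0 ?exprn_gt0.
Qed.

End Lyapunov.

End Perturbation.
(** The constants are chosen before [e] and [pr], so that they serve all small exploration gains at
    once. *)
Lemma mean_drift_lyapunov : exists e0 C2 cV : R, [/\ 0 < e0, 0 <= C2, 0 < cV &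
  forall (e : R) (pr : 'rV[R]_d -> 'rV[R]_d), 0 < e -> e < e0 ->
    (forall x, enorm (pr x) <= e * C1 * (1 + enorm (x - opt))) ->
    (forall x y, enorm (pr x - pr y) <= e * C1 * (1 + enorm (x - opt)) * enorm (x - y)) ->
    exists t, [/\ mean_drift pr t = 0, (forall x, mean_drift pr x = 0 -> x = t),
      enorm (t - opt) <= e * C2,
      (forall x, cV * enorm (x - t) ^+ 2 <= bregman t x) &
      (forall x, dotv (grad G x - grad G t) (mean_drift pr x) <= - cV * enorm (x - t) ^+ 2)]].
Proof.
set kS := d%:R ^+ 2 * `|invmx S|; set kap := kS * (C1 * (1 + r)).
have kap0 : 0 <= kap.
  by rewrite mulr_ge0 ?mulr_ge0// addr_ge0// ltW.
pose cm := Num.min c1 (cg / 4).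
have cm0 : 0 < cm by rewrite lt_min c10 divr_gt0.
pose C2 := 2 * kap / cg.
have C20 : 0 <= C2 by rewrite divr_ge0 ?(ltW cg0)// mulr_ge0.
pose cV := Num.min (Num.min (c1 / 2) (ca / 8)) (lam / 2 * cm ^+ 2).
have cV0 : 0 < cV by rewrite !lt_min !divr_gt0//= mulr_gt0 ?divr_gt0 ?exprn_gt0.
have kr0 : 0 <= C1 * (1 + r) by rewrite mulr_ge0// addr_ge0// ltW.
(* [e1] and [e2] produce the zero, [e3] to [e5] place it close enough to [opt], and [e6] absorbs the
   perturbation in the decrease; each [+ 1] covers a vanishing constant. *)
pose e1 := r / (C2 + kap + 1); pose e2 := c1 / 2 / (kap + 1).
pose e3 := r / 2 / (C2 + 1); pose e4 := cg / 8 * r / (L * C2 + 1).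
pose e5 := ca / 32 * r / (L * C2 + 1); pose e6 := lam / 2 * cm / (C1 * (1 + r) + 1).
exists (Num.min e1 (Num.min e2 (Num.min e3 (Num.min e4 (Num.min e5 e6))))), C2, cV.
have LC2 : 0 <= L * C2 by rewrite mulr_ge0// ltW.
split=> //.
  by rewrite !lt_min !divr_gt0 ?mulr_gt0 ?ltr_wpDl ?addr_ge0 ?divr_gt0.
move=> e pr e0; rewrite !lt_min => /and5P[h1 h2 h3 h4 /andP[h5 h6]] prb prl.
have g1 := small_mul_lt (addr_ge0 C20 kap0) r0 (ltW e0) (ltW h1).
have g2 := small_mul_lt kap0 (divr_gt0 c10 (ltr0Sn R 1)) (ltW e0) (ltW h2).
have g3 := small_mul_lt C20 (divr_gt0 r0 (ltr0Sn R 1)) (ltW e0) (ltW h3).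
have g4 := small_mul_lt LC2 (mulr_gt0 (divr_gt0 cg0 (ltr0Sn R 7)) r0) (ltW e0) (ltW h4).
have g5 := small_mul_lt LC2 (mulr_gt0 (divr_gt0 ca0 (ltr0Sn R 31)) r0) (ltW e0) (ltW h5).
have g6 := small_mul_lt kr0 (mulr_gt0 (divr_gt0 lam0 (ltr0Sn R 1)) cm0) (ltW e0) (ltW h6).
have [t t0 tC] := mean_drift_root e0 prb prl g1 g2.
have cmc1 : cm <= c1 by rewrite ge_min lexx.
have cmcg : cm <= cg / 4 by rewrite ge_min lexx orbT.
have tr := le_trans tC (ltW g3).
have Lt : L * enorm (t - opt) <= e * (L * C2) by rewrite mulrCA ler_wpM2l// ltW.
have tg := le_trans Lt (ltW g4); have ta := le_trans Lt (ltW g5).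
exists t; split=> //.
- by move=> x; exact: (drift_root_unique e0 prl cm0 cmc1 cmcg t0 tr tg (ltW g6)).
- move=> x; apply: le_trans (bregman_lower tr ta x).
  by rewrite ler_wpM2r// ge_min lexx.
- move=> x; apply: (le_trans (bregman_decrease e0 prl cm0 cmc1 cmcg t0 tr tg (ltW g6) x)).
  by rewrite ler_wpM2r// lerN2 ge_min lexx orbT.
Qed.

End MeanField.

(** * The exploration gain *)

Lemma sqrt_dist (R : rcfType) (a b : R) : 0 <= a -> 0 <= b ->
  `|Num.sqrt a - Num.sqrt b| * (Num.sqrt a + Num.sqrt b) = `|a - b|.
Proof.
move=> a0 b0; rewrite -[in RHS](sqr_sqrtr a0) -[in RHS](sqr_sqrtr b0) subr_sqr normrM.
by congr (_ * _); rewrite ger0_norm// addr_ge0 ?sqrtr_ge0.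
Qed.

Section Gain.
Variables (R : realType) (d : nat) (G : 'rV[R]_d -> R) (L ca : R) (opt : 'rV[R]_d).
Hypothesis dG : forall x, differentiable G x.
Hypothesis L0 : 0 < L.
Hypothesis gradL : forall x y, enorm (grad G x - grad G y) <= L * enorm (x - y).
Hypothesis grad_opt : grad G opt = 0.
Hypothesis ca0 : 0 < ca.
Hypothesis gap_lo : forall x, ca * enorm (x - opt) ^+ 2 <= G x - G opt.
Implicit Types x y xi : 'rV[R]_d.

(** The gradient is at most [L] times the distance to [opt], and on the segment this distance is at
    most the sum of those of the end points. *)
Lemma objective_diff x y :
  `|G x - G y| <= L * (enorm (x - opt) + enorm (y - opt)) * enorm (x - y).
Proof.
have [s /andP[s0 s1]] := taylor1 dG y (x - y); rewrite subrKC => ->.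
rewrite (le_trans (normr_dotv _ _))// ler_wpM2r//.
have := gradL (y + s *: (x - y)) opt; rewrite grad_opt subr0 => /le_trans; apply.
rewrite ler_pM2l//.
have -> : y + s *: (x - y) - opt = s *: (x - opt) + (1 - s) *: (y - opt).
  by apply/rowP => i; rewrite !mxE; ring.
have q1 : 0 <= 1 - s by rewrite subr_ge0.
rewrite (le_trans (enormD _ _))// !enormZ !ger0_norm// lerD// ler_piMl//.
by rewrite gerBl.
Qed.

Lemma objective_locally_lip : locally_lip G.
Proof.
move=> b; exists (L * (2 * (`|b| + enorm opt))).
  by rewrite mulr_ge0 ?(ltW L0)// mulr_ge0// addr_ge0.
move=> x y xb yb; apply: (le_trans (objective_diff x y)).
rewrite ler_wpM2r// ler_pM2l// mulr_natl mulr2n.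
by rewrite lerD// (le_trans (enormD _ _))// enormN lerD2r (le_trans _ (ler_norm _)).
Qed.

(** What both gains have in common once [e] is factored out. In the second form the square root is
    Lipschitz because increments of [G] are of the order of the distance to [opt] times the
    displacement, while the root itself dominates that distance. *)
Lemma gain_factor (g : gain_form R d) : gain_ok G g ->
  exists (eta : 'rV[R]_d -> R) (Ke ce : R), [/\ (forall e x, gain G g e x = e * eta x),
    forall x, 1 <= eta x, 0 <= Ke, 0 < ce &
    (forall x y, `|eta x - eta y| <= Ke * enorm (x - y)) /\
    (forall x, ce * enorm (x - opt) <= eta x)].
Proof.
case: g => [ctr sg|Gm] /= ok.
- pose a x := enorm (x - ctr) / sg.
  have a0 x : 0 <= a x by rewrite divr_ge0// ltW.
  exists (fun x => Num.sqrt (1 + enorm (x - ctr) ^+ 2 / sg ^+ 2)), sg^-1, (sg + enorm (ctr - opt))^-1.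
  have aE x : enorm (x - ctr) ^+ 2 / sg ^+ 2 = a x ^+ 2 by rewrite -expr_div_n.
  have p0 x : 0 <= 1 + a x ^+ 2 by rewrite addr_ge0.
  have ge1 x : 1 <= Num.sqrt (1 + a x ^+ 2) by rewrite -{1}sqrtr1 ler_wsqrtr// lerDl sqr_ge0.
  have gea x : a x <= Num.sqrt (1 + a x ^+ 2).
    by rewrite -{1}(ger0_norm (a0 x)) -sqrtr_sqr ler_wsqrtr// lerDr.
  have sp : 0 < sg + enorm (ctr - opt) by rewrite ltr_pwDl.
  split=> [//|x|||]; rewrite ?aE//.
  - by rewrite invr_ge0 ltW.
  - by rewrite invr_gt0.
  split=> [x y|x]; rewrite !aE.
    have h := sqrt_dist (p0 x) (p0 y).
    have sxy : 0 < Num.sqrt (1 + a x ^+ 2) + Num.sqrt (1 + a y ^+ 2).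
      by rewrite addr_gt0// (lt_le_trans ltr01).
    rewrite -(ler_pM2r sxy) h opprD addrACA subrr add0r subr_sqr normrM.
    rewrite ler_pM//.
      rewrite /a -mulrBl normrM mulrC normfV (gtr0_norm ok) ler_pM2l ?invr_gt0//.
      by rewrite (le_trans (enorm_lip _ _))// opprB addrA subrK.
    by rewrite ger0_norm ?addr_ge0// lerD.
  rewrite mulrC ler_pdivrMr//.
  have h1 := gea x; have h2 := ge1 x.
  have h3 := ler_wpM2l (ltW ok) h1.
  rewrite /a mulrCA mulfV ?gt_eqF// mulr1 in h3.
  rewrite (le_trans (enorm_triangle x ctr opt))// mulrDr lerD//; first by rewrite mulrC.
  by rewrite ler_peMl.
have p0 x : 1 <= 1 + G x - Gm by rewrite -addrA lerDl subr_ge0.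
have p0' x : 0 <= 1 + G x - Gm by rewrite (le_trans ler01).
have c0 : 0 < Num.sqrt ca by rewrite sqrtr_gt0.
pose eta x := Num.sqrt (1 + G x - Gm).
have ge1 x : 1 <= eta x by rewrite -{1}sqrtr1 ler_wsqrtr.
have gec x : Num.sqrt ca * enorm (x - opt) <= eta x.
  rewrite -(ger0_norm (enorm_ge0 (x - opt))) -sqrtr_sqr -sqrtrM ?(ltW ca0)//.
  rewrite ler_wsqrtr// (le_trans (gap_lo x))//.
  by have := ok opt; move: (G x) (G opt) => u v; lra.
exists eta, (L / Num.sqrt ca), (Num.sqrt ca); split=> //.
  by rewrite divr_ge0// ltW.
split=> // x y.
have sxy : 0 < eta x + eta y by rewrite addr_gt0// (lt_le_trans ltr01).
rewrite -(ler_pM2r sxy) (sqrt_dist (p0' x) (p0' y)).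
rewrite (_ : 1 + G x - Gm - (1 + G y - Gm) = G x - G y); last by ring.
rewrite (le_trans (objective_diff x y))// [leRHS]mulrAC ler_wpM2r//.
rewrite -[leRHS]mulrA ler_pM2l// [leRHS]mulrC ler_pdivlMr// [leLHS]mulrDl.
by rewrite lerD// mulrC.
Qed.

(** * Growth and Lipschitz bounds for the scaled objective *)

Variables (eta : 'rV[R]_d -> R) (Ke ce B : R).
Hypothesis eta1 : forall x, 1 <= eta x.
Hypothesis Ke0 : 0 <= Ke.
Hypothesis ce0 : 0 < ce.
Hypothesis eta_lip : forall x y, `|eta x - eta y| <= Ke * enorm (x - y).
Hypothesis eta_lo : forall x, ce * enorm (x - opt) <= eta x.
Hypothesis B0 : 0 <= B.

Definition quotient (e : R) x xi := G (x + (e * eta x) *: xi) / (e * eta x).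

Let eta0 x : 0 < eta x. Proof. exact: lt_le_trans (eta1 x). Qed.

(** Scale of the probed point: its distance to [opt] is at most [D e * eta x], since [eta] also
    dominates the distance of [x]. *)
Let D (e : R) := ce^-1 + e * B.

Let D0 e : 0 < e -> 0 < D e.
Proof. by move=> e0; rewrite ltr_pwDl ?invr_gt0// mulr_ge0// ltW. Qed.

Let probe_dist e x xi : 0 < e -> enorm xi <= B ->
  enorm (x + (e * eta x) *: xi - opt) <= D e * eta x.
Proof.
move=> e0 xB; rewrite addrAC (le_trans (enormD _ _))// /D mulrDl lerD//.
  by rewrite mulrC ler_pdivlMr// mulrC.
rewrite enormZ gtr0_norm ?mulr_gt0// mulrAC ler_wpM2r ?(ltW (eta0 x))//.
by rewrite ler_pM2l.
Qed.

Let A (e : R) := `|G opt| + L * D e ^+ 2.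

Let A0 e : 0 <= A e.
Proof. by rewrite addr_ge0// mulr_ge0// ltW. Qed.

Let probe_bound e x xi : 0 < e -> enorm xi <= B ->
  `|G (x + (e * eta x) *: xi)| <= A e * eta x ^+ 2.
Proof.
move=> e0 xB; set y := x + _.
have := objective_diff y opt; rewrite subrr enorm0 addr0 -mulrA -expr2 => h.
have := ler_normD (G y - G opt) (G opt); rewrite subrK => /le_trans; apply.
rewrite addrC /A mulrDl lerD//; first by rewrite ler_peMr// exprn_ege1.
rewrite (le_trans h)// -mulrA ler_pM2l// -exprMn lerXn2r ?nnegrE//.
  by rewrite mulr_ge0// ltW// D0.
exact: probe_dist.
Qed.

Lemma quotient_bound e x : 0 < e -> exists2 C : R, 0 <= C &
  forall xi, enorm xi <= B -> `|quotient e x xi| <= C.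
Proof.
move=> e0; have p0 : 0 < e * eta x by rewrite mulr_gt0.
exists (A e * eta x ^+ 2 / (e * eta x)).
  by rewrite divr_ge0 ?mulr_ge0// ltW.
move=> xi xB; rewrite /quotient normrM normfV [X in _ / X]gtr0_norm//.
by rewrite ler_pM2r ?invr_gt0// probe_bound.
Qed.

(** At the probed points the objective is O(eta^2) and its increments are O(eta) times the
    displacement, so dividing by [eta] leaves a constant independent of the state. By symmetry
    [eta y <= eta x]. *)
Lemma quotient_lip e : 0 < e -> exists2 C : R, 0 <= C &
  forall x y xi, enorm xi <= B -> `|quotient e x xi - quotient e y xi| <= C * enorm (x - y).
Proof.
move=> e0; pose K := 1 + e * Ke * B.
have K0 : 0 <= K by rewrite addr_ge0// !mulr_ge0// ltW.
pose C := (2 * L * D e * K + A e * Ke) / e.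
have C0 : 0 <= C.
  rewrite divr_ge0 ?(ltW e0)// addr_ge0 ?mulr_ge0//.
    by rewrite ltW.
  by rewrite ltW// D0.
exists C => //.
suff half x y xi : enorm xi <= B -> eta y <= eta x ->
    `|quotient e x xi - quotient e y xi| <= C * enorm (x - y).
  move=> x y xi xB; case/orP: (le_total (eta y) (eta x)) => xy; first exact: half.
  by rewrite distrC enormB half.
move=> xB yx.
have ex : 0 < e * eta x by rewrite mulr_gt0.
have ey : 0 < e * eta y by rewrite mulr_gt0.
set x' := x + (e * eta x) *: xi; set y' := y + (e * eta y) *: xi.
have xy' : enorm (x' - y') <= K * enorm (x - y).
  have -> : x' - y' = (x - y) + (e * (eta x - eta y)) *: xi.
    by apply/rowP => i; rewrite /x' /y' !mxE; ring.
  rewrite (le_trans (enormD _ _))// /K mulrDl mul1r lerD2l enormZ normrM (gtr0_norm e0).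
  rewrite -!mulrA ler_pM2l// [leRHS](_ : _ = Ke * enorm (x - y) * B); last by ring.
  by rewrite ler_pM.
have h1 : `|G x' - G y'| <= 2 * L * D e * K * eta x * enorm (x - y).
  apply: (le_trans (objective_diff x' y')).
  have s1 : enorm (x' - opt) + enorm (y' - opt) <= 2 * D e * eta x.
    have p1 := probe_dist x e0 xB; have p2 := probe_dist y e0 xB.
    have p3 := ler_wpM2l (ltW (D0 e0)) yx.
    move: p1 p2 p3; rewrite -/x' -/y'; move: (enorm _) (enorm _) (D e) => u v z; lra.
  have s2 := ler_pM (addr_ge0 (enorm_ge0 (x' - opt)) (enorm_ge0 (y' - opt)))
     (enorm_ge0 (x' - y')) s1 xy'.
  have s3 := ler_wpM2l (ltW L0) s2.
  rewrite -mulrA (le_trans s3)// le_eqVlt; apply/orP; left; apply/eqP; ring.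
have h2 := probe_bound y e0 xB; rewrite -/y' in h2.
have -> : quotient e x xi - quotient e y xi =
    (G x' - G y') / (e * eta x) - G y' * (eta x - eta y) / (e * (eta x * eta y)).
  by rewrite /quotient -/x' -/y'; field; rewrite !gt_eqF.
rewrite [leRHS](_ : _ = 2 * L * D e * K / e * enorm (x - y) + A e * Ke / e * enorm (x - y)); last first.
  by rewrite /C mulrDl mulrDl.
rewrite (le_trans (ler_normB _ _))// lerD//.
  rewrite normrM normfV [X in _ / X]gtr0_norm// ler_pdivrMr// (le_trans h1)//.
  by apply: eq_ler; field; rewrite gt_eqF.
rewrite normrM normfV [X in _ / X]gtr0_norm ?mulr_gt0// ler_pdivrMr ?mulr_gt0//.
rewrite normrM (le_trans (ler_pM _ _ h2 (eta_lip x y)))//.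
rewrite [leRHS](_ : _ = A e * (eta x * eta y) * (Ke * enorm (x - y))); last first.
  by field; rewrite gt_eqF.
rewrite ler_wpM2r ?mulr_ge0// ler_wpM2l// expr2 ler_pM2r//.
Qed.

End Gain.

(** * Zeroth-order field *)

Section Spsa.
Context {disp : measure_display} {T : measurableType disp} {R : realType}.
Variables (d : nat) (P : probability T R) (W : nat -> T -> 'rV[R]_d) (M : R).
Hypothesis M0 : 0 <= M.
Hypothesis WM : forall n t, enorm (W n t) <= M.
Hypothesis iidW : iid P W.
Hypothesis mean0 : forall n i, 'E_P[(fun w => W n w 0 i)%R]%E = 0%E.
Hypothesis pos2 : forall n, posdef (second_moment_mx P (W n)).
Notation path := (nat -> 'rV[R]_d).
Notation E := (EW P W).
Notation nice := (nice M).
Notation niceV := (niceV M).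
Notation inball := (inball M).
Implicit Types (w : path) (X Y : path -> 'rV[R]_d) (x y u v : 'rV[R]_d).

Variables (G : 'rV[R]_d -> R) (L H : R) (opt : 'rV[R]_d).
Hypothesis dG : forall x, differentiable G x.
Hypothesis dgG : forall x, differentiable (grad G) x.
Hypothesis L0 : 0 < L.
Hypothesis H0 : 0 <= H.
Hypothesis gradL : forall x y, enorm (grad G x - grad G y) <= L * enorm (x - y).
Hypothesis hessL : forall x y u,
  enorm (u *m hess G x - u *m hess G y) <= H * enorm u * enorm (x - y).
Hypothesis grad_opt : grad G opt = 0.
Variables (eta : 'rV[R]_d -> R) (Ke ce : R).
Hypothesis eta1 : forall x, 1 <= eta x.
Hypothesis Ke0 : 0 <= Ke.
Hypothesis ce0 : 0 < ce.
Hypothesis eta_lip : forall x y, `|eta x - eta y| <= Ke * enorm (x - y).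
Hypothesis eta_lo : forall x, ce * enorm (x - opt) <= eta x.
Variables (p q : R).

Let ED := @EWD _ _ _ _ P W M M0 WM iidW.
Let EZ := @EWZ _ _ _ _ P W M M0 WM iidW.
Let E_eq := @EW_eq _ _ _ _ P W M WM.
Let E_cst := @EW_cst _ _ _ _ P W.
Let tower := @EW_tower _ _ _ _ P W M M0 WM iidW.

(** [u] is the older sample. The pair [(p, q)] is [(1, 0)] for i.i.d. and [(zeta, - zeta)] for
    zig-zag exploration. *)
Definition probe u v := p *: v + q *: u.
Let B := (`|p| + `|q|) * M.

Let B0 : 0 <= B. Proof. by rewrite mulr_ge0// addr_ge0. Qed.

Let eta0 x : 0 < eta x. Proof. exact: lt_le_trans (eta1 x). Qed.

Lemma probe_le u v : enorm u <= M -> enorm v <= M -> enorm (probe u v) <= B.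
Proof.
move=> uM vM; rewrite (le_trans (enormD _ _))// !enormZ /B mulrDl.
by rewrite lerD// ler_wpM2l.
Qed.

Lemma nice_probe n i j : (i < n)%N -> (j < n)%N -> niceV n (fun w => probe (w i) (w j)).
Proof.
move=> ni nj; apply: niceVD; apply: niceVZ => //; try exact: nice_cst.
  exact: niceV_coord.
exact: niceV_coord.
Qed.

Lemma eta_locally_lip : locally_lip eta.
Proof. by move=> r; exists Ke. Qed.

Lemma nice_quotient e n X Y : 0 < e -> niceV n X -> niceV n Y ->
  nice n (fun w => quotient G eta e (X w) (Y w)).
Proof.
move=> e0 nX nY.
have ne : nice n (fun w => e * eta (X w)) by apply: niceZ => //; exact: (nice_comp M0 eta_locally_lip nX).
apply: niceM => //.
  apply: (nice_comp M0 (objective_locally_lip dG L0 gradL grad_opt)).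
  by apply: niceVD => //; exact: niceVZ.
apply: (nice_inv e0) => // w wM.
by rewrite ler_peMr// ltW.
Qed.

Section Gain.
Variable e : R.
Hypothesis e0 : 0 < e.

Definition field x u v := spsa_field G (fun x => e * eta x) x (probe u v).

Lemma fieldE x u v : field x u v = - (quotient G eta e x (probe u v) *: probe u v).
Proof. by []. Qed.

Lemma nice_field n X i j : niceV n X -> (i < n)%N -> (j < n)%N ->
  niceV n (fun w => field (X w) (w i) (w j)).
Proof.
move=> nX ni nj; apply: niceVN => //; apply: niceVZ => //; last exact: nice_probe.
exact: (nice_quotient e0 nX (nice_probe ni nj)).
Qed.

Lemma field_lip : exists2 C : R, 0 <= C & forall x y u v, enorm u <= M -> enorm v <= M ->
  enorm (field x u v - field y u v) <= C * enorm (x - y).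
Proof.
have [C C0 CP] := quotient_lip dG L0 gradL grad_opt eta1 Ke0 ce0 eta_lip eta_lo B0 e0.
exists (C * B) => [|x y u v uM vM]; first exact: mulr_ge0.
have pB := probe_le uM vM.
rewrite !fieldE -opprD enormN -scalerBl enormZ mulrAC ler_pM//.
exact: CP.
Qed.

Lemma field_bound x : exists2 C : R, 0 <= C & forall u v, enorm u <= M -> enorm v <= M ->
  enorm (field x u v) <= C.
Proof.
have [C C0 CP] := quotient_bound dG L0 gradL grad_opt eta1 ce0 eta_lo B0 x e0.
exists (C * B) => [|u v uM vM]; first exact: mulr_ge0.
have pB := probe_le uM vM.
by rewrite fieldE enormN enormZ ler_pM// CP.
Qed.

Notation hF := (hF P W field).
Notation fbar := (fbar P W field).
Notation EV := (EV P W).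

Lemma fbar_joint x : fbar x = EV (fun w => field x (w 0%N) (w 1%N)).
Proof.
apply/rowP => i; rewrite !mxE.
have nF := nice_field (niceV_cst M 2 x) (isT : 0 < 2)%N (isT : 1 < 2)%N i.
rewrite [RHS](tower nF); apply: E_eq => w wM; rewrite mxE; apply: E_eq => v vM.
by rewrite updE upd_lt.
Qed.

Lemma E_coord n i : E (fun w => w n 0 i) = 0.
Proof. by have := mean0 n i; rewrite /EW /Ex /sample => ->. Qed.

Let nice_coord n k i : (k < n)%N -> nice n (fun w => w k 0 i).
Proof. by move=> kn; exact: (@niceV_coord R d M n k kn i). Qed.

(** Covariance of the probe, its two samples being centred and uncorrelated. *)
Definition noise_mx : 'M[R]_d :=
  p ^+ 2 *: second_moment_mx P (W 1%N) + q ^+ 2 *: second_moment_mx P (W 0%N).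

Let E_second n i j : E (fun w => w n 0 i * w n 0 j) = second_moment_mx P (W n) i j.
Proof. by rewrite mxE. Qed.

Let E_cross i j : E (fun w => w 1%N 0 i * w 0%N 0 j) = 0.
Proof.
have n2 : nice 2 (fun w => w 1%N 0 i * w 0%N 0 j).
  by apply: niceM => //; exact: nice_coord.
rewrite (tower n2); apply: E_eq0 => // w wM.
rewrite /integrate -[RHS](mulr0 (w 0%N 0 j)) -(E_coord 0 i) -(EZ _ (nice_coord i (ltn0Sn 0))).
by apply: E_eq => v vM; rewrite updE upd_lt// mulrC.
Qed.

Let xi w := probe (w 0%N) (w 1%N).

Let nice_xi : niceV 2 xi. Proof. exact: nice_probe. Qed.

Let xi_le w : inball w -> enorm (xi w) <= B.
Proof. by move=> wM; exact: probe_le. Qed.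

Lemma E_probe k : E (fun w => xi w 0 k) = 0.
Proof.
have n0 := nice_coord k (isT : 0 < 2)%N; have n1 := nice_coord k (isT : 1 < 2)%N.
transitivity (E (fun w => p * w 1%N 0 k + q * w 0%N 0 k)).
  by congr (E _); apply/funext => w; rewrite !mxE.
by rewrite (ED (niceZ M0 p n1) (niceZ M0 q n0)) (EZ _ n1) (EZ _ n0) !E_coord !mulr0 addr0.
Qed.

Lemma E_probe2 i j : E (fun w => xi w 0 i * xi w 0 j) = noise_mx i j.
Proof.
have n0 k := nice_coord k (isT : 0 < 2)%N; have n1 k := nice_coord k (isT : 1 < 2)%N.
have m11 := niceM M0 (n1 i) (n1 j); have m00 := niceM M0 (n0 i) (n0 j).
have m10 := niceM M0 (n1 i) (n0 j); have m01 := niceM M0 (n1 j) (n0 i).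
have z11 := niceZ M0 (p ^+ 2) m11; have z00 := niceZ M0 (q ^+ 2) m00.
have z10 := niceZ M0 (p * q) m10; have z01 := niceZ M0 (p * q) m01.
transitivity (E (fun w => p ^+ 2 * (w 1%N 0 i * w 1%N 0 j) + q ^+ 2 * (w 0%N 0 i * w 0%N 0 j) +
   (p * q * (w 1%N 0 i * w 0%N 0 j) + p * q * (w 1%N 0 j * w 0%N 0 i)))).
  by congr (E _); apply/funext => w; rewrite /xi !mxE; ring.
rewrite (ED (niceD z11 z00) (niceD z10 z01)) (ED z11 z00) (ED z10 z01).
rewrite (EZ _ m11) (EZ _ m00) (EZ _ m10) (EZ _ m01) !E_cross !mulr0 !addr0.
by rewrite /noise_mx [RHS]mxE [in RHS]mxE [X in _ = _ + X]mxE !E_second.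
Qed.

Lemma noise_mx_lower : p != 0 ->
  exists2 lam : R, 0 < lam & forall v, lam * enorm v ^+ 2 <= dotv (v *m noise_mx) v.
Proof.
move=> p0; have [c c0 cP] := posdef_lower (pos2 1); have [c' c'0 c'P] := posdef_lower (pos2 0).
exists (p ^+ 2 * c); first by rewrite mulr_gt0// exprn_even_gt0.
move=> v; rewrite mulmxDr -!scalemxAr dotvDl !dotvZl -mulrA.
rewrite -[leLHS]addr0 lerD//; first by rewrite ler_wpM2l.
rewrite mulr_ge0// (le_trans _ (c'P v))// mulr_ge0//.
exact: ltW.
Qed.

(** * The bias of the mean field *)

Let rem x w := taylor_rem G x (e * eta x) (xi w).

Definition drift_error x := EV (fun w => rem x w *: xi w).

Let quotientE x w : quotient G eta e x (xi w) =
  G x / (e * eta x) + dotv (grad G x) (xi w) + rem x w.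
Proof.
rewrite /quotient /rem /taylor_rem; field.
by rewrite !gt_eqF.
Qed.

Let nice_rem x : nice 2 (rem x).
Proof.
have nq := nice_quotient e0 (niceV_cst M 2 x) nice_xi.
have nd := nice_dotv M0 (niceV_cst M 2 (grad G x)) nice_xi.
have nc := nice_cst d M 2 (G x / (e * eta x)).
apply: nice_congr (niceB M0 (niceB M0 nq nc) nd) => w wM.
by rewrite quotientE; ring.
Qed.

(** Expand the quotient to first order: the term of order 1/e is a constant times the centred probe
    and averages out, the linear term produces the covariance, and the Taylor remainder is
    [drift_error]. *)
Lemma fbar_mean_drift x : fbar x = mean_drift G noise_mx drift_error x.
Proof.
rewrite fbar_joint /mean_drift; apply/rowP => k; rewrite [LHS]mxE.
have nk := nice_xi k; have nr := niceM M0 (nice_rem x) nk.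
have nd j := niceM M0 (nice_xi j) nk.
have nc := niceZ M0 (G x / (e * eta x)) nk.
have ns : nice 2 (fun w => \sum_(j < d) grad G x 0 j * (xi w 0 j * xi w 0 k)).
  by apply: nice_sum => j; exact: niceZ.
transitivity (E (fun w => -1 * (G x / (e * eta x) * xi w 0 k +
   \sum_(j < d) grad G x 0 j * (xi w 0 j * xi w 0 k) + rem x w * xi w 0 k))).
  congr (E _); apply/funext => w; rewrite fieldE -/(xi w) quotientE 2!mxE mulN1r !mulrDl.
  by congr (- (_ + _ + _)); rewrite mulr_suml; apply: eq_bigr => j _; rewrite mulrA.
have nb := niceD (niceD nc ns) nr.
rewrite (EZ _ nb) (ED (niceD nc ns) nr) (ED nc ns) (EZ _ nk) E_probe mulr0 add0r.
rewrite (@E_sum _ _ _ _ P W M M0 WM iidW 2) => [|j]; last exact: niceZ.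
rewrite !mxE mulN1r opprD; congr (- _ - _).
  by apply: eq_bigr => j _; rewrite (EZ _ (nd j)) E_probe2.
by congr (E _); apply/funext => w; rewrite [RHS]mxE.
Qed.

(** One constant for both bounds below; its summands come from the size of the Taylor remainder, its
    variation with the base point and its variation with the probe length. *)
Definition error_const : R := (L * (eta opt + Ke) + H * (eta opt + Ke) + 2 * L * Ke) * B ^+ 3.

Lemma error_const_ge0 : 0 <= error_const.
Proof.
have h : 0 <= eta opt + Ke by rewrite addr_ge0// ltW.
by rewrite mulr_ge0 ?exprn_ge0// !addr_ge0 ?mulr_ge0// ltW.
Qed.

Lemma eta_le x : eta x <= (eta opt + Ke) * (1 + enorm (x - opt)).
Proof.
have := eta_lip x opt; rewrite ler_norml => /andP[_]; have := eta0 opt.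
have := mulr_ge0 (ltW (eta0 opt)) (enorm_ge0 (x - opt)).
by move: (enorm _) (eta x) (eta opt) Ke0 => n a b; lra.
Qed.

Lemma drift_error_bound x :
  enorm (drift_error x) <= e * error_const * (1 + enorm (x - opt)).
Proof.
have n0 := enorm_ge0 (x - opt).
have h : 0 <= eta opt + Ke by rewrite addr_ge0// ltW.
apply: (@enorm_EV _ _ _ _ P W M M0 WM iidW 2).
- by rewrite mulr_ge0 ?addr_ge0// mulr_ge0 ?error_const_ge0// ltW.
- by apply: niceVZ.
move=> w wM; rewrite enormZ.
have xB := xi_le wM; have s0 : 0 < e * eta x by rewrite mulr_gt0.
apply: (@le_trans _ _ (L * (e * eta x) * B ^+ 2 * B)).
  rewrite ler_pM// (le_trans (taylor_rem_bound dG gradL x _ (ltW L0) s0))//.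
  apply: ler_wpM2l; first by rewrite mulr_ge0 ?(ltW L0) ?(ltW s0).
  by rewrite lerXn2r ?nnegrE.
rewrite [leLHS](_ : _ = e * B ^+ 3 * L * eta x); last by ring.
rewrite [leRHS](_ : _ = e * B ^+ 3 * L * ((eta opt + Ke) * (1 + enorm (x - opt))) +
  e * B ^+ 3 * (H * (eta opt + Ke) + 2 * L * Ke) * (1 + enorm (x - opt))); last first.
  by rewrite /error_const; ring.
have eB : 0 <= e * B ^+ 3 by rewrite mulr_ge0 ?exprn_ge0// ltW.
rewrite -[leLHS]addr0 lerD//.
  by rewrite ler_wpM2l ?eta_le// mulr_ge0// ltW.
rewrite mulr_ge0 ?addr_ge0// mulr_ge0// addr_ge0 ?mulr_ge0//.
exact: ltW.
Qed.

(** A change of state moves the base point and the probe length; the two effects are separated by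
    inserting the remainder at [y] with the probe length of [x]. *)
Lemma drift_error_lip x y : enorm (drift_error x - drift_error y) <=
  e * error_const * (1 + enorm (x - opt)) * enorm (x - y).
Proof.
have n0 := enorm_ge0 (x - opt); have m0 := enorm_ge0 (x - y).
have h : 0 <= eta opt + Ke by rewrite addr_ge0// ltW.
have nx := niceVZ M0 (nice_rem x) nice_xi; have ny := niceVZ M0 (nice_rem y) nice_xi.
rewrite /drift_error -(EVB M0 WM iidW nx ny).
apply: (@enorm_EV _ _ _ _ P W M M0 WM iidW 2).
- by rewrite mulr_ge0// mulr_ge0 ?addr_ge0// mulr_ge0 ?error_const_ge0// ltW.
- exact: (niceVB M0 nx ny).
move=> w wM; rewrite -scalerBl enormZ.
have xB := xi_le wM.
have sx : 0 < e * eta x by rewrite mulr_gt0.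
have sy : 0 < e * eta y by rewrite mulr_gt0.
have xi2 : enorm (xi w) ^+ 2 <= B ^+ 2 by rewrite lerXn2r ?nnegrE.
have h1 : `|rem x w - rem y w| <= e * B ^+ 2 *
    (H * ((eta opt + Ke) * (1 + enorm (x - opt))) + 2 * L * Ke) * enorm (x - y).
  have -> : rem x w - rem y w =
      (taylor_rem G x (e * eta x) (xi w) - taylor_rem G y (e * eta x) (xi w)) +
      (taylor_rem G y (e * eta x) (xi w) - taylor_rem G y (e * eta y) (xi w)).
    by rewrite addrA subrK.
  rewrite (le_trans (ler_normD _ _))// mulrDr mulrDl lerD//.
    apply: (le_trans (taylor_rem_lip dG dgG hessL x y (xi w) H0 sx)).
    rewrite [leRHS](_ : _ = H * (e * ((eta opt + Ke) * (1 + enorm (x - opt)))) * B ^+ 2 * enorm (x - y)); last by ring.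
    rewrite ler_wpM2r// ler_pM// ?mulr_ge0 ?(ltW e0) ?(ltW (eta0 x))//.
    by rewrite ler_wpM2l// ler_pM2l// eta_le.
  apply: (le_trans (taylor_rem_step dG gradL y (xi w) (ltW L0) sx sy)).
  rewrite -mulrBr normrM (gtr0_norm e0).
  rewrite [leRHS](_ : _ = 2 * L * B ^+ 2 * (e * (Ke * enorm (x - y)))); last by ring.
  have L2 : 0 <= 2 * L by rewrite mulr_ge0// ltW.
  apply: ler_pM.
  - by rewrite mulr_ge0.
  - by rewrite mulr_ge0// ltW.
  - exact: ler_wpM2l.
  - by rewrite ler_pM2l.
rewrite (le_trans (ler_pM _ _ h1 xB))//.
rewrite [leRHS](_ : _ = e * B ^+ 2 *
    (H * ((eta opt + Ke) * (1 + enorm (x - opt))) + 2 * L * Ke) * enorm (x - y) * B +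
    e * B ^+ 3 * (L * (eta opt + Ke) * (1 + enorm (x - opt)) + 2 * L * Ke * enorm (x - opt)) * enorm (x - y)); last first.
  by rewrite /error_const; ring.
rewrite lerDl mulr_ge0// mulr_ge0 ?mulr_ge0 ?exprn_ge0 ?(ltW e0)//.
by rewrite addr_ge0// !mulr_ge0 ?addr_ge0// ltW.
Qed.

End Gain.
Notation EV := (EV P W).

Section Landscape.
Variables (r c1 cg ca : R).
Hypothesis r0 : 0 < r.
Hypothesis c10 : 0 < c1.
Hypothesis cg0 : 0 < cg.
Hypothesis ca0 : 0 < ca.
Hypothesis mono : forall x y, enorm (x - opt) <= r -> enorm (y - opt) <= r ->
  c1 * enorm (y - x) ^+ 2 <= dotv (grad G y - grad G x) (y - x).
Hypothesis glow : forall x, cg * enorm (x - opt) <= enorm (grad G x).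
Hypothesis gap_lo : forall x, ca * enorm (x - opt) ^+ 2 <= G x - G opt.
Hypothesis gap_up : forall x, G x - G opt <= L * enorm (x - opt) ^+ 2.

(** The abstract limit theorem, with the Bregman divergence at [t] as Lyapunov function. [e0] and
    [C2] precede [e] and the step sizes, as the quantifiers of the claim demand. *)
Lemma spsa_variance_cvg : p != 0 -> exists e0 C2 : R, [/\ 0 < e0, 0 <= C2 &
  forall e, 0 < e -> e < e0 -> exists t, [/\ fbar P W (field e) t = 0,
    (forall x, fbar P W (field e) x = 0 -> x = t), enorm (t - opt) <= e * C2 &
    forall (al : nat -> R) (x0 : 'rV[R]_d), (forall n, 0 < al n) -> (forall n, al n <= 1) ->
      (forall n, al n.+1 <= al n) -> al @ \oo --> (0 : R) ->
      (fun n => (al n.+1)^-1 - (al n)^-1) @ \oo --> (0 : R) ->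
      (fun N : nat => N%:R^-1 * (al N)^-1) @ \oo --> (0 : R) ->
      (fun N : nat => N%:R^-1 * (\sum_(n < N) al n) ^+ 2) @ \oo --> (0 : R) ->
      (fun N : nat => N%:R^-1 * E (fun w => enorm (target_sum P W (field e) al x0 N w -
          EV (target_sum P W (field e) al x0 N)) ^+ 2)) @ \oo -->
        noise_variance P W (field e) t]].
Proof.
move=> p0; have [lam lam0 lamP] := noise_mx_lower p0.
have [e0 [C2 [cV [e00 C20 cV0 H1]]]] := mean_drift_lyapunov dG L0 gradL grad_opt r0 c10 cg0 ca0
  mono glow gap_lo gap_up lam0 lamP error_const_ge0.
exists e0, C2; split=> // e ep ee.
have [t [t0 tu tC V_lo V_dec]] := H1 e (drift_error e) ep ee (drift_error_bound ep) (drift_error_lip ep).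
exists t; split=> //.
- by rewrite fbar_mean_drift.
- by move=> x; rewrite fbar_mean_drift//; exact: tu.
move=> al x0 al0 al1 al_dec al_0 dal_0 s1 s2.
(* These bounds depend on [e], which is harmless: [e] is fixed when [N] grows, and they do not enter
   the limit. *)
have [Cl Cl0 ClP] := field_lip ep; have [Cb Cb0 CbP] := field_bound ep t.
have CF0 : 0 <= Num.max Cl Cb by rewrite le_max Cl0.
apply: (@target_bias_variance_cvg _ _ _ _ P W M M0 WM iidW (field e) t (Num.max Cl Cb) _ CF0 _ _
  (bregman G t) (fun x => grad G x - grad G t) cV L cV0 (ltW L0)) => //.
- by move=> n X i j nX ni nj; exact: nice_field.
- move=> x y u v uM vM; rewrite (le_trans (ClP x y u v uM vM))// ler_wpM2r//.
  by rewrite le_max lexx.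
- by move=> u v uM vM; rewrite (le_trans (CbP u v uM vM))// le_max lexx orbT.
- by move=> x; exact: bregman_upper.
- by move=> x u; exact: bregman_step.
- move=> x y; rewrite (_ : _ - _ = grad G x - grad G y)//.
  by move: (grad G x) (grad G y) (grad G t) => a b c; apply/rowP => i; rewrite !mxE; ring.
- by rewrite subrr.
- by move=> x; rewrite fbar_mean_drift.
- by rewrite fbar_mean_drift.
Qed.

End Landscape.

Lemma eta_bound e t C2 : e <= 1 -> 0 <= C2 -> enorm (t - opt) <= e * C2 ->
  eta t <= (eta opt + Ke) * (1 + C2).
Proof.
move=> e1 C20 tC; apply: (le_trans (eta_le t)).
rewrite ler_wpM2l ?addr_ge0 ?(ltW (eta0 opt))// lerD2l (le_trans tC)//.
by rewrite ler_piMl.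
Qed.

(* The part of the field of order 1/e is a multiple of the zig-zag probe, hence telescopes and
   does not contribute to [incr]. *)
Lemma zigzag_variance_upper C2 : q = - p -> 0 <= C2 -> exists K : R, forall e t,
  0 < e -> e <= 1 -> enorm (t - opt) <= e * C2 -> fbar P W (field e) t = 0 ->
  noise_variance P W (field e) t <= K * e ^+ 2.
Proof.
move=> qp C20; pose Kt := (eta opt + Ke) * (1 + C2).
have Kt0 : 0 <= Kt by rewrite mulr_ge0 ?addr_ge0// ltW.
pose K := (L * C2 * B + L * Kt * B ^+ 2) * B.
have K0 : 0 <= K.
  have L0' := ltW L0.
  by rewrite mulr_ge0// addr_ge0// mulr_ge0// mulr_ge0.
exists ((3 * K) ^+ 2) => e t e0 e1 tC ft.
pose g := G t / (e * eta t).
(* The field without its 1/e part. It is O(e): [t] lies within [e * C2] of [opt], so the gradient at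
   [t] is O(e), like the Taylor remainder. *)
pose resid u v : 'rV[R]_d := field e t u v + g *: probe u v.
have s0 : 0 < e * eta t by rewrite mulr_gt0.
have residE u v : resid u v = - ((dotv (grad G t) (probe u v) + taylor_rem G t (e * eta t) (probe u v)) *: probe u v).
  rewrite /resid fieldE -scaleNr -scalerDl -[RHS]scaleNr; congr (_ *: _).
  by rewrite /quotient /g /taylor_rem; field; rewrite !gt_eqF.
have resid_le u v : enorm u <= M -> enorm v <= M -> enorm (resid u v) <= e * K.
  move=> uM vM; have pB := probe_le uM vM.
  rewrite residE enormN enormZ /K mulrA ler_pM//.
  rewrite mulrDr (le_trans (ler_normD _ _))// lerD//.
    have gt : enorm (grad G t) <= L * (e * C2).
      have := gradL t opt; rewrite grad_opt subr0 => /le_trans; apply.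
      by rewrite ler_pM2l.
    rewrite (le_trans (normr_dotv _ _))// (le_trans (ler_pM _ _ gt pB))//.
    by apply: eq_ler; ring.
  rewrite (le_trans (taylor_rem_bound dG gradL t _ (ltW L0) s0))//.
  rewrite [leRHS](_ : _ = L * (e * Kt) * B ^+ 2); last by ring.
  rewrite ler_pM//.
  - by rewrite mulr_ge0// ltW.
  - by rewrite ler_wpM2l ?(ltW L0)// ler_wpM2l ?(ltW e0)//; exact: eta_bound tC.
  - by rewrite lerXn2r ?nnegrE.
have nR u : enorm u <= M -> niceV 1 (fun w => resid u (w 0%N)).
  move=> uM; apply: niceVD; first exact: (niceF1 (@nice_field e e0) t uM).
  apply: niceVZ => //; first exact: nice_cst.
  by apply: niceVD; [apply: niceVZ => //; [exact: nice_cst|exact: niceV_coord]|exact: niceV_cst].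
have hE u : enorm u <= M -> hF P W (field e) t u = (g * p) *: u + EV (fun w => resid u (w 0%N)).
  move=> uM; have np : niceV 1 (fun w => g *: probe u (w 0%N)).
    apply: niceVZ => //; first exact: nice_cst.
    by apply: niceVD; [apply: niceVZ => //; [exact: nice_cst|exact: niceV_coord]|exact: niceV_cst].
  have -> : hF P W (field e) t u = EV (fun w => resid u (w 0%N)) - EV (fun w => g *: probe u (w 0%N)).
    rewrite -(EVB M0 WM iidW (nR u uM) np); congr (EV _).
    by apply/funext => v; rewrite /resid addrK.
  rewrite addrC; congr (_ + _); apply/rowP => i; rewrite !mxE.
  have n1 : nice 1 (fun w => w 0%N 0 i) := @niceV_coord R d M 1 0 isT i.
  rewrite (_ : (fun w => _) = fun w => g * p * w 0%N 0 i + - (g * p * u 0 i)); last first.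
    by apply/funext => w; rewrite /probe qp !mxE; ring.
  rewrite (ED (niceZ M0 _ n1) (nice_cst d M 1 _)) (EZ _ n1) E_coord E_cst.
  by rewrite mulr0 add0r opprK.
have inc u v : enorm u <= M -> enorm v <= M -> enorm (incr P W (field e) t u v) <= 3 * K * e.
  move=> uM vM.
  (* The 1/e parts are [- (g * p) *: (v - u)] from the field, [- (g * p) *: u] and [(g * p) *: v]
     from the two means; they cancel. *)
  have -> : incr P W (field e) t u v =
      resid u v - EV (fun w => resid u (w 0%N)) + EV (fun w => resid v (w 0%N)).
    rewrite /incr /ht ft (hE u uM) (hE v vM) subr0.
    have -> : resid u v = field e t u v + (g * p) *: (v - u).
      by rewrite /resid /probe qp scaleNr -scalerBr scalerA.
    move: (field e t u v) (EV _) (EV _) => a b c.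
    by apply/rowP => i; rewrite !mxE; ring.
  have mean_le x : enorm x <= M -> enorm (EV (fun w => resid x (w 0%N))) <= e * K.
    move=> xM; apply: (enorm_EV M0 WM iidW _ (nR x xM)) => [|w wM]; last exact: resid_le.
    by rewrite mulr_ge0// ltW.
  rewrite (le_trans (enormD _ _))// (_ : 3 * K * e = e * K + e * K + e * K); last by ring.
  by rewrite lerD ?mean_le// (le_trans (enormD _ _))// enormN lerD ?mean_le// resid_le.
rewrite -exprMn -[leRHS]E_cst /noise_variance.
have [Cl Cl0 ClP] := field_lip e0.
have nI : niceV 2 (fun w => incr P W (field e) t (w 0%N) (w 1%N)).
  exact: (nice_incr M0 WM iidW (@nice_field e e0) Cl0 ClP (niceV_cst M 2 t)
    (isT : 0 < 2)%N (isT : 1 < 2)%N).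
apply: (EW_le M0 WM iidW (nice_enorm_sqr M0 nI) (nice_cst d M 2 _)) => w wM.
rewrite lerXn2r ?nnegrE//; last exact: inc.
by apply: mulr_ge0; [exact: mulr_ge0|exact: ltW].
Qed.

Hypothesis mean3 : forall n (i j k : 'I_d), (i <= j <= k)%N ->
  'E_P[(fun s => W n s 0 i * W n s 0 j * W n s 0 k)%R]%E = 0%E.

(** The moment hypothesis concerns ordered indices, so the factors are sorted according to the
    position of [i] relative to [k]. *)
Let E_third (k : 'I_d) : E (fun w => w 1%N 0 k * enorm (w 1%N) ^+ 2) = 0.
Proof.
have nc i : nice 2 (fun w => w 1%N 0 i) := @niceV_coord R d M 2 1 isT i.
transitivity (E (fun w => \sum_(i < d) w 1%N 0 k * (w 1%N 0 i * w 1%N 0 i))).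
  by congr (E _); apply/funext => w; rewrite enorm_sqr mulr_sumr.
rewrite (@E_sum _ _ _ _ P W M M0 WM iidW 2) => [|i]; last first.
  by apply: niceM => //; exact: niceM.
rewrite big1// => i _; case/orP: (leq_total i k) => ik.
  have := @mean3 1 i i k; rewrite leqnn ik => /(_ isT) h.
  rewrite (_ : (fun w => _) = fun w => w 1%N 0 i * w 1%N 0 i * w 1%N 0 k).
    by rewrite /EW /Ex /sample h.
  by apply/funext => w; rewrite mulrC.
have := @mean3 1 k i i; rewrite leqnn ik => /(_ isT) h.
rewrite (_ : (fun w => _) = fun w => w 1%N 0 k * w 1%N 0 i * w 1%N 0 i).
  by rewrite /EW /Ex /sample h.
by apply/funext => w; rewrite mulrA.
Qed.

Lemma second_trace_gt0 : (0 < d)%N -> 0 < E (fun w => enorm (w 1%N) ^+ 2).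
Proof.
move=> d0; pose i0 : 'I_d := Ordinal d0.
have nc i : nice 2 (fun w => w 1%N 0 i) := @niceV_coord R d M 2 1 isT i.
have n2 := niceM M0 (nc i0) (nc i0).
have nw : niceV 2 (fun w => w 1%N) by exact: niceV_coord.
have : 0 < second_moment_mx P (W 1%N) i0 i0.
  have v0 : (delta_mx 0 i0 : 'rV[R]_d) != 0.
    apply/eqP => /rowP /(_ i0); rewrite !mxE !eqxx /= => /eqP.
    by rewrite oner_eq0.
  by have := pos2 1 v0; rewrite dotv_mulmx dotv_delta -rowE mxE.
have -> : second_moment_mx P (W 1%N) i0 i0 = E (fun w => w 1%N 0 i0 * w 1%N 0 i0).
  by rewrite mxE.
move=> /lt_le_trans; apply.
apply: (EW_le M0 WM iidW n2 (nice_enorm_sqr M0 nw)) => w wM.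
by rewrite -expr2 -(real_normK (num_real (w 1%N 0 i0))) lerXn2r ?nnegrE// enorm_coord.
Qed.

(* If [G opt = 0] then [G t] is of the order of [enorm (t - opt) ^+ 2], and the mean of the
   square of the lower bound of [G] at the probed point is bounded below because the third
   moments of the noise vanish; otherwise [G] at the probed point is comparable to [G opt]. *)
Lemma iid_variance_lower (ca C2 : R) : (0 < d)%N -> p = 1 -> q = 0 -> 0 < ca -> 0 <= C2 ->
  (forall x, ca * enorm (x - opt) ^+ 2 <= G x - G opt) ->
  (forall x, G x - G opt <= L * enorm (x - opt) ^+ 2) ->
  exists e1 b0 : R, [/\ 0 < e1, 0 < b0 & forall e t, 0 < e -> e < e1 ->
    enorm (t - opt) <= e * C2 -> fbar P W (field e) t = 0 ->
    b0 * (1 / e ^+ 2) * G t ^+ 2 <= noise_variance P W (field e) t].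
Proof.
move=> d0 p1 q0 ca0 C20 gap_lo gap_up.
pose Kt := (eta opt + Ke) * (1 + C2).
have Kt0 : 0 < Kt.
  by rewrite mulr_gt0// ?ltr_pwDl// (lt_le_trans (eta0 opt))// lerDl.
pose s2 := E (fun w => enorm (w 1%N) ^+ 2).
have s20 : 0 < s2 by exact: second_trace_gt0.
have nw : niceV 2 (fun w => w 1%N) by exact: niceV_coord.
have nw2 := nice_enorm_sqr M0 nw.
have probeE u v : probe u v = v by rewrite /probe p1 q0 scale1r scale0r addr0.
pose Gq e t w := G (t + (e * eta t) *: w 1%N) ^+ 2 * enorm (w 1%N) ^+ 2.
have nGq e t : nice 2 (Gq e t).
  apply: niceM => //; under eq_fun do rewrite expr2; apply: niceM => //;
    apply: (nice_comp M0 (objective_locally_lip dG L0 gradL grad_opt));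
    apply: niceVD; [exact: niceV_cst|apply: niceVZ => //; exact: nice_cst|
                    exact: niceV_cst|apply: niceVZ => //; exact: nice_cst].
have red e t : 0 < e -> e <= 1 -> enorm (t - opt) <= e * C2 -> fbar P W (field e) t = 0 ->
    (e * Kt) ^- 2 * E (Gq e t) <= noise_variance P W (field e) t.
  move=> e0 e1 tC ft.
  (* With [q = 0] the field ignores the older sample, so [hF] is constant and equals [fbar] at [t],
     which is 0; only the field remains in [incr]. *)
  have hconst u v : hF P W (field e) t u = hF P W (field e) t v.
    by congr EV; apply/funext => w; rewrite !fieldE !probeE.
  have h0 u : hF P W (field e) t u = 0.
    rewrite -ft; apply/rowP => i; rewrite [RHS]mxE -[LHS]E_cst.
    by congr (E _); apply/funext => w; rewrite (hconst u (w 0%N)).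
  have [Cl Cl0 ClP] := field_lip e0.
  have nI : niceV 2 (fun w => incr P W (field e) t (w 0%N) (w 1%N)).
    exact: (nice_incr M0 WM iidW (@nice_field e e0) Cl0 ClP (niceV_cst M 2 t)
    (isT : 0 < 2)%N (isT : 1 < 2)%N).
  rewrite -(EZ _ (nGq e t)) /noise_variance.
  apply: (EW_le M0 WM iidW (niceZ M0 _ (nGq e t)) (nice_enorm_sqr M0 nI)) => w wM.
  rewrite /incr /ht !h0 ft !subr0 addr0 fieldE probeE enormN enormZ [leRHS]exprMn real_normK ?num_real//.
  rewrite /Gq mulrA ler_wpM2r// /quotient expr_div_n mulrC.
  have ek0 : 0 < e * Kt by exact: mulr_gt0.
  have ee0 : 0 < e * eta t by exact: mulr_gt0.
  rewrite ler_wpM2l// lef_pV2 ?posrE ?exprn_gt0//.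
  apply: lerXn2r; rewrite ?nnegrE.
  - by rewrite mulr_ge0 ?(ltW e0) ?(ltW (eta0 t)).
  - by rewrite mulr_ge0 ?(ltW e0) ?(ltW Kt0).
  - by rewrite ler_pM2l//; exact: eta_bound tC.
suff [em [b [em0 b0 H1]]] : exists em b : R, [/\ 0 < em, 0 < b & forall e t, 0 < e -> e < em -> e <= 1 ->
    enorm (t - opt) <= e * C2 -> b * G t ^+ 2 <= E (Gq e t)].
  exists (Num.min 1 em), (b / Kt ^+ 2); split.
  - by rewrite lt_min ltr01 em0.
  - by rewrite divr_gt0// exprn_gt0.
  move=> e t e0; rewrite lt_min => /andP[e_1 ee1] tC ft.
  apply: le_trans (red e t e0 (ltW e_1) tC ft).
  rewrite (_ : b / Kt ^+ 2 * (1 / e ^+ 2) * G t ^+ 2 = (e * Kt) ^- 2 * (b * G t ^+ 2)); last first.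
    by field; rewrite !gt_eqF.
  rewrite ler_wpM2l//; first by rewrite invr_ge0 sqr_ge0.
  exact: H1 e0 ee1 (ltW e_1) tC.
have [Go|Go] := eqVneq (G opt) 0.
- exists 1, (ca ^+ 2 * s2 / L ^+ 2); split=> //.
    by rewrite divr_gt0 ?exprn_gt0// mulr_gt0// exprn_gt0.
  move=> e t e0 _ e1 tC; set u := t - opt; set m := enorm u ^+ 2.
  have Gt : G t ^+ 2 <= L ^+ 2 * m ^+ 2.
    have h1 := gap_lo t; have h2 := gap_up t; rewrite Go subr0 in h1 h2.
    have Gt0 : 0 <= G t by rewrite (le_trans _ h1)// mulr_ge0// ltW.
    have m0 : 0 <= m by exact: sqr_ge0.
    by rewrite -exprMn; apply: lerXn2r; rewrite ?nnegrE// mulr_ge0// ltW.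
  (* From [X ^+ 2 >= 2 * X * m - m ^+ 2], where [X] is the squared distance of the probed point to
     [opt]. Apart from the factor [enorm (w 1%N) ^+ 2] the bound is affine in the sample, so its
     varying term is a third moment and has mean zero. *)
  pose low w := ca ^+ 2 * (m ^+ 2 * enorm (w 1%N) ^+ 2 +
     (4 * (e * eta t) * m) * (dotv u (w 1%N) * enorm (w 1%N) ^+ 2)).
  have nd : nice 2 (fun w => dotv u (w 1%N) * enorm (w 1%N) ^+ 2).
    by apply: niceM => //; apply: nice_dotv => //; exact: niceV_cst.
  have nl : nice 2 low by apply: niceZ => //; apply: niceD; apply: niceZ.
  have El : E low = ca ^+ 2 * (m ^+ 2 * s2).
    rewrite (EZ _ (niceD (niceZ M0 _ nw2) (niceZ M0 _ nd))) (ED (niceZ M0 _ nw2) (niceZ M0 _ nd)).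
    rewrite (EZ _ nw2) (EZ _ nd) (_ : E (fun w => dotv u _ * _) = 0) ?mulr0 ?addr0//.
    transitivity (E (fun w => \sum_(k < d) u 0 k * (w 1%N 0 k * enorm (w 1%N) ^+ 2))).
      by congr (E _); apply/funext => w; rewrite mulr_suml; apply: eq_bigr => k _; rewrite mulrA.
    have nk k : nice 2 (fun w => w 1%N 0 k * enorm (w 1%N) ^+ 2) by exact: niceM.
    rewrite (@E_sum _ _ _ _ P W M M0 WM iidW 2) => [|k]; last exact: niceZ.
    by rewrite big1// => k _; rewrite (EZ _ (nk k)) E_third mulr0.
  apply: (@le_trans _ _ (E low)).
    rewrite El; apply: (@le_trans _ _ (ca ^+ 2 * s2 / L ^+ 2 * (L ^+ 2 * m ^+ 2))).
      by apply: ler_wpM2l => //; rewrite divr_ge0// mulr_ge0// ltW.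
    by apply: eq_ler; field; rewrite gt_eqF.
  apply: (EW_le M0 WM iidW nl (nGq e t)) => w wM.
  rewrite /low /Gq.
  set X := enorm (t + (e * eta t) *: w 1%N - opt) ^+ 2.
  have XE : X = m + 2 * (e * eta t) * dotv u (w 1%N) + (e * eta t) ^+ 2 * enorm (w 1%N) ^+ 2.
    by rewrite /X addrAC -/u enormD_sqr dotvZr enormZ exprMn real_normK ?num_real// /m; ring.
  have GX : (ca * X) ^+ 2 <= G (t + (e * eta t) *: w 1%N) ^+ 2.
    have := gap_lo (t + (e * eta t) *: w 1%N); rewrite Go subr0 -/X => h.
    have cX0 : 0 <= ca * X by rewrite mulr_ge0 ?sqr_ge0// ltW.
    by rewrite lerXn2r ?nnegrE// (le_trans cX0).
  have Xm : m ^+ 2 + 4 * (e * eta t) * m * dotv u (w 1%N) <= X ^+ 2.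
    have h1 := sqr_ge0 (X - m).
    have h2 : 0 <= m * ((e * eta t) ^+ 2 * enorm (w 1%N) ^+ 2).
      exact: mulr_ge0 (sqr_ge0 _) (mulr_ge0 (sqr_ge0 _) (sqr_ge0 _)).
    have h3 : X * m = (m + 2 * (e * eta t) * dotv u (w 1%N) +
      (e * eta t) ^+ 2 * enorm (w 1%N) ^+ 2) * m by rewrite -XE.
    move: h1 h2 h3; rewrite sqrrB.
    move: (m) (e * eta t) (dotv _ _) (X ^+ 2) (X) (enorm (w 1%N) ^+ 2) => a b c f x g.
    by rewrite !expr2; lra.
  apply: le_trans (ler_wpM2r (sqr_ge0 _) GX).
  rewrite [leRHS](_ : _ = ca ^+ 2 * (X ^+ 2 * enorm (w 1%N) ^+ 2)); last by ring.
  apply: ler_wpM2l; first exact: sqr_ge0.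
  rewrite [leLHS](_ : _ = (m ^+ 2 + 4 * (e * eta t) * m * dotv u (w 1%N)) * enorm (w 1%N) ^+ 2);
    last by ring.
  by apply: ler_wpM2r => //; exact: sqr_ge0.
have Go0 : 0 < `|G opt| by rewrite normr_gt0.
pose A := L * (C2 + Kt * B) ^+ 2.
have A0 : 0 <= A by rewrite mulr_ge0// ltW.
(* For such [e], the values of [G] at [t] and at the probed point differ from [G opt] by at most
   half of its modulus; their ratio is at most 3, whence the 9. *)
exists (`|G opt| / 2 / (A + 1)), (s2 / 9); split.
- by rewrite divr_gt0 ?divr_gt0// ltr_wpDl.
- exact: divr_gt0.
move=> e t e0 ee1 e1 tC.
have eA := small_mul_lt A0 (divr_gt0 Go0 (ltr0Sn R 1)) (ltW e0) (ltW ee1).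
have close y : enorm (y - opt) <= e * (C2 + Kt * B) -> `|G y - G opt| <= `|G opt| / 2.
  move=> yo; have h := gap_lo y; have h' := gap_up y.
  have h0 : 0 <= G y - G opt by rewrite (le_trans _ h)// mulr_ge0// ltW.
  rewrite ger0_norm// (le_trans h')// (le_trans _ (ltW eA))//.
  have yo2 : enorm (y - opt) ^+ 2 <= e * (C2 + Kt * B) ^+ 2.
    apply: (@le_trans _ _ ((e * (C2 + Kt * B)) ^+ 2)).
      by rewrite lerXn2r ?nnegrE// (le_trans (enorm_ge0 _) yo).
    by rewrite exprMn ler_wpM2r// expr2 ler_piMl// ltW.
  by rewrite (le_trans (ler_wpM2l (ltW L0) yo2))// mulrCA.
have ct : `|G t - G opt| <= `|G opt| / 2.
  by apply: close; rewrite (le_trans tC)// ler_pM2l// lerDl mulr_ge0// ltW.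
have -> : s2 / 9 * G t ^+ 2 = E (fun w => G t ^+ 2 / 9 * enorm (w 1%N) ^+ 2).
  by rewrite (EZ _ nw2) -/s2; field.
apply: (EW_le M0 WM iidW (niceZ M0 _ nw2) (nGq e t)) => w wM.
rewrite /Gq ler_wpM2r//.
have cw : `|G (t + (e * eta t) *: w 1%N) - G opt| <= `|G opt| / 2.
  apply: close; rewrite addrAC (le_trans (enormD _ _))// mulrDr lerD//.
  rewrite enormZ gtr0_norm ?mulr_gt0// -mulrA ler_pM2l// ler_pM ?(ltW (eta0 t))//.
    exact: eta_bound tC.
  by have := probe_le (wM 0%N) (wM 1%N); rewrite probeE.
have ga : `|G opt| / 2 <= `|G (t + (e * eta t) *: w 1%N)|.
  move: cw; move: (G (t + _)) (G opt) => a c h.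
  by have := lerB_dist c a; rewrite distrC; lra.
have gb : `|G t| <= 3 * (`|G opt| / 2).
  move: ct; move: (G t) (G opt) => a c h.
  by have := ler_normD (a - c) c; rewrite subrK; lra.
rewrite ler_pdivrMr// -(real_normK (num_real (G t))) -[X in _ <= X * _](real_normK (num_real _)).
rewrite (_ : 9 = 3 ^+ 2 :> R); last by rewrite -natrX.
rewrite -exprMn lerXn2r ?nnegrE ?mulr_ge0// (le_trans gb)// mulrC ler_pM2r//.
Qed.

(** * The recursion as a functional of the samples *)

Section Recursion.
Variables (e : R) (xi : nat -> T -> 'rV[R]_d) (a : nat -> R) (x0 : 'rV[R]_d).
Hypothesis e0 : 0 < e.
Hypothesis xiE : forall n s, xi n.+1 s = probe (W n s) (W n.+1 s).
Let eps x := e * eta x.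
Let al n := a n.+1.

Lemma mean_field_fbar x : mean_field P G eps xi x = fbar P W (field e) x.
Proof.
rewrite (fbar_joint e0); apply/rowP => i; rewrite !mxE.
by congr (fine (expectation P _)); apply/funext => s; rewrite xiE.
Qed.

(** The step out of [n] uses [a n.+1] and [xi n.+1], which accounts for the shift in [al] and for
    the samples [n] and [n.+1]. *)
Lemma spsa_theta n s : spsa G eps xi a x0 n s = theta (field e) al x0 n (sample W s).
Proof.
elim: n => [//|n IH] /=; rewrite IH xiE -[RHS]/(_ + a n.+1 *: - (_ *: probe (W n s) (W n.+1 s))).
rewrite scalerN scalerA; congr (_ - _ *: _).
by rewrite div1r mulrAC mulrA.
Qed.

Lemma target_bias_sum N s : target_bias P G eps xi a x0 N s =
  N%:R^-1 *: target_sum P W (field e) al x0 N (sample W s).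
Proof.
by congr (_ *: _); apply: eq_bigr => n _; rewrite mean_field_fbar spsa_theta.
Qed.

(** Averaging puts a factor [N ^- 2] on the covariance of the sum. At [N = 0] both sides are 0 by
    the convention for the inverse of 0. *)
Lemma trace_cov_target_bias N : N%:R * \tr (cov_mx P (target_bias P G eps xi a x0 N)) =
  N%:R^-1 * E (fun w => enorm (target_sum P W (field e) al x0 N w -
    EV (target_sum P W (field e) al x0 N)) ^+ 2).
Proof.
have [Cl Cl0 ClP] := field_lip e0.
set S := target_sum P W (field e) al x0 N.
have nS : niceV N.+2 S.
  exact: (nice_target_sum M0 WM iidW (@nice_field e e0) Cl0 ClP).
pose D i w := S w 0 i - EV S 0 i.
have nD i : nice N.+2 (D i) by apply: niceB => //; exact: nice_cst.
have nDD i : nice N.+2 (fun w => D i w * D i w) by exact: niceM.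
have covE i : cov_mx P (target_bias P G eps xi a x0 N) i i =
    N%:R^-1 ^+ 2 * E (fun w => D i w * D i w).
  rewrite mxE unlock -(EZ _ (nDD i)).
  have XE : (fun s => target_bias P G eps xi a x0 N s 0 i) =
      (fun s => N%:R^-1 * S (sample W s) 0 i).
    by apply/funext => s; rewrite target_bias_sum mxE.
  have mE : fine ('E_P[(fun s => target_bias P G eps xi a x0 N s 0 i)%R])%E = N%:R^-1 * EV S 0 i.
    by rewrite XE mxE -(EZ _ (nS i)).
  congr (fine (expectation P _)); apply/funext => s; rewrite mE XE /D.
  change ((N%:R^-1 * S (sample W s) 0 i - N%:R^-1 * EV S 0 i) *
    (N%:R^-1 * S (sample W s) 0 i - N%:R^-1 * EV S 0 i) = N%:R^-1 ^+ 2 *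
    ((S (sample W s) 0 i - EV S 0 i) * (S (sample W s) 0 i - EV S 0 i))).
  by ring.
have -> : E (fun w => enorm (S w - EV S) ^+ 2) = \sum_(i < d) E (fun w => D i w * D i w).
  rewrite -(@E_sum _ _ _ _ P W M M0 WM iidW N.+2)//.
  congr (E _); apply/funext => w; rewrite enorm_sqr; apply: eq_bigr => i _.
  by rewrite /D mxE [(- EV S) 0 i]mxE.
rewrite /mxtrace (eq_bigr _ (fun i _ => covE i)) -mulr_sumr mulrA; congr (_ * _).
have [->|N0] := eqVneq (N%:R : R) 0; first by rewrite mul0r invr0.
by rewrite expr2 mulrA mulfV// mul1r.
Qed.

End Recursion.

End Spsa.

(** * Step sizes *)

Section StepSize.
Context {R : realType}.
Implicit Types (s rho alpha : R) (n N : nat).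

Lemma cvg_powR_neg s : 0 < s -> (fun n => n.+1%:R `^ (- s) : R) @ \oo --> (0 : R).
Proof.
move=> s0.
have e2 n : n.+1%:R `^ (- s) = (n.+1%:R^-1 : R) `^ s.
  by rewrite -powR_inv1// -powRrM mulN1r.
apply/cvgrPdist_le => e e0.
have ee0 : 0 < e `^ s^-1 by exact: powR_gt0.
have /cvgrPdist_le /(_ _ ee0) := @cvg_harmonic R.
apply: filterS => n /=; rewrite !sub0r !normrN e2 ger0_norm//.
move=> h; rewrite ger0_norm ?powR_ge0//.
rewrite (le_trans (ge0_ler_powR (ltW s0) _ _ h)) ?nnegrE ?invr_ge0 ?powR_ge0//.
by rewrite -powRrM mulVf ?gt_eqF// powRr1// ltW.
Qed.

(* The induction step is Young's inequality for [N ^ (1 - rho)] and [(N + 1) ^ rho]. *)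
Lemma powR_harmonic_sum rho N : 0 < rho -> rho < 1 ->
  \sum_(n < N) n.+1%:R `^ (- rho) <= (1 - rho)^-1 * N%:R `^ (1 - rho) :> R.
Proof.
move=> r0 r1; have d0 : 0 < 1 - rho by rewrite subr_gt0.
elim: N => [|N IH]; first by rewrite big_ord0 mulr_ge0// ?powR_ge0// invr_ge0 ltW.
rewrite big_ord_recr/= (le_trans (lerD IH (lexx _)))//.
have N10 : (0 : R) < N.+1%:R by [].
have := @conjugate_powR R (N%:R `^ (1 - rho)) (N.+1%:R `^ rho) ((1 - rho)^-1) (rho^-1).
rewrite !powR_ge0 !invr_gt0 !invrK subrK -!powRrM !mulfV ?gt_eqF// !powRr1//.
move=> /(_ isT isT d0 r0 erefl) Y.
have b0 : 0 < (N.+1%:R : R) `^ rho by exact: powR_gt0.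
have -> : (N.+1%:R : R) `^ (- rho) = (N.+1%:R `^ rho)^-1 by rewrite powRN.
have -> : (N.+1%:R : R) `^ (1 - rho) = N.+1%:R / N.+1%:R `^ rho.
  by rewrite powRD ?powRr1 ?powRN// (gt_eqF N10) implybT.
rewrite -(ler_pM2r d0) -(ler_pM2r b0).
move: Y b0 d0; set u := _ `^ (1 - rho); set v := _ `^ rho => Y b0 d0.
have -> : ((1 - rho)^-1 * u + v^-1) * (1 - rho) * v = u * v + (1 - rho).
  by field; rewrite !gt_eqF.
have -> : (1 - rho)^-1 * (N.+1%:R / v) * (1 - rho) * v = N.+1%:R.
  by field; rewrite !gt_eqF.
rewrite -natr1; move: Y; rewrite -natr1; move: (N%:R : R) => z.
lra.
Qed.

(** * Decay of the step-size schedule *)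

Section Schedule.
Variables (alpha rho : R).
Hypotheses (alpha0 : 0 < alpha) (alpha1 : alpha <= 1).
Hypotheses (rho_half : 1 / 2 < rho) (rho1 : rho < 1).
Let al n := step_size alpha rho n.+1.

Let rho0 : 0 < rho. Proof. by move: rho_half; lra. Qed.

Let powN n : (n.+1%:R : R) `^ (- rho) = (n.+1%:R `^ rho)^-1.
Proof. by rewrite powRN. Qed.

Let pow0 n : 0 < (n.+1%:R : R) `^ rho. Proof. exact: powR_gt0. Qed.

Let pow_le n : (n.+1%:R : R) `^ rho <= n.+2%:R `^ rho.
Proof. by rewrite ge0_ler_powR ?nnegrE ?ler_nat ?ltW. Qed.

(** From [(1 + 1/n) ^ rho <= 1 + 1/n], valid as [rho < 1]; it makes the increments of [n ^ rho] tend
    to 0. *)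
Let powS n : (n.+2%:R : R) `^ rho <= n.+1%:R `^ rho + n.+1%:R `^ (- (1 - rho)).
Proof.
have n0 : (0 : R) < n.+1%:R by [].
have -> : (n.+2%:R : R) = n.+1%:R * (1 + n.+1%:R^-1).
  by rewrite mulrDr mulr1 mulfV ?gt_eqF// natr1.
have h1 : (1 : R) <= 1 + n.+1%:R^-1 by rewrite lerDl invr_ge0.
have h0 : (0 : R) <= 1 + n.+1%:R^-1 by exact: le_trans h1.
rewrite powRM//.
rewrite (le_trans (ler_wpM2l (ltW (pow0 n)) (ler_powR h1 (ltW rho1))))//.
rewrite powRr1// mulrDr mulr1 lerD2l opprB powRD; last by rewrite (gt_eqF n0) implybT.
by rewrite powRN powRr1.
Qed.

Lemma step_size_gt0 n : 0 < al n.
Proof. by rewrite /al /step_size lt_min alpha0 powR_gt0. Qed.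

Lemma step_size_le1 n : al n <= 1.
Proof. by rewrite /al /step_size ge_min alpha1. Qed.

Lemma step_size_powR n : al n <= n.+1%:R `^ (- rho).
Proof. by rewrite /al /step_size ge_min lexx orbT. Qed.

Lemma step_size_decr n : al n.+1 <= al n.
Proof.
rewrite /al /step_size le_min ge_min lexx/= ge_min; apply/orP; right.
by rewrite !powN lef_pV2 ?posrE.
Qed.

Lemma inv_step_size n : (al n)^-1 = Num.max alpha^-1 (n.+1%:R `^ rho).
Proof.
rewrite /al /step_size powN; case: (leP alpha) => h.
  by rewrite max_l// -[leLHS]invrK lef_pV2 ?posrE ?invr_gt0.
by rewrite invrK max_r// -[leRHS]invrK lef_pV2 ?posrE ?invr_gt0 ?ltW.
Qed.

Lemma step_size_cvg0 : al @ \oo --> (0 : R).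
Proof.
apply: (squeeze_cvgr _ (cvg_cst _) (cvg_powR_neg rho0)).
by apply: nearW => n; rewrite step_size_powR ltW ?step_size_gt0.
Qed.

(** Taking the maximum with [alpha^-1] cannot enlarge an increment of [n ^ rho]. *)
Lemma inv_step_size_increment : (fun n => (al n.+1)^-1 - (al n)^-1) @ \oo --> (0 : R).
Proof.
have r1 : 0 < 1 - rho by rewrite subr_gt0.
apply: (squeeze_cvgr _ (cvg_cst _) (cvg_powR_neg r1)).
apply: nearW => n; rewrite subr_ge0 lef_pV2 ?posrE ?step_size_gt0// step_size_decr/=.
rewrite !inv_step_size; have pS := powS n; have pl := pow_le n.
have c0 : 0 <= (n.+1%:R : R) `^ (- (1 - rho)) by exact: powR_ge0.
move: c0 pl pS; set c := _ `^ (- (1 - rho)); set b := n.+2%:R `^ rho.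
set a := n.+1%:R `^ rho; move: c b a alpha^-1 => c b a i c0 ab bc.
rewrite /Num.max; case: ltP => ?; case: ltP => ?; lra.
Qed.

Lemma inv_step_size_average : (fun N : nat => N%:R^-1 * (al N)^-1) @ \oo --> (0 : R).
Proof.
have r1 : 0 < 1 - rho by rewrite subr_gt0.
rewrite -cvg_shiftS/=.
have h : (fun N : nat => alpha^-1 * N.+1%:R^-1 + 2 * N.+1%:R `^ (- (1 - rho))) @ \oo --> (0 : R).
  rewrite -[X in _ --> X](_ : alpha^-1 * 0 + 2 * 0 = 0 :> R); last by rewrite !mulr0 addr0.
  apply: cvgD; apply: cvgM; try exact: cvg_cst.
    exact: cvg_harmonic.
  exact: cvg_powR_neg.
apply: (squeeze_cvgr _ (cvg_cst _) h); apply: nearW => N.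
rewrite mulr_ge0 ?invr_ge0 ?(ltW (step_size_gt0 _))//=.
have n0 : (0 : R) < N.+1%:R by [].
have n1 : (1 : R) <= N.+1%:R by rewrite ler1n.
have -> : (N.+1%:R : R) `^ (- (1 - rho)) = N.+1%:R^-1 * N.+1%:R `^ rho.
  rewrite opprB addrC powRD; last by rewrite (gt_eqF n0) implybT.
  by rewrite powR_inv1.
rewrite [leRHS](_ : _ = N.+1%:R^-1 * (alpha^-1 + 2 * N.+1%:R `^ rho)); last by ring.
rewrite ler_wpM2l ?invr_ge0// inv_step_size.
have hp : (N.+1%:R : R) `^ (- (1 - rho)) <= N.+1%:R `^ rho by rewrite ler_powR//; move: rho_half; lra.
have i0 : 0 < alpha^-1 by rewrite invr_gt0.
move: hp i0 (pow0 N) (powS N); set c := _ `^ (- (1 - rho)); set b := N.+2%:R `^ rho.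
set a := N.+1%:R `^ rho; move: c b a alpha^-1 => c b a i ca i0 a0 bc.
rewrite /Num.max; case: ltP => ?; lra.
Qed.

(** The sum is O(N ^ (1 - rho)), so the expression is O(N ^ (1 - 2 * rho)), which vanishes because
    [rho > 1/2]. *)
Lemma step_size_sum_average :
  (fun N : nat => N%:R^-1 * (\sum_(n < N) al n) ^+ 2) @ \oo --> (0 : R).
Proof.
have r1 : 0 < 1 - rho by rewrite subr_gt0.
have r2 : 0 < 2 * rho - 1 by move: rho_half; lra.
rewrite -cvg_shiftS/=.
have h : (fun N : nat => (1 - rho)^-1 ^+ 2 * N.+1%:R `^ (- (2 * rho - 1))) @ \oo --> (0 : R).
  rewrite -[X in _ --> X](_ : (1 - rho)^-1 ^+ 2 * 0 = 0 :> R); last by rewrite !mulr0.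
  by apply: cvgM; [exact: cvg_cst|exact: cvg_powR_neg].
apply: (squeeze_cvgr _ (cvg_cst _) h); apply: nearW => N.
rewrite mulr_ge0 ?invr_ge0//=.
have n0 : (0 : R) < N.+1%:R by [].
have S0 : 0 <= \sum_(n < N.+1) al n by rewrite sumr_ge0// => n _; rewrite (ltW (step_size_gt0 _)).
have S1 : \sum_(n < N.+1) al n <= (1 - rho)^-1 * N.+1%:R `^ (1 - rho).
  by apply: le_trans (powR_harmonic_sum _ rho0 rho1); apply: ler_sum => n _; exact: step_size_powR.
rewrite (le_trans (ler_wpM2l _ (ler_pM _ _ S1 S1)))// ?invr_ge0//.
have -> : - (2 * rho - 1) = -1 + (1 - rho) + (1 - rho) by ring.
rewrite !powRD ?powR_inv1 ?(gt_eqF n0) ?implybT//.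
by apply: eq_ler; ring.
Qed.

End Schedule.
End StepSize.

(** * Constants extracted from the assumptions, and the conclusion *)

Lemma lipschitz_le (R : realType) (U V : normedModType R) (f : U -> V) : lipschitz f ->
  exists2 k : R, 0 < k & forall x y, `|f x - f y| <= k * `|x - y|.
Proof.
move=> [A [_ hA]]; exists (Num.max A 0 + 1).
  by rewrite ltr_wpDl// le_max lexx orbT.
move=> x y; apply: (hA (Num.max A 0 + 1) _ (x, y)) => //.
by rewrite (le_lt_trans (_ : A <= Num.max A 0)) ?ltrDl// le_max lexx.
Qed.

Lemma lipschitz_enorm (R : realType) (d : nat) (f : 'rV[R]_d -> 'rV[R]_d) : lipschitz f ->
  exists2 L : R, 0 < L & forall x y, enorm (f x - f y) <= L * enorm (x - y).
Proof.
move=> /lipschitz_le[k k0 kP]; exists (d.+1%:R * k); first by rewrite mulr_gt0.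
move=> x y; rewrite (le_trans (enorm_mx_norm _))// -mulrA ler_pM ?ler_nat//.
by rewrite (le_trans (kP x y))// ler_pM2l// mx_norm_enorm.
Qed.

Lemma lipschitz_mx_enorm (R : realType) (d : nat) (f : 'rV[R]_d -> 'M[R]_d) : lipschitz f ->
  exists2 H : R, 0 <= H & forall x y u,
    enorm (u *m f x - u *m f y) <= H * enorm u * enorm (x - y).
Proof.
move=> /lipschitz_le[k k0 kP]; exists (d%:R ^+ 2 * k); first by rewrite mulr_ge0 ?(ltW k0).
move=> x y u; rewrite -mulmxBr (le_trans (enorm_mulmx _ _))//.
have fk : `|f x - f y| <= k * enorm (x - y).
  by rewrite (le_trans (kP x y))// ler_pM2l// mx_norm_enorm.
rewrite [leRHS]mulrAC ler_wpM2r// -[leRHS]mulrA.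
by rewrite ler_wpM2l.
Qed.

Lemma compact_enorm_bound (R : realType) (d : nat) (K : set 'rV[R]_d) : compact K ->
  exists2 M : R, 0 <= M & forall x, K x -> enorm x <= M.
Proof.
move=> /compact_bounded[A [_ hA]]; exists (d%:R * (Num.max A 0 + 1)).
  by rewrite mulr_ge0// addr_ge0// le_max lexx orbT.
move=> x Kx; rewrite (le_trans (enorm_mx_norm _))// ler_wpM2l//.
apply: hA => //.
by rewrite (le_lt_trans (_ : A <= Num.max A 0)) ?ltrDl// le_max lexx.
Qed.

Theorem proposition2p2 (R : realType) (d : nat) (disp : measure_display)
    (T : measurableType disp) (P : probability T R)
    (Gam : 'rV[R]_d -> R) (theta_opt : 'rV[R]_d) (g : gain_form R d)
    (W : nat -> T -> 'rV[R]_d) (rho : R) (theta0 : 'rV[R]_d) :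
  (0 < d)%N ->
  1 / 2 < rho -> rho < 1 ->
  gain_ok Gam g ->
  smooth_objective Gam ->
  stable_gradient_flow Gam theta_opt ->
  exploration_noise P W ->
  (exists alpha0 eps0 b0 : R, [/\ 0 < alpha0, 0 < eps0, 0 < b0 &
     forall alpha e : R, 0 < alpha -> alpha <= alpha0 -> 0 < e -> e < eps0 ->
       exists theta_star : 'rV[R]_d,
         (forall theta, mean_field P Gam (gain Gam g e) W theta = 0 <->
                        theta = theta_star) /\
         exists L : R,
           (fun N : nat => N%:R * \tr (cov_mx P
              (target_bias P Gam (gain Gam g e) W (step_size alpha rho)
                 theta0 N))) @ \oo --> L /\
           b0 * (1 / e ^+ 2) * Gam theta_star ^+ 2 <= L]) /\
  (forall zeta : R, 0 < zeta ->
   exists alpha0 eps0 b1 : R, [/\ 0 < alpha0, 0 < eps0 &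
     forall alpha e : R, 0 < alpha -> alpha <= alpha0 -> 0 < e -> e < eps0 ->
       exists L : R,
         (fun N : nat => N%:R * \tr (cov_mx P
            (target_bias P Gam (gain Gam g e) (zigzag zeta W)
               (step_size alpha rho) theta0 N))) @ \oo --> L /\
         L <= b1 * e ^+ 2]).
Proof.
move=> d0 rho_half rho1 okg [dG dgG _ [/lipschitz_enorm[L L0 gradL]
  /lipschitz_mx_enorm[H H0 hessL]] [delta delta0 far]] [_ gradE /posdef_lower[c0 c00 hess_opt]].
move=> [iidW [K /compact_enorm_bound[M M0 KM] WK] mean0 mean3 pos2].
have WM n t : enorm (W n t) <= M by apply: KM.
have grad_opt : grad Gam theta_opt = 0 by exact/gradE.
have r0 := mono_radius_gt0 H0 c00.
have mono := grad_mono dgG H0 hessL c00 hess_opt.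
have c10 : 0 < c0 / 2 by rewrite divr_gt0.
have [cg cg0 glow] := grad_lower dgG H0 hessL gradE c00 hess_opt delta0 far.
have [ca ca0 gap_lo] := gap_lower dG dgG L0 H0 gradL hessL gradE c00 hess_opt delta0 far.
have gap_up := gap_upper dG L0 gradL gradE.
have [eta [Ke [ce [gainE eta1 Ke0 ce0 [eta_lip eta_lo]]]]] :=
  gain_factor dG L0 gradL grad_opt ca0 gap_lo okg.
have gE e : gain Gam g e = fun x => e * eta x by apply/funext => x; exact: gainE.
(* Stated for any exploration sequence that realises the probe from index 1 on, whatever its value
   at index 0, so that it serves both designs. *)
have limit p q : p != 0 -> exists e0 C2 : R, [/\ 0 < e0, 0 <= C2 &
    forall e, 0 < e -> e < e0 -> exists t, [/\ enorm (t - theta_opt) <= e * C2,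
      fbar P W (field Gam eta p q e) t = 0 &
      forall xi, (forall n s, xi n.+1 s = probe p q (W n s) (W n.+1 s)) ->
      (forall theta, mean_field P Gam (gain Gam g e) xi theta = 0 <-> theta = t) /\
      forall alpha, 0 < alpha -> alpha <= 1 ->
        (fun N : nat => N%:R * \tr (cov_mx P (target_bias P Gam (gain Gam g e) xi
          (step_size alpha rho) theta0 N))) @ \oo --> noise_variance P W (field Gam eta p q e) t]].
  move=> p0; have [e0 [C2 [e00 C20 HC]]] := spsa_variance_cvg M0 WM iidW mean0 pos2 dG dgG L0 H0
    gradL hessL grad_opt eta1 Ke0 ce0 eta_lip eta_lo q r0 c10 cg0 ca0 mono glow gap_lo gap_up p0.
  exists e0, C2; split=> // e ep ee; have [t [t0 tu tC cvg_t]] := HC e ep ee.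
  exists t; split=> // xi xiE; rewrite gE; split=> [x|alpha a0 a1].
    rewrite (mean_field_fbar M0 WM iidW dG L0 gradL grad_opt eta1 Ke0 eta_lip ep xiE).
    by split=> [/tu|->].
  under eq_fun do rewrite (trace_cov_target_bias M0 WM iidW dG L0 gradL grad_opt eta1 Ke0 ce0
    eta_lip eta_lo (step_size alpha rho) theta0 ep xiE).
  apply: cvg_t.
  - exact: step_size_gt0.
  - exact: step_size_le1.
  - exact: step_size_decr.
  - exact: step_size_cvg0.
  - exact: inv_step_size_increment.
  - exact: inv_step_size_average.
  - exact: step_size_sum_average.
split=> [|zeta z0].
  have [e0 [C2 [e00 C20 lim]]] := limit 1 0 (oner_neq0 R).
  have [e1 [b0 [e10 b00 lower]]] := iid_variance_lower M0 WM iidW pos2 dG L0 gradL grad_opt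
    eta1 Ke0 ce0 eta_lip eta_lo mean3 d0 (erefl 1) (erefl 0) ca0 C20 gap_lo gap_up.
  (* [alpha0 = 1] keeps every step size at most 1, as the moment bound requires. *)
  exists 1, (Num.min e0 e1), b0; split=> //; first by rewrite lt_min e00.
  move=> alpha e a0 a1 ep; rewrite lt_min => /andP[ee0 ee1].
  have [t [tC t0 /(_ W)[|tE cvg_t]]] := lim e ep ee0.
    by move=> n s; rewrite /probe scale1r scale0r addr0.
  exists t; split=> //; exists (noise_variance P W (field Gam eta 1 0 e) t); split; first exact: cvg_t.
  exact: lower.
have [e0 [C2 [e00 C20 lim]]] := limit zeta (- zeta) (lt0r_neq0 z0).
have [b1 upper] := zigzag_variance_upper M0 WM iidW mean0 dG L0 gradL grad_opt
  eta1 Ke0 ce0 eta_lip eta_lo (erefl (- zeta)) C20.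
(* [e <= 1] makes the bound on [eta] at the zero uniform in [e]. *)
exists 1, (Num.min e0 1), b1; split=> //; first by rewrite lt_min e00/=.
move=> alpha e a0 a1 ep; rewrite lt_min => /andP[ee0 ee1].
have [t [tC t0 /(_ (zigzag zeta W))[|_ cvg_t]]] := lim e ep ee0.
  by move=> n s; rewrite /probe /zigzag scalerBr scaleNr.
exists (noise_variance P W (field Gam eta zeta (- zeta) e) t); split; first exact: cvg_t.
by apply: upper => //; exact: ltW.
Qed.
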